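(* Let $-1\leq b<a\leq 1$, let $\alpha\in(0,1]$, let $n\geq 1$ be an integer, and let $\Phi$ be a convex non-decreasing function on $(-\infty,\infty)$. Then for every $f\in T_n^\alpha[a,b]$ and every $r\in(0,1)$, $$\int_{-\pi}^\pi\Phi\left(-\log|f'(re^{i\theta})|\right)d\theta\leq\int_{-\pi}^\pi\Phi\left(-\log\left|\frac{L_{n-1}(a,b:re^{i\theta})\,k'(re^{i\theta})^{1-\alpha}}{L_0(re^{i\theta})^{1-\alpha}}\right|\right)d\theta,$$ where $k(z)=z/(1-z)^2$ is the Koebe function, $L_0(z)=(1+z)/(1-z)$, $L_0(a,b:z)=(1+az)/(1+bz)$, and $$L_m(a,b:z)=\frac{\alpha}{z^\alpha}\int_0^z t^{\alpha-1}L_{m-1}(a,b:t)\,dt,\qquad m\geq 1.$$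
   Context: Let $A$ be the class of analytic functions $f(z)=z+a_2z^2+\cdots$ in the unit disk $|z|<1$. For $-1\leq b<a\leq 1$, $P[a,b]$ is the family of Janowski functions: analytic functions $p(z)=1+c_1z+\cdots$ in $|z|<1$ that are subordinate to $L_0(a,b:z)=(1+az)/(1+bz)$, i.e. $p(z)=L_0(a,b:w(z))$ for some analytic $w$ in $|z|<1$ with $w(0)=0$ and $|w(z)|<1$. The Salagean derivative is $D^0g(z)=g(z)$, $D^ng(z)=z[D^{n-1}g(z)]'$ for $n\geq1$. For $\alpha>0$, the class $T_n^\alpha[a,b]$ consists of the functions $f\in A$ such that $$\frac{D^n\big(f(z)^\alpha\big)}{\alpha^n z^\alpha}\in P[a,b].$$ Here $D^n$ is applied to the function $f(z)^\alpha$, and powers are principal determinations: $f(z)\neq0$ for $0<|z|<1$, and $f(z)^\alpha=z^\alpha F(z)$, where $F(z)=(f(z)/z)^\alpha$ is the analytic branch with $F(0)=1$. Thus $D^n(f(z)^\alpha)/z^\alpha=\big(\alpha+z\frac{d}{dz}\big)^nF(z)$ is a single-valued analytic function. The integral defining $L_m$ is understood so that $L_m$ is analytic in $|z|<1$: $L_m(a,b:z)=\alpha\int_0^1 s^{\alpha-1}L_{m-1}(a,b:sz)\,ds$. The functions $L_m$ depend on $\alpha$. Only moduli of the powers with exponent $1-\alpha$ enter the claim. *)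

(* Defs.v *)
From Stdlib Require Import Reals Lra Lia.
From Coquelicot Require Import Coquelicot.

Local Open Scope C_scope.

Definition unit_disk (z : C) : Prop := (Cmod z < 1)%R.

(* Functions on the disk are total functions [C -> C] whose values outside the
   disk are irrelevant; the disk is open, so derivatives at its points only
   depend on the values inside. *)
Definition analytic_disk (f : C -> C) : Prop :=
  forall z : C, unit_disk z -> ex_derive (K := C_AbsRing) (V := C_NormedModule) f z.

Definition Cexp (z : C) : C :=
  ((exp (Re z) * cos (Im z))%R, (exp (Re z) * sin (Im z))%R).

Definition polar (r theta : R) : C := ((r * cos theta)%R, (r * sin theta)%R).

Definition convex (Phi : R -> R) : Prop :=
  forall x y t : R, (0 <= t <= 1)%R ->
    (Phi (t * x + (1 - t) * y) <= t * Phi x + (1 - t) * Phi y)%R.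

Definition class_A (f : C -> C) : Prop :=
  analytic_disk f /\ f 0 = 0 /\ C_derive f 0 = 1.

Definition janowski_map (a b : R) (z : C) : C := (1 + a * z) / (1 + b * z).

Definition janowski (a b : R) (p : C -> C) : Prop :=
  analytic_disk p /\ p 0 = 1 /\
  exists w : C -> C,
    analytic_disk w /\ w 0 = 0 /\
    (forall z, unit_disk z -> (Cmod (w z) < 1)%R) /\
    (forall z, unit_disk z -> p z = janowski_map a b (w z)).

(* [F] is the analytic branch of [(f(z)/z)^alpha] with [F(0) = 1], i.e.
   [exp (alpha * l)] for the analytic logarithm [l] of [f(z)/z] with [l(0) = 0].
   In particular [f(z) <> 0] for [0 < |z| < 1]. *)
Definition power_branch (alpha : R) (f F : C -> C) : Prop :=
  exists l : C -> C,
    analytic_disk l /\ l 0 = 0 /\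
    (forall z, unit_disk z -> f z = z * Cexp (l z)) /\
    (forall z, unit_disk z -> F z = Cexp (alpha * l z)).

Definition salagean (n : nat) (g : C -> C) : C -> C :=
  Nat.iter n (fun h z => z * C_derive h z) g.

(* [D^n (z^alpha F) / z^alpha = (alpha + z d/dz)^n F], see [salagean_power]; unlike
   [z^alpha] itself, the right-hand side is single-valued on the whole disk. *)
Definition twisted_salagean (alpha : R) (n : nat) (F : C -> C) : C -> C :=
  Nat.iter n (fun G z => alpha * G z + z * C_derive G z) F.

(* Every local analytic branch [q] of [z^alpha] satisfies [q' = alpha q / z]. *)
Lemma salagean_power (alpha : R) (U : C -> Prop) (q F : C -> C) (n : nat) :
  open (T := AbsRing_UniformSpace C_AbsRing) U ->
  (forall z, U z -> z <> 0) ->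
  (forall z, U z ->
     is_derive (K := C_AbsRing) (V := C_NormedModule) q z (alpha * q z / z)) ->
  (forall k z, (k < n)%nat -> U z ->
     ex_derive (K := C_AbsRing) (V := C_NormedModule) (twisted_salagean alpha k F) z) ->
  forall z, U z ->
    salagean n (fun x => q x * F x) z = q z * twisted_salagean alpha n F z.
Proof.
intros HU H0 Hq.
induction n as [|n IH]; intros HF z Hz; [reflexivity|].
set (G := twisted_salagean alpha n F).
assert (HG : is_derive (K := C_AbsRing) (V := C_NormedModule) G z (C_derive G z)).
{ apply C_derive_correct; [exact 0|]. apply HF; [lia|exact Hz]. }
assert (HD : is_derive (K := C_AbsRing) (V := C_NormedModule)
               (salagean n (fun x => q x * F x)) z
               (alpha * q z / z * G z + q z * C_derive G z)).
{ apply is_derive_ext_loc with (fun x => q x * G x).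
  - apply filter_imp with (2 := HU z Hz). intros x Hx. symmetry.
    apply IH; [|exact Hx]. intros k y Hk. apply HF. lia.
  - destruct (Hq z Hz) as [[q1 q2 q3] q4], HG as [[g1 g2 g3] g4].
    assert (H : is_derive (K := C_AbsRing) (V := AbsRing_NormedModule C_AbsRing)
                  (fun x => q x * G x) z
                  (alpha * q z / z * G z + q z * C_derive G z)).
    { apply (is_derive_mult (K := C_AbsRing) q G z (alpha * q z / z) (C_derive G z)).
      - split; [split; [exact q1|exact q2|exact q3]|exact q4].
      - split; [split; [exact g1|exact g2|exact g3]|exact g4].
      - exact Cmult_comm. }
    destruct H as [[h1 h2 h3] h4].
    split; [split; [exact h1|exact h2|exact h3]|exact h4]. }
change (z * C_derive (salagean n (fun x => q x * F x)) z =
        q z * (alpha * G z + z * C_derive G z)).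
rewrite (is_C_derive_unique _ _ _ HD).
field. exact (H0 z Hz).
Qed.

Definition class_T (n : nat) (alpha a b : R) (f : C -> C) : Prop :=
  class_A f /\
  exists F : C -> C,
    power_branch alpha f F /\
    janowski a b (fun z => twisted_salagean alpha n F z / RtoC (alpha ^ n)).

(* The substitution [t = s z] in [alpha z^(-alpha) int_0^z t^(alpha-1) L_(m-1)(t) dt].
   The integral is improper at [s = 0] when [alpha < 1]. *)
Fixpoint Lfun (alpha a b : R) (m : nat) (z : C) : C :=
  match m with
  | O => janowski_map a b z
  | S m' =>
      alpha * RInt_gen (V := C_R_CompleteNormedModule)
                (fun s : R => RtoC (Rpower s (alpha - 1)) * Lfun alpha a b m' (s * z))
                (at_right 0%R) (at_point 1%R)
  end.

Definition koebe (z : C) : C := z / ((1 - z) * (1 - z)).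

Definition L0 (z : C) : C := (1 + z) / (1 - z).

(* [|L_(n-1)(a,b:z) k'(z)^(1-alpha) / L_0(z)^(1-alpha)|]; only moduli of the powers occur. *)
Definition extremal_modulus (n : nat) (alpha a b : R) (z : C) : R :=
  (Cmod (Lfun alpha a b (n - 1) z) * Rpower (Cmod (C_derive koebe z)) (1 - alpha)
   / Rpower (Cmod (L0 z)) (1 - alpha))%R.

(* Main.v *)
Require Import Defs.
From Stdlib Require Import Reals.
From Coquelicot Require Import Coquelicot.
From Stdlib Require Import Lra Lia Classical ClassicalEpsilon.
From Stdlib Require Ranalysis5.

(* Put [p_m = D^m (f^alpha) / (alpha^m z^alpha)] and [f = z exp l], so that
   [p_(m-1)] is the average [alpha int_0^1 s^(alpha-1) p_m(s z) ds] of [p_m] and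
   [f' = p_1 exp ((1 - alpha) l)].  The average of a convex map is convex, and averaging preserves
   subordination to a convex map (Hallenbeck-Ruscheweyh), so [p_n < L_0(a,b)] yields
   [p_1 < L_(n-1)(a,b)].  In particular [Re p_1 > 0], and Jack's lemma then gives
   [exp (-l/2) = 1 - w] with [|w(z)| <= |z|].  Hence
     [- log |f'| = - log |L_(n-1)(w_1)| + 2 (1 - alpha) log |1 - w|]
   with two Schwarz functions [w_1, w].  For each term separately, and for [Phi(x) = max(x - t, 0)],
   replacing the Schwarz function by [z] increases the integral (Littlewood's subordination
   principle).  Both resulting terms, and hence their sum, are even and nondecreasing in
   [|theta|], so a threshold [t] for the sum splits into thresholds for the two terms at which the
   hinges add up exactly.  A general [Phi] is a limit of sums of hinge functions. *)

(** Littlewood's principle does not apply to [log |f'|] at once, because its two terms are governed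
    by different Schwarz functions. Hinges allow the terms to be majorised separately. The formula
    for [f'] comes from [p_1 = exp (alpha l) (1 + z l')] and [f' = exp l (1 + z l')]. In the
    extremal expression [k' / L_0] is just [1 / (1 - z)^2], whence the factor [2 (1 - alpha)]. That
    [|L_m|] decreases with the angle cannot be proved by induction on [m] as it stands, since
    averaging gives no control of moduli. The induction carries the monotonicity of [Re (q(s e^(i
    theta)) conj (q(t e^(i theta))))] for independent radii [s] and [t]: this form is additive in
    each factor, so it passes to averages, and [s = t] returns the modulus. Convexity is used in
    differential form. Injectivity, openness of the image and the bound for the lift all come from
    one inequality: the image of a disk lies strictly on one side of each tangent of its boundary
    curve. *)

Local Open Scope R_scope.

(** * Continuity and differentiation over C *)

(* The embedding [e] is the identity of [C] or the inclusion of [R], so that one calculus serves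
   complex functions and curves. *)
Definition cont_via {X : Type} (e f : X -> C) (x : X) : Prop :=
  forall eps, 0 < eps -> exists delta, 0 < delta /\
    forall y, Cmod (e y - e x) < delta -> Cmod (f y - f x) < eps.

Definition der_via {X : Type} (e f : X -> C) (x : X) (d : C) : Prop :=
  forall eps, 0 < eps -> exists delta, 0 < delta /\
    forall y, Cmod (e y - e x) < delta ->
      Cmod (f y - f x - d * (e y - e x)) <= eps * Cmod (e y - e x).

Notation ccont := (cont_via (fun z : C => z)).
Notation rcont := (cont_via RtoC).
Notation cder := (der_via (fun z : C => z)).
Notation rder := (der_via RtoC).

Lemma lt_Rmin (x a b : R) : x < Rmin a b -> x < a /\ x < b.
Proof. intros H. pose proof (Rmin_l a b). pose proof (Rmin_r a b). lra. Qed.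

Lemma Cmod_nonneg (z : C) : 0 <= Cmod z.
Proof. apply Cmod_ge_0. Qed.

Lemma Cmod_minus_sym (x y : C) : Cmod (x - y) = Cmod (y - x).
Proof. rewrite <- Cmod_opp. f_equal. ring. Qed.

Lemma Cmod_triangle_rev (x y : C) : Cmod x - Cmod y <= Cmod (x - y).
Proof.
replace x with ((x - y) + y)%C at 1 by ring.
pose proof (Cmod_triangle (x - y)%C y). lra.
Qed.

Lemma Cmod_sqr (z : C) : Cmod z * Cmod z = fst z * fst z + snd z * snd z.
Proof.
unfold Cmod. rewrite sqrt_sqrt; [simpl; ring|].
simpl. nra.
Qed.

Lemma Re_le_Cmod (z : C) : Rabs (fst z) <= Cmod z.
Proof. eapply Rle_trans; [apply Rmax_l | apply Rmax_Cmod]. Qed.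

Lemma Im_le_Cmod (z : C) : Rabs (snd z) <= Cmod z.
Proof. eapply Rle_trans; [apply Rmax_r | apply Rmax_Cmod]. Qed.

Lemma Cmod_le_Re_Im (z : C) : Cmod z <= Rabs (fst z) + Rabs (snd z).
Proof.
pose proof (Cmod_nonneg z). pose proof (Rabs_pos (fst z)). pose proof (Rabs_pos (snd z)).
apply Rsqr_incr_0; unfold Rsqr; [|lra|lra].
rewrite Cmod_sqr.
assert (fst z * fst z = Rabs (fst z) * Rabs (fst z)) by (rewrite <- Rabs_mult, Rabs_pos_eq; nra).
assert (snd z * snd z = Rabs (snd z) * Rabs (snd z)) by (rewrite <- Rabs_mult, Rabs_pos_eq; nra).
nra.
Qed.

Lemma Cmod_pos (z : C) : z <> 0%C -> 0 < Cmod z.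
Proof. apply Cmod_gt_0. Qed.

Lemma Cmod_pos_neq (z : C) : 0 < Cmod z -> z <> 0%C.
Proof. intros H E. rewrite E, Cmod_0 in H. lra. Qed.

Section Calculus.

Context {X : Type} (e : X -> C).

Lemma cont_const (c : C) (x : X) : cont_via e (fun _ => c) x.
Proof.
intros eps He. exists 1. split; [lra|]. intros y _.
replace (c - c)%C with (RtoC 0) by ring. rewrite Cmod_0. exact He.
Qed.

Lemma cont_embed (x : X) : cont_via e e x.
Proof. intros eps He. exists eps. split; [exact He|]. auto. Qed.

Lemma cont_local (f g : X -> C) (x : X) (eta : R) : 0 < eta ->
  (forall y, Cmod (e y - e x) < eta -> f y = g y) -> cont_via e f x -> cont_via e g x.
Proof.
intros Heta H Hf eps He. destruct (Hf eps He) as [d [Hd Hf']].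
exists (Rmin d eta). split; [apply Rmin_glb_lt; auto|].
intros y Hy.
rewrite <- (H y), <- (H x).
- apply Hf'. eapply Rlt_le_trans; [exact Hy | apply Rmin_l].
- replace (e x - e x)%C with (RtoC 0) by ring. rewrite Cmod_0. exact Heta.
- eapply Rlt_le_trans; [exact Hy | apply Rmin_r].
Qed.

Lemma cont_plus (f g : X -> C) (x : X) :
  cont_via e f x -> cont_via e g x -> cont_via e (fun y => f y + g y)%C x.
Proof.
intros Hf Hg eps He.
destruct (Hf (eps / 2)) as [d1 [Hd1 H1]]; [lra|].
destruct (Hg (eps / 2)) as [d2 [Hd2 H2]]; [lra|].
exists (Rmin d1 d2). split; [apply Rmin_glb_lt; auto|].
intros y Hy.
replace (f y + g y - (f x + g x))%C with ((f y - f x) + (g y - g x))%C by ring.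
eapply Rle_lt_trans; [apply Cmod_triangle|].
assert (Cmod (f y - f x) < eps / 2).
{ apply H1. eapply Rlt_le_trans; [exact Hy | apply Rmin_l]. }
assert (Cmod (g y - g x) < eps / 2).
{ apply H2. eapply Rlt_le_trans; [exact Hy | apply Rmin_r]. }
lra.
Qed.

Lemma cont_comp (F : C -> C) (f : X -> C) (x : X) :
  ccont F (f x) -> cont_via e f x -> cont_via e (fun y => F (f y)) x.
Proof.
intros HF Hf eps He. destruct (HF eps He) as [d [Hd H]].
destruct (Hf d Hd) as [d' [Hd' H']]. exists d'. split; auto.
Qed.

Lemma cont_locally_bounded (f : X -> C) (x : X) : cont_via e f x ->
  exists delta, 0 < delta /\
    forall y, Cmod (e y - e x) < delta -> Cmod (f y) <= Cmod (f x) + 1.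
Proof.
intros Hf. destruct (Hf 1) as [d [Hd H]]; [lra|]. exists d. split; [exact Hd|].
intros y Hy. specialize (H y Hy). pose proof (Cmod_triangle_rev (f y) (f x)). lra.
Qed.

Lemma cont_mult (f g : X -> C) (x : X) :
  cont_via e f x -> cont_via e g x -> cont_via e (fun y => f y * g y)%C x.
Proof.
intros Hf Hg eps He.
destruct (cont_locally_bounded g x Hg) as [d0 [Hd0 H0]].
pose proof (Cmod_nonneg (f x)) as Nf. pose proof (Cmod_nonneg (g x)) as Ng.
set (A := Cmod (g x) + 1) in *. set (B := Cmod (f x) + 1).
assert (HA : 0 < A) by (unfold A; lra). assert (HB : 0 < B) by (unfold B; lra).
destruct (Hf (eps / 2 / A)) as [d1 [Hd1 H1]].
{ apply Rdiv_lt_0_compat; lra. }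
destruct (Hg (eps / 2 / B)) as [d2 [Hd2 H2]].
{ apply Rdiv_lt_0_compat; lra. }
exists (Rmin d0 (Rmin d1 d2)). split; [repeat apply Rmin_glb_lt; auto|].
intros y Hy.
destruct (lt_Rmin _ _ _ Hy) as [Hy0 Hy'].
destruct (lt_Rmin _ _ _ Hy') as [Hy1 Hy2].
specialize (H0 y Hy0). specialize (H1 y Hy1). specialize (H2 y Hy2).
replace (f y * g y - f x * g x)%C
  with ((f y - f x) * g y + f x * (g y - g x))%C by ring.
eapply Rle_lt_trans; [apply Cmod_triangle|]. rewrite !Cmod_mult.
pose proof (Cmod_nonneg (f y - f x)%C). pose proof (Cmod_nonneg (g y - g x)%C).
pose proof (Cmod_nonneg (g y)).
assert (Cmod (f y - f x) * Cmod (g y) <= Cmod (f y - f x) * A)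
  by (apply Rmult_le_compat_l; lra).
assert (Cmod (f y - f x) * A < eps / 2).
{ apply (Rmult_lt_compat_r A) in H1; [|exact HA]. field_simplify in H1; lra. }
assert (Cmod (f x) * Cmod (g y - g x) <= B * Cmod (g y - g x))
  by (apply Rmult_le_compat_r; unfold B; lra).
assert (B * Cmod (g y - g x) < eps / 2).
{ apply (Rmult_lt_compat_l B) in H2; [|exact HB]. field_simplify in H2; lra. }
lra.
Qed.

Lemma cont_opp (f : X -> C) (x : X) :
  cont_via e f x -> cont_via e (fun y => - f y)%C x.
Proof.
intros Hf eps He. destruct (Hf eps He) as [d [Hd H]]. exists d. split; [exact Hd|].
intros y Hy. replace (- f y - - f x)%C with (- (f y - f x))%C by ring.
rewrite Cmod_opp. auto.
Qed.

Lemma cont_minus (f g : X -> C) (x : X) :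
  cont_via e f x -> cont_via e g x -> cont_via e (fun y => f y - g y)%C x.
Proof. intros Hf Hg. apply cont_plus; [exact Hf | apply cont_opp, Hg]. Qed.

Lemma cont_of_Lipschitz (F : C -> C) (M : R) : 0 < M ->
  (forall x y, Cmod (F y - F x) <= M * Cmod (y - x)) ->
  forall (f : X -> C) (x : X), cont_via e f x -> cont_via e (fun y => F (f y)) x.
Proof.
intros HM H f x. apply cont_comp. intros eps He. exists (eps / M).
split; [apply Rdiv_lt_0_compat; lra|]. intros y Hy.
eapply Rle_lt_trans; [apply H|].
apply (Rmult_lt_compat_l M) in Hy; [|exact HM]. field_simplify in Hy; lra.
Qed.

Lemma cont_conj (f : X -> C) (x : X) :
  cont_via e f x -> cont_via e (fun y => Cconj (f y)) x.
Proof.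
apply (cont_of_Lipschitz Cconj 1); [lra|]. intros u v.
rewrite Rmult_1_l. right. unfold Cmod, Cconj. simpl. f_equal. ring.
Qed.

Lemma cont_Re (f : X -> C) (x : X) :
  cont_via e f x -> cont_via e (fun y => RtoC (fst (f y))) x.
Proof.
apply (cont_of_Lipschitz (fun z => RtoC (fst z)) 1); [lra|]. intros u v.
rewrite <- RtoC_minus, Cmod_R, Rmult_1_l. apply (Re_le_Cmod (v - u)).
Qed.

Lemma cont_Im (f : X -> C) (x : X) :
  cont_via e f x -> cont_via e (fun y => RtoC (snd (f y))) x.
Proof.
apply (cont_of_Lipschitz (fun z => RtoC (snd z)) 1); [lra|]. intros u v.
rewrite <- RtoC_minus, Cmod_R, Rmult_1_l. apply (Im_le_Cmod (v - u)).
Qed.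

Lemma cont_Cmod (f : X -> C) (x : X) :
  cont_via e f x -> cont_via e (fun y => RtoC (Cmod (f y))) x.
Proof.
apply (cont_of_Lipschitz (fun z => RtoC (Cmod z)) 1); [lra|]. intros u v.
rewrite <- RtoC_minus, Cmod_R, Rmult_1_l. apply Rabs_le.
pose proof (Cmod_triangle_rev v u). pose proof (Cmod_triangle_rev u v).
rewrite (Cmod_minus_sym u v) in *. lra.
Qed.

Lemma cont_max (f g : X -> R) (x : X) :
  cont_via e (fun y => RtoC (f y)) x -> cont_via e (fun y => RtoC (g y)) x ->
  cont_via e (fun y => RtoC (Rmax (f y) (g y))) x.
Proof.
intros Hf Hg eps He.
destruct (Hf eps He) as [d1 [Hd1 H1]]. destruct (Hg eps He) as [d2 [Hd2 H2]].
exists (Rmin d1 d2). split; [apply Rmin_glb_lt; auto|]. intros y Hy.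
assert (A : Cmod (f y - f x) < eps).
{ apply H1. eapply Rlt_le_trans; [exact Hy | apply Rmin_l]. }
assert (B : Cmod (g y - g x) < eps).
{ apply H2. eapply Rlt_le_trans; [exact Hy | apply Rmin_r]. }
rewrite <- RtoC_minus, Cmod_R in *.
apply Rabs_def2 in A. apply Rabs_def2 in B.
apply Rabs_def1; unfold Rmax; destruct (Rle_dec (f y) (g y)), (Rle_dec (f x) (g x)); lra.
Qed.

Lemma der_cont (f : X -> C) (x : X) (d : C) : der_via e f x d -> cont_via e f x.
Proof.
intros H eps He. destruct (H 1) as [d1 [Hd1 H1]]; [lra|].
pose proof (Cmod_nonneg d) as Nd.
exists (Rmin d1 (eps / (Cmod d + 2))).
assert (0 < eps / (Cmod d + 2)) by (apply Rdiv_lt_0_compat; lra).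
split; [apply Rmin_glb_lt; auto|].
intros y Hy.
destruct (lt_Rmin _ _ _ Hy) as [Hy1 Hy2].
specialize (H1 y Hy1).
pose proof (Cmod_triangle_rev (f y - f x)%C (d * (e y - e x))%C) as T.
rewrite Cmod_mult in T. pose proof (Cmod_nonneg (e y - e x)%C).
assert (Cmod (e y - e x) * (Cmod d + 2) < eps).
{ apply (Rmult_lt_compat_r (Cmod d + 2)) in Hy2; [|lra]. field_simplify in Hy2; lra. }
nra.
Qed.

Lemma der_const (c : C) (x : X) : der_via e (fun _ => c) x 0.
Proof.
intros eps He. exists 1. split; [lra|]. intros y _.
replace (c - c - 0 * (e y - e x))%C with (RtoC 0) by ring. rewrite Cmod_0.
pose proof (Cmod_nonneg (e y - e x)%C). nra.
Qed.

Lemma der_embed (x : X) : der_via e e x 1.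
Proof.
intros eps He. exists 1. split; [lra|]. intros y _.
replace (e y - e x - 1 * (e y - e x))%C with (RtoC 0) by ring. rewrite Cmod_0.
pose proof (Cmod_nonneg (e y - e x)%C). nra.
Qed.

Lemma der_eq (f : X -> C) (x : X) (d d' : C) : d = d' -> der_via e f x d -> der_via e f x d'.
Proof. intros <-. auto. Qed.

Lemma der_local (f g : X -> C) (x : X) (d : C) (eta : R) : 0 < eta ->
  (forall y, Cmod (e y - e x) < eta -> f y = g y) -> der_via e f x d -> der_via e g x d.
Proof.
intros Heta H Hf eps He. destruct (Hf eps He) as [d1 [Hd Hf']].
exists (Rmin d1 eta). split; [apply Rmin_glb_lt; auto|].
intros y Hy.
rewrite <- (H y), <- (H x).
- apply Hf'. eapply Rlt_le_trans; [exact Hy | apply Rmin_l].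
- replace (e x - e x)%C with (RtoC 0) by ring. rewrite Cmod_0. exact Heta.
- eapply Rlt_le_trans; [exact Hy | apply Rmin_r].
Qed.

Lemma der_plus (f g : X -> C) (x : X) (df dg : C) :
  der_via e f x df -> der_via e g x dg -> der_via e (fun y => f y + g y)%C x (df + dg).
Proof.
intros Hf Hg eps He.
destruct (Hf (eps / 2)) as [d1 [Hd1 H1]]; [lra|].
destruct (Hg (eps / 2)) as [d2 [Hd2 H2]]; [lra|].
exists (Rmin d1 d2). split; [apply Rmin_glb_lt; auto|].
intros y Hy.
destruct (lt_Rmin _ _ _ Hy) as [Hy1 Hy2].
specialize (H1 y Hy1). specialize (H2 y Hy2).
replace (f y + g y - (f x + g x) - (df + dg) * (e y - e x))%C
  with ((f y - f x - df * (e y - e x)) + (g y - g x - dg * (e y - e x)))%C by ring.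
eapply Rle_trans; [apply Cmod_triangle|]. lra.
Qed.

Lemma der_comp (F : C -> C) (f : X -> C) (x : X) (D d : C) :
  cder F (f x) D -> der_via e f x d -> der_via e (fun y => F (f y)) x (D * d).
Proof.
intros HF Hf eps He.
pose proof (Cmod_nonneg d) as Nd. pose proof (Cmod_nonneg D) as ND.
set (A := Cmod d + 1). set (B := Cmod D + 1).
assert (HA : 0 < A) by (unfold A; lra). assert (HB : 0 < B) by (unfold B; lra).
destruct (HF (eps / 2 / A)) as [d1 [Hd1 H1]]; [apply Rdiv_lt_0_compat; lra|].
(* The bound [1] makes [f] Lipschitz at [x] with constant [A = |d| + 1], which controls the argument
   of the remainder of [F]. *)
destruct (Hf (Rmin 1 (eps / 2 / B))) as [d2 [Hd2 H2]].
{ apply Rmin_glb_lt; [lra|]. apply Rdiv_lt_0_compat; lra. }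
exists (Rmin d2 (d1 / A)).
split; [apply Rmin_glb_lt; [auto | apply Rdiv_lt_0_compat; lra]|].
intros y Hy.
destruct (lt_Rmin _ _ _ Hy) as [Hy2 Hy1].
specialize (H2 y Hy2). pose proof (Cmod_nonneg (e y - e x)%C) as P.
set (h := Cmod (e y - e x)) in *.
assert (L : Cmod (f y - f x) <= A * h).
{ pose proof (Cmod_triangle_rev (f y - f x)%C (d * (e y - e x))%C) as T.
  rewrite Cmod_mult in T. fold h in T.
  assert (Rmin 1 (eps / 2 / B) * h <= 1 * h) by (apply Rmult_le_compat_r; [exact P | apply Rmin_l]).
  unfold A. lra. }
assert (Hs : A * h < d1).
{ apply (Rmult_lt_compat_l A) in Hy1; [|exact HA]. field_simplify in Hy1; lra. }
specialize (H1 (f y) (Rle_lt_trans _ _ _ L Hs)). cbv beta in H1.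
replace (F (f y) - F (f x) - D * d * (e y - e x))%C
  with ((F (f y) - F (f x) - D * (f y - f x)) + D * (f y - f x - d * (e y - e x)))%C by ring.
eapply Rle_trans; [apply Cmod_triangle|]. rewrite Cmod_mult.
assert (Q1 : eps / 2 / A * Cmod (f y - f x) <= eps / 2 * h).
{ apply Rle_trans with (eps / 2 / A * (A * h)).
  - apply Rmult_le_compat_l; [|exact L]. apply Rlt_le, Rdiv_lt_0_compat; lra.
  - right. field. lra. }
assert (Q2 : Cmod D * Cmod (f y - f x - d * (e y - e x)) <= eps / 2 * h).
{ apply Rle_trans with (B * (eps / 2 / B * h)).
  - apply Rmult_le_compat; [lra | apply Cmod_nonneg | unfold B; lra|].
    eapply Rle_trans; [exact H2|]. apply Rmult_le_compat_r; [exact P | apply Rmin_r].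
  - right. field. lra. }
lra.
Qed.

Lemma der_mult (f g : X -> C) (x : X) (df dg : C) :
  der_via e f x df -> der_via e g x dg ->
  der_via e (fun y => f y * g y)%C x (df * g x + f x * dg).
Proof.
intros Hf Hg eps He.
pose proof (der_cont _ _ _ Hg) as Cg.
destruct (cont_locally_bounded g x Cg) as [d0 [Hd0 H0]].
pose proof (Cmod_nonneg (f x)) as Nf. pose proof (Cmod_nonneg (g x)) as Ng.
  pose proof (Cmod_nonneg df) as Nd.
set (A := Cmod (g x) + 1) in *. set (B := Cmod (f x) + 1). set (E := Cmod df + 1).
assert (HA : 0 < A) by (unfold A; lra). assert (HB : 0 < B) by (unfold B; lra).
assert (HE : 0 < E) by (unfold E; lra).
destruct (Hf (eps / 3 / A)) as [d1 [Hd1 H1]]; [apply Rdiv_lt_0_compat; lra|].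
destruct (Hg (eps / 3 / B)) as [d2 [Hd2 H2]]; [apply Rdiv_lt_0_compat; lra|].
destruct (Cg (eps / 3 / E)) as [d3 [Hd3 H3]]; [apply Rdiv_lt_0_compat; lra|].
exists (Rmin (Rmin d0 d1) (Rmin d2 d3)). split; [repeat apply Rmin_glb_lt; auto|].
intros y Hy.
destruct (lt_Rmin _ _ _ Hy) as [Ha Hb].
destruct (lt_Rmin _ _ _ Ha) as [Hy0 Hy1].
destruct (lt_Rmin _ _ _ Hb) as [Hy2 Hy3].
specialize (H0 y Hy0). specialize (H1 y Hy1). specialize (H2 y Hy2). specialize (H3 y Hy3).
pose proof (Cmod_nonneg (e y - e x)%C) as P. set (h := Cmod (e y - e x)) in *.
replace (f y * g y - f x * g x - (df * g x + f x * dg) * (e y - e x))%C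
  with ((f y - f x - df * (e y - e x)) * g y
        + (f x * (g y - g x - dg * (e y - e x)) + df * (e y - e x) * (g y - g x)))%C by ring.
eapply Rle_trans; [apply Cmod_triangle|].
eapply Rle_trans; [apply Rplus_le_compat_l, Cmod_triangle|].
rewrite !Cmod_mult. fold h.
assert (Q1 : Cmod (f y - f x - df * (e y - e x)) * Cmod (g y) <= eps / 3 * h).
{ apply Rle_trans with (eps / 3 / A * h * A).
  - apply Rmult_le_compat; [apply Cmod_nonneg | apply Cmod_nonneg | exact H1 | exact H0].
  - right. field. lra. }
assert (Q2 : Cmod (f x) * Cmod (g y - g x - dg * (e y - e x)) <= eps / 3 * h).
{ apply Rle_trans with (B * (eps / 3 / B * h)).
  - apply Rmult_le_compat; [lra | apply Cmod_nonneg | unfold B; lra | exact H2].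
  - right. field. lra. }
assert (Q3 : Cmod df * h * Cmod (g y - g x) <= eps / 3 * h).
{ apply Rle_trans with (E * h * (eps / 3 / E)).
  - apply Rmult_le_compat; [nra | apply Cmod_nonneg | unfold E; nra | lra].
  - right. field. lra. }
lra.
Qed.

Lemma der_opp (f : X -> C) (x : X) (d : C) :
  der_via e f x d -> der_via e (fun y => - f y)%C x (- d).
Proof.
intros H eps He. destruct (H eps He) as [d1 [Hd1 H1]]. exists d1. split; [exact Hd1|].
intros y Hy. specialize (H1 y Hy).
replace (- f y - - f x - - d * (e y - e x))%C with (- (f y - f x - d * (e y - e x)))%C by ring.
rewrite Cmod_opp. exact H1.
Qed.

Lemma der_minus (f g : X -> C) (x : X) (df dg : C) :
  der_via e f x df -> der_via e g x dg -> der_via e (fun y => f y - g y)%C x (df - dg).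
Proof. intros Hf Hg. apply der_plus; [exact Hf | apply der_opp, Hg]. Qed.

Lemma der_scal (c : C) (f : X -> C) (x : X) (d : C) :
  der_via e f x d -> der_via e (fun y => c * f y)%C x (c * d).
Proof.
intros H. eapply der_eq; [|apply (der_mult (fun _ => c) f x 0 d); [apply der_const | exact H]].
cbv beta. ring.
Qed.

End Calculus.

Lemma cder_inv (z : C) : z <> 0%C -> cder Cinv z (- / (z * z)).
Proof.
intros Hz eps He. pose proof (Cmod_pos z Hz) as P. set (m := Cmod z) in *.
(* The remainder is [(y - z)^2 / (z^2 y)]. The first bound keeps [|y| > m / 2], and the second then
   makes the remainder at most [eps |y - z|]. *)
exists (Rmin (m / 2) (eps * m * m * m / 2)).
assert (0 < eps * m * m * m) by (repeat apply Rmult_lt_0_compat; lra).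
split; [apply Rmin_glb_lt; lra|].
intros y Hy.
destruct (lt_Rmin _ _ _ Hy) as [Hy1 Hy2].
assert (Y : m / 2 < Cmod y).
{ pose proof (Cmod_triangle_rev z y). rewrite Cmod_minus_sym in Hy1. unfold m in *. lra. }
assert (Hy0 : y <> 0%C) by (apply Cmod_pos_neq; lra).
replace (/ y - / z - - / (z * z) * (y - z))%C
  with ((y - z) * (y - z) / (z * z * y))%C by (field; auto).
rewrite Cmod_div by (repeat apply Cmult_neq_0; auto). rewrite !Cmod_mult. fold m.
pose proof (Cmod_nonneg (y - z)%C). set (h := Cmod (y - z)) in *.
apply Rle_trans with (h * h / (m * m * (m / 2))).
- apply Rmult_le_compat_l; [nra|]. apply Rinv_le_contravar.
  + repeat apply Rmult_lt_0_compat; lra.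
  + apply Rmult_le_compat_l; [nra | lra].
- apply Rle_trans with (h * (eps * m * m * m / 2) / (m * m * (m / 2))).
  + apply Rmult_le_compat_r; [|nra].
    apply Rlt_le, Rinv_0_lt_compat. repeat apply Rmult_lt_0_compat; lra.
  + right. field. lra.
Qed.

Lemma ccont_inv (z : C) : z <> 0%C -> ccont Cinv z.
Proof. intros H. eapply der_cont, cder_inv, H. Qed.

Lemma cont_inv {X : Type} (e f : X -> C) (x : X) :
  f x <> 0%C -> cont_via e f x -> cont_via e (fun y => / f y)%C x.
Proof. intros H. apply cont_comp, ccont_inv, H. Qed.

Lemma cont_div {X : Type} (e f g : X -> C) (x : X) :
  g x <> 0%C -> cont_via e f x -> cont_via e g x -> cont_via e (fun y => f y / g y)%C x.
Proof. intros H Hf Hg. apply cont_mult; [exact Hf | apply cont_inv; auto]. Qed.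

Lemma der_inv {X : Type} (e f : X -> C) (x : X) (d : C) :
  f x <> 0%C -> der_via e f x d -> der_via e (fun y => / f y)%C x (- d / (f x * f x)).
Proof.
intros H Hf. eapply der_eq; [|apply (der_comp e Cinv f x (- / (f x * f x)) d); [apply cder_inv,
  H | exact Hf]].
field. exact H.
Qed.

Lemma der_div {X : Type} (e f g : X -> C) (x : X) (df dg : C) :
  g x <> 0%C -> der_via e f x df -> der_via e g x dg ->
  der_via e (fun y => f y / g y)%C x ((df * g x - f x * dg) / (g x * g x)).
Proof.
intros H Hf Hg. eapply der_eq; [|apply (der_mult _ f (fun y => / g y)%C x df); [exact Hf
  | apply der_inv; [exact H | exact Hg]]].
cbv beta.
field. exact H.
Qed.

(** * Integrals of complex-valued functions *)

Lemma is_derive_eps {K : AbsRing} {V : NormedModule K} (f : K -> V) (x : K) (l : V) :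
  is_derive f x l <->
  forall eps : R, 0 < eps -> exists delta : R, 0 < delta /\ forall y : K,
    abs (minus y x) < delta ->
    norm (minus (minus (f y) (f x)) (scal (minus y x) l)) <= eps * abs (minus y x).
Proof.
split.
- intros [_ H] eps He.
  destruct (H x (fun P HP => HP) (mkposreal eps He)) as [d Hd].
  exists d. split; [apply cond_pos|]. intros y Hy. exact (Hd y Hy).
- intros H. split; [apply is_linear_scal_l|].
  (* The definition quantifies over all limits of the neighbourhood filter of [x]; the only one is
     [x]. *)
  intros y Hy eps. apply (is_filter_lim_locally_unique (V := AbsRing_NormedModule K)) in Hy.
    subst y.
  destruct (H eps (cond_pos eps)) as [d [Hd H']].
  exists (mkposreal d Hd). intros y Hy. exact (H' y Hy).
Qed.

Lemma cder_is_derive (f : C -> C) (z d : C) :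
  is_derive (K := C_AbsRing) (V := C_NormedModule) f z d <-> cder f z d.
Proof.
assert (E : forall y, norm (K := C_AbsRing) (V := C_NormedModule)
    (minus (minus (f y) (f z)) (scal (minus y z) d)) = Cmod (f y - f z - d * (y - z))).
{ intros y. rewrite (Cmult_comm d). reflexivity. }
rewrite is_derive_eps. split; intros H eps He; destruct (H eps He) as [del [Hd H']];
  exists del; (split; [exact Hd|]); intros y Hy; specialize (H' y Hy).
- rewrite E in H'. exact H'.
- rewrite E. exact H'.
Qed.

Lemma is_derive_R_eps (f : R -> R) (x l : R) :
  is_derive f x l <->
  forall eps, 0 < eps -> exists delta, 0 < delta /\ forall y,
    Rabs (y - x) < delta -> Rabs (f y - f x - l * (y - x)) <= eps * Rabs (y - x).
Proof.
rewrite (is_derive_eps (K := R_AbsRing) (V := R_NormedModule) f x l).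
split; intros H eps He; destruct (H eps He) as [del [Hd H']];
  exists del; (split; [exact Hd|]); intros y Hy; specialize (H' y Hy).
- rewrite (Rmult_comm l). exact H'.
- rewrite (Rmult_comm l) in H'. exact H'.
Qed.

Lemma rder_components (g : R -> C) (t : R) (v : C) :
  rder g t v <->
  is_derive (fun u => fst (g u)) t (fst v) /\ is_derive (fun u => snd (g u)) t (snd v).
Proof.
assert (Er : forall u, fst (g u - g t - v * (RtoC u - RtoC t))%C =
   fst (g u) - fst (g t) - fst v * (u - t)) by (intros u; simpl; ring).
assert (Ei : forall u, snd (g u - g t - v * (RtoC u - RtoC t))%C =
   snd (g u) - snd (g t) - snd v * (u - t)) by (intros u; simpl; ring).
rewrite !is_derive_R_eps. split.
- intros H. split; intros eps He; destruct (H eps He) as [d [Hd H']]; exists d;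
    (split; [exact Hd|]); intros u Hu;
    specialize (H' u); rewrite <- RtoC_minus, Cmod_R in H'; specialize (H' Hu).
  + rewrite <- Er. rewrite RtoC_minus in H'. eapply Rle_trans; [apply Re_le_Cmod | exact H'].
  + rewrite <- Ei. rewrite RtoC_minus in H'. eapply Rle_trans; [apply Im_le_Cmod | exact H'].
- intros [H1 H2] eps He.
  destruct (H1 (eps / 2)) as [d1 [Hd1 H1']]; [lra|].
  destruct (H2 (eps / 2)) as [d2 [Hd2 H2']]; [lra|].
  exists (Rmin d1 d2). split; [apply Rmin_glb_lt; auto|].
  intros u Hu. eapply Rle_trans; [apply Cmod_le_Re_Im|]. rewrite Er, Ei.
  rewrite <- RtoC_minus, Cmod_R in *.
  specialize (H1' u (Rlt_le_trans _ _ _ Hu (Rmin_l _ _))).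
  specialize (H2' u (Rlt_le_trans _ _ _ Hu (Rmin_r _ _))). lra.
Qed.

Lemma rcont_continuous (f : R -> R) (t : R) :
  rcont (fun u => RtoC (f u)) t <-> continuous f t.
Proof.
split.
- intros H. apply (filterlim_locally f (f t)). intros eps.
  destruct (H eps (cond_pos eps)) as [d [Hd H']].
  exists (mkposreal d Hd). intros u Hu.
  specialize (H' u). rewrite <- !RtoC_minus, !Cmod_R in H'. exact (H' Hu).
- intros H eps He. apply filterlim_locally with (eps := mkposreal eps He) in H.
  destruct H as [d Hd]. exists d. split; [apply cond_pos|]. intros u Hu.
  rewrite <- !RtoC_minus, !Cmod_R in *. exact (Hd u Hu).
Qed.

Lemma rcont_fst (g : R -> C) (t : R) : rcont g t -> continuous (fun u => fst (g u)) t.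
Proof. intros H. apply rcont_continuous, cont_Re, H. Qed.

Lemma rcont_snd (g : R -> C) (t : R) : rcont g t -> continuous (fun u => snd (g u)) t.
Proof. intros H. apply rcont_continuous, cont_Im, H. Qed.

(** A complex number doubles as a pair of real parameters, so that the calculus of [cont_via] also
    yields joint continuity of integrands on rectangles. *)
Lemma ccont_continuity_2d (f : C -> R) (x y : R) :
  ccont (fun z => RtoC (f z)) (x, y) -> continuity_2d_pt (fun u v => f (u, v)) x y.
Proof.
intros H eps. destruct (H eps (cond_pos eps)) as [d [Hd H']].
assert (Hd2 : 0 < d / 2) by lra.
exists (mkposreal (d / 2) Hd2). simpl. intros u v Hu Hv.
specialize (H' (u, v)). rewrite <- RtoC_minus, Cmod_R in H'. apply H'.
eapply Rle_lt_trans; [apply Cmod_le_Re_Im|]. simpl.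
replace (u + - x) with (u - x) by ring. replace (v + - y) with (v - y) by ring. lra.
Qed.

(** * The complex exponential *)

Lemma Cexp_plus (z w : C) : Cexp (z + w) = (Cexp z * Cexp w)%C.
Proof.
unfold Cexp, Re, Im. apply injective_projections; simpl; rewrite exp_plus.
- rewrite cos_plus. ring.
- rewrite sin_plus. ring.
Qed.

Lemma Cexp_0 : Cexp 0 = 1%C.
Proof.
unfold Cexp, Re, Im. simpl. rewrite exp_0, cos_0, sin_0.
apply injective_projections; simpl; ring.
Qed.

Lemma Cexp_opp (z : C) : (Cexp z * Cexp (- z))%C = 1%C.
Proof. rewrite <- Cexp_plus. replace (z + - z)%C with (RtoC 0) by ring. apply Cexp_0. Qed.

Lemma Cexp_neq_0 (z : C) : Cexp z <> 0%C.
Proof.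
intros H. pose proof (Cexp_opp z) as E. rewrite H in E.
apply (f_equal fst) in E. simpl in E. lra.
Qed.

Lemma Cmod_Cexp (z : C) : Cmod (Cexp z) = exp (fst z).
Proof.
apply Rsqr_inj; [apply Cmod_ge_0 | apply Rlt_le, exp_pos|].
unfold Rsqr. rewrite Cmod_sqr. unfold Cexp, Re, Im. simpl.
pose proof (sin2_cos2 (snd z)) as H. unfold Rsqr in H.
replace (exp (fst z) * cos (snd z) * (exp (fst z) * cos (snd z))
   + exp (fst z) * sin (snd z) * (exp (fst z) * sin (snd z)))
  with (exp (fst z) * exp (fst z) * (sin (snd z) * sin (snd z) + cos (snd z) * cos (snd z)))
  by ring.
rewrite H. ring.
Qed.

Lemma cder_Cexp_0 : cder Cexp 0 1.
Proof.
(* The real and imaginary parts of the remainder are at most [4 * k * h] and [5 * k * h], hence the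
   [10]; [k <= 1] gives [exp x <= 3]. *)
intros eps He. set (k := Rmin 1 (eps / 10)).
assert (Hk : 0 < k) by (apply Rmin_glb_lt; lra).
assert (Hk1 : k <= 1) by apply Rmin_l. assert (Hk2 : k <= eps / 10) by apply Rmin_r. clearbody k.
assert (De : is_derive exp 0 1) by (auto_derive; [auto | rewrite exp_0; ring]).
assert (Dc : is_derive cos 0 0) by (auto_derive; [auto | rewrite sin_0; ring]).
assert (Ds : is_derive sin 0 1) by (auto_derive; [auto | rewrite cos_0; ring]).
apply (proj1 (is_derive_R_eps _ _ _)) with (eps := k) in De; [|exact Hk].
apply (proj1 (is_derive_R_eps _ _ _)) with (eps := k) in Dc; [|exact Hk].
apply (proj1 (is_derive_R_eps _ _ _)) with (eps := k) in Ds; [|exact Hk].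
destruct De as [d1 [P1 H1]]. destruct Dc as [d2 [P2 H2]]. destruct Ds as [d3 [P3 H3]].
exists (Rmin (Rmin d1 d2) (Rmin d3 k)). split; [repeat apply Rmin_glb_lt; auto|].
intros z Hz. replace (z - 0)%C with z in * by ring.
destruct (lt_Rmin _ _ _ Hz) as [Ha Hb].
destruct (lt_Rmin _ _ _ Ha) as [Z1 Z2].
destruct (lt_Rmin _ _ _ Hb) as [Z3 Z4].
pose proof (Re_le_Cmod z) as Rx. pose proof (Im_le_Cmod z) as Ry.
destruct z as [x y]. cbn [fst snd] in *. set (h := Cmod (x, y)) in *.
specialize (H1 x). specialize (H2 y). specialize (H3 y).
rewrite Rminus_0_r in H1, H2, H3. rewrite exp_0 in H1. rewrite cos_0 in H2. rewrite sin_0 in H3.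
specialize (H1 ltac:(lra)). specialize (H2 ltac:(lra)). specialize (H3 ltac:(lra)).
rewrite Cexp_0. unfold Cexp, Re, Im. cbn [fst snd].
set (a := exp x - 1 - 1 * x) in *. set (b := cos y - 1 - 0 * y) in *.
set (c := sin y - 0 - 1 * y) in *.
assert (Ex : exp x = 1 + x + a) by (unfold a; ring).
assert (Cy : cos y = 1 + b) by (unfold b; ring).
assert (Sy : sin y = y + c) by (unfold c; ring).
pose proof (Rabs_pos x) as Px. pose proof (Rabs_pos y) as Py.
assert (KX : k * Rabs x <= k) by nra.
pose proof (Rle_abs x) as Lx. pose proof (Rle_abs a) as La.
assert (Bx : 0 < exp x <= 3) by (split; [apply exp_pos | lra]).
assert (Bx1 : Rabs (exp x - 1) <= 2 * k).
{ replace (exp x - 1) with (x + a) by lra. eapply Rle_trans; [apply Rabs_triang | lra]. }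
eapply Rle_trans; [apply Cmod_le_Re_Im|]. simpl.
replace (exp x * cos y + - (1) + - (1 * x - 0 * y)) with (a + exp x * b)
  by (rewrite Cy, Ex; ring).
replace (exp x * sin y + - 0 + - (1 * y + 0 * x)) with ((exp x - 1) * y + exp x * c)
  by (rewrite Sy; ring).
assert (T1 : Rabs (a + exp x * b) <= k * h + 3 * (k * h)).
{ eapply Rle_trans; [apply Rabs_triang|]. rewrite Rabs_mult, (Rabs_pos_eq (exp x)) by lra.
  apply Rplus_le_compat; [nra|]. apply Rmult_le_compat; try lra; [apply Rabs_pos | nra]. }
assert (T2 : Rabs ((exp x - 1) * y + exp x * c) <= 2 * k * h + 3 * (k * h)).
{ eapply Rle_trans; [apply Rabs_triang|]. rewrite !Rabs_mult, (Rabs_pos_eq (exp x)) by lra.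
  apply Rplus_le_compat.
  - apply Rmult_le_compat; try apply Rabs_pos; lra.
  - apply Rmult_le_compat; try lra; [apply Rabs_pos | nra]. }
assert (0 <= h) by lra. nra.
Qed.

Lemma cder_Cexp (z : C) : cder Cexp z (Cexp z).
Proof.
apply der_local with (f := fun y => (Cexp z * Cexp (y - z))%C) (eta := 1); [lra| |].
- intros y _. rewrite <- Cexp_plus. f_equal. ring.
- eapply der_eq; [|apply der_scal, (der_comp _ Cexp (fun y => y - z)%C z 1 (1 - 0))].
  + ring.
  + replace (z - z)%C with (RtoC 0) by ring. apply cder_Cexp_0.
  + apply der_minus; [apply der_embed | apply der_const].
Qed.

(* Componentwise, since the C-valued integral of Coquelicot has no scalar rule for
   complex constants. *)
Definition CInt (g : R -> C) (a b : R) : C :=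
  (RInt (fun t => fst (g t)) a b, RInt (fun t => snd (g t)) a b).

(** Continuity at the end points is two-sided, so an integrand has to behave a little beyond the
    interval. The bounds [Rmin] and [Rmax] admit both orientations. *)
Definition contseg (g : R -> C) (a b : R) : Prop :=
  forall t, Rmin a b <= t <= Rmax a b -> rcont g t.

Lemma contseg_ex_Re (g : R -> C) (a b : R) :
  contseg g a b -> ex_RInt (fun t => fst (g t)) a b.
Proof. intros H. apply (ex_RInt_continuous (V := R_CompleteNormedModule)). intros t Ht.
  apply rcont_fst, H, Ht. Qed.

Lemma contseg_ex_Im (g : R -> C) (a b : R) :
  contseg g a b -> ex_RInt (fun t => snd (g t)) a b.
Proof. intros H. apply (ex_RInt_continuous (V := R_CompleteNormedModule)). intros t Ht.
  apply rcont_snd, H, Ht. Qed.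

Lemma CInt_ext (f g : R -> C) (a b : R) :
  (forall t, Rmin a b < t < Rmax a b -> f t = g t) -> CInt f a b = CInt g a b.
Proof.
intros H. unfold CInt. f_equal; apply RInt_ext; intros t Ht; rewrite (H t Ht); reflexivity.
Qed.

Lemma CInt_plus (f g : R -> C) (a b : R) : contseg f a b -> contseg g a b ->
  CInt (fun t => f t + g t)%C a b = (CInt f a b + CInt g a b)%C.
Proof.
intros Hf Hg. unfold CInt. apply injective_projections; simpl.
- apply (RInt_plus (V := R_CompleteNormedModule)); apply contseg_ex_Re; auto.
- apply (RInt_plus (V := R_CompleteNormedModule)); apply contseg_ex_Im; auto.
Qed.

Lemma CInt_scal (c : C) (f : R -> C) (a b : R) : contseg f a b ->
  CInt (fun t => c * f t)%C a b = (c * CInt f a b)%C.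
Proof.
intros Hf. pose proof (contseg_ex_Re f a b Hf) as Er. pose proof (contseg_ex_Im f a b Hf) as Ei.
apply (RInt_correct (V := R_CompleteNormedModule)) in Er.
apply (RInt_correct (V := R_CompleteNormedModule)) in Ei.
unfold CInt. apply injective_projections; cbn [fst snd]; apply is_RInt_unique.
- apply (is_RInt_minus (V := R_NormedModule)
     (fun t => fst c * fst (f t)) (fun t => snd c * snd (f t)));
   apply (is_RInt_scal (V := R_NormedModule)); assumption.
- apply (is_RInt_plus (V := R_NormedModule)
     (fun t => fst c * snd (f t)) (fun t => snd c * fst (f t)));
   apply (is_RInt_scal (V := R_NormedModule)); assumption.
Qed.

Lemma contseg_const (c : C) (a b : R) : contseg (fun _ => c) a b.
Proof. intros t _. apply cont_const. Qed.

Lemma contseg_mult (f g : R -> C) (a b : R) :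
  contseg f a b -> contseg g a b -> contseg (fun t => f t * g t)%C a b.
Proof. intros Hf Hg t Ht. apply cont_mult; auto. Qed.

Lemma contseg_plus (f g : R -> C) (a b : R) :
  contseg f a b -> contseg g a b -> contseg (fun t => f t + g t)%C a b.
Proof. intros Hf Hg t Ht. apply cont_plus; auto. Qed.

Lemma contseg_scal (c : C) (g : R -> C) (a b : R) :
  contseg g a b -> contseg (fun t => c * g t)%C a b.
Proof. intros Hg. apply contseg_mult; [apply contseg_const | exact Hg]. Qed.

Lemma CInt_minus (f g : R -> C) (a b : R) : contseg f a b -> contseg g a b ->
  CInt (fun t => f t - g t)%C a b = (CInt f a b - CInt g a b)%C.
Proof.
intros Hf Hg. rewrite (CInt_ext _ (fun t => f t + (-(1)) * g t)%C); [|intros t _; ring].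
rewrite CInt_plus, CInt_scal; auto; [ring|]. apply contseg_scal, Hg.
Qed.

Lemma CInt_const (c : C) (a b : R) : CInt (fun _ => c) a b = (RtoC (b - a) * c)%C.
Proof.
unfold CInt. rewrite !RInt_const. unfold scal; simpl; unfold mult; simpl.
apply injective_projections; simpl; ring.
Qed.

Lemma CInt_Chasles (f : R -> C) (a b c : R) : contseg f a b -> contseg f b c ->
  (CInt f a b + CInt f b c)%C = CInt f a c.
Proof.
intros H1 H2. unfold CInt. apply injective_projections; simpl.
- apply (RInt_Chasles (V := R_CompleteNormedModule)); apply contseg_ex_Re; auto.
- apply (RInt_Chasles (V := R_CompleteNormedModule)); apply contseg_ex_Im; auto.
Qed.

Lemma CInt_FTC (G g : R -> C) (a b : R) :
  (forall t, Rmin a b <= t <= Rmax a b -> rder G t (g t)) -> contseg g a b ->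
  CInt g a b = (G b - G a)%C.
Proof.
intros HG Hg. unfold CInt. apply injective_projections; simpl; apply is_RInt_unique.
- apply (is_RInt_derive (V := R_CompleteNormedModule) (fun t => fst (G t)) (fun t => fst (g t))).
  + intros t Ht. apply (proj1 (rder_components G t (g t))), HG, Ht.
  + intros t Ht. apply rcont_fst, Hg, Ht.
- apply (is_RInt_derive (V := R_CompleteNormedModule) (fun t => snd (G t)) (fun t => snd (g t))).
  + intros t Ht. apply (proj1 (rder_components G t (g t))), HG, Ht.
  + intros t Ht. apply rcont_snd, Hg, Ht.
Qed.

(* The modulus of the integral is the integral of [Re (u g)] for a unimodular constant [u]. *)
Lemma CInt_Cmod_le (g : R -> C) (a b M : R) : a <= b -> contseg g a b ->
  (forall t, a <= t <= b -> Cmod (g t) <= M) -> Cmod (CInt g a b) <= M * (b - a).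
Proof.
intros Hab Hg HM. set (I := CInt g a b).
destruct (Req_dec (Cmod I) 0) as [E|NE].
{ rewrite E. apply Rmult_le_pos; [|lra].
  eapply Rle_trans; [apply Cmod_nonneg | apply (HM a); lra]. }
pose proof (Cmod_nonneg I) as P. set (u := (Cconj I / RtoC (Cmod I))%C).
assert (HI : RtoC (Cmod I) <> 0%C) by (intros E; apply RtoC_inj in E; lra).
assert (Hu : (u * I)%C = RtoC (Cmod I)).
{ unfold u. replace (Cconj I / RtoC (Cmod I) * I)%C with (Cconj I * I / RtoC (Cmod I))%C
    by (field; exact HI).
  replace (Cconj I * I)%C with (RtoC (Cmod I) * RtoC (Cmod I))%C; [field; exact HI|].
  rewrite <- RtoC_mult, Cmod_sqr. unfold Cconj.
  apply injective_projections; simpl; ring. }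
assert (Mu : Cmod u = 1).
{ unfold u. rewrite Cmod_div by exact HI. rewrite Cmod_R, Rabs_pos_eq by exact P.
  replace (Cmod (Cconj I)) with (Cmod I); [field; lra|].
  unfold Cmod, Cconj. simpl. f_equal. ring. }
assert (K : CInt (fun t => u * g t)%C a b = RtoC (Cmod I)) by (rewrite CInt_scal; auto).
assert (S : contseg (fun t => u * g t)%C a b) by (apply contseg_scal, Hg).
apply (f_equal fst) in K. unfold CInt in K. cbn [fst] in K.
change (fst (RtoC (Cmod I))) with (Cmod I) in K. rewrite <- K.
replace (M * (b - a)) with (RInt (fun _ => M) a b)
  by (rewrite RInt_const; unfold scal; simpl; unfold mult; simpl; ring).
apply RInt_le; [exact Hab | apply contseg_ex_Re, S | apply ex_RInt_const|].
intros t Ht. eapply Rle_trans; [apply Rle_abs|]. eapply Rle_trans; [apply Re_le_Cmod|].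
rewrite Cmod_mult, Mu, Rmult_1_l. apply HM. lra.
Qed.

Lemma CInt_affine (f : R -> C) (u v a b : R) : contseg f (u * a + v) (u * b + v) ->
  CInt (fun t => RtoC u * f (u * t + v)%R)%C a b = CInt f (u * a + v) (u * b + v).
Proof.
intros H. unfold CInt. apply injective_projections; cbn [fst snd].
- rewrite <- (RInt_comp_lin (V := R_CompleteNormedModule) (fun t => fst (f t)) u v a b)
    by (apply contseg_ex_Re, H).
  apply RInt_ext. intros t _. simpl. unfold scal; simpl; unfold mult; simpl. ring.
- rewrite <- (RInt_comp_lin (V := R_CompleteNormedModule) (fun t => snd (f t)) u v a b)
    by (apply contseg_ex_Im, H).
  apply RInt_ext. intros t _. simpl. unfold scal; simpl; unfold mult; simpl. ring.
Qed.

(** * Integrals with a parameter and exchange of integrations *)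

Lemma continuity_2d_slice_r (f : R -> R -> R) (x y : R) :
  continuity_2d_pt f x y -> continuous (f x) y.
Proof.
intros H. apply (filterlim_locally (f x) (f x y)). intros eps. destruct (H eps) as [d Hd].
exists d. intros v Hv. apply Hd; [|exact Hv]. rewrite Rminus_diag. rewrite Rabs_R0. apply cond_pos.
Qed.

Lemma continuity_2d_slice_l (f : R -> R -> R) (x y : R) :
  continuity_2d_pt f x y -> continuous (fun u => f u y) x.
Proof.
intros H. apply (filterlim_locally (fun u => f u y) (f x y)). intros eps.
  destruct (H eps) as [d Hd].
exists d. intros v Hv. apply Hd; [exact Hv|]. rewrite Rminus_diag. rewrite Rabs_R0. apply cond_pos.
Qed.

Lemma RInt_param_continuous (f : R -> R -> R) (c d x : R) : c <= d ->
  (forall u y, c <= y <= d -> continuity_2d_pt f u y) ->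
  continuous (fun u => RInt (f u) c d) x.
Proof.
intros Hcd H.
assert (Ex : forall u, ex_RInt (f u) c d).
{ intros u. apply (ex_RInt_continuous (V := R_CompleteNormedModule)).
  rewrite Rmin_left, Rmax_right by exact Hcd. intros y Hy. apply continuity_2d_slice_r, H, Hy. }
apply (filterlim_locally (fun u => RInt (f u) c d) (RInt (f x) c d)). intros eps.
(* The [+ 1] keeps the quotient meaningful when [c = d], and the half makes the final estimate
   strict. *)
assert (He : 0 < eps / 2 / (d - c + 1)).
{ pose proof (cond_pos eps). apply Rdiv_lt_0_compat; lra. }
destruct (uniform_continuity_2d_1d' f c d x (fun y Hy => H x y Hy) (mkposreal _ He)) as [del Hdel].
exists del. intros u Hu.
assert (Hu' : Rabs (u - x) < del) by exact Hu. apply Rabs_def2 in Hu'.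
change (Rabs (RInt (f u) c d - RInt (f x) c d) < eps).
rewrite <- (RInt_minus (V := R_CompleteNormedModule)) by auto.
apply Rle_lt_trans with ((d - c) * (eps / 2 / (d - c + 1))).
- apply (abs_RInt_le_const (fun y => minus (f u y) (f x y))); [exact Hcd| |].
  + apply (ex_RInt_minus (V := R_NormedModule)); auto.
  + intros t Ht. apply Rlt_le.
    assert (Z : Rabs (t - t) < del) by (rewrite Rminus_diag, Rabs_R0; apply cond_pos).
    assert (C1 : x - del <= x <= x + del) by (pose proof (cond_pos del); lra).
    assert (C2 : x - del <= u <= x + del) by lra.
    exact (Hdel t x t u Ht C1 Ht C2 Z).
- pose proof (cond_pos eps). apply Rle_lt_trans with (eps / 2); [|lra].
  apply Rle_trans with ((d - c + 1) * (eps / 2 / (d - c + 1))).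
  + apply Rmult_le_compat_r; lra.
  + right. field. lra.
Qed.

(** Fubini by differentiation: with [b] replaced by a variable [z], both sides vanish at [z = a] and
    have the derivative [RInt (f z) c d]. *)
Lemma RInt_swap_global (f : R -> R -> R) (a b c d : R) : a <= b -> c <= d ->
  (forall x y, continuity_2d_pt f x y) ->
  RInt (fun x => RInt (f x) c d) a b = RInt (fun y => RInt (fun x => f x y) a b) c d.
Proof.
intros Hab Hcd H.
assert (Ex : forall y u v, ex_RInt (fun x => f x y) u v).
{ intros y u v. apply (ex_RInt_continuous (V := R_CompleteNormedModule)). intros x _.
  apply continuity_2d_slice_l, H. }
assert (D1 : forall x y, is_derive (fun z => RInt (fun u => f u y) a z) x (f x y)).
{ intros x y. apply (is_derive_RInt (V := R_NormedModule) (fun u => f u y) _ a x).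
  - apply filter_forall. intros z. apply (RInt_correct (V := R_CompleteNormedModule)), Ex.
  - apply continuity_2d_slice_l, H. }
assert (D2 : forall x, is_derive (fun z => RInt (fun y => RInt (fun u => f u y) a z) c d) x
                         (RInt (f x) c d)).
{ intros x.
  replace (RInt (f x) c d)
    with (RInt (fun y => Derive (fun z => RInt (fun u => f u y) a z) x) c d)
    by (apply RInt_ext; intros y _; apply is_derive_unique, D1).
  apply (is_derive_RInt_param (fun z y => RInt (fun u => f u y) a z)).
  - apply filter_forall. intros z y _. exists (f z y). apply D1.
  - intros y _. apply continuity_2d_pt_ext with (2 := H x y). intros u v.
    symmetry. apply is_derive_unique, D1.
  - apply filter_forall. intros z. apply (ex_RInt_continuous (V := R_CompleteNormedModule)).
    intros y _.
    assert (Sw : forall u v, continuity_2d_pt (fun v u => f u v) u v).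
    { intros u v eps. destruct (H v u eps) as [del Hdel]. exists del. intros p q Hp Hq.
      apply Hdel; assumption. }
    destruct (Rle_dec a z) as [Haz|Haz].
    + apply (RInt_param_continuous (fun y u => f u y) a z y Haz). auto.
    + apply (continuous_ext (fun y => opp (RInt (fun u => f u y) z a))).
      * intros v. apply (opp_RInt_swap (V := R_CompleteNormedModule)). apply Ex.
      * apply (continuous_opp (V := R_NormedModule)).
        apply (RInt_param_continuous (fun y u => f u y) z a y); [lra|]. auto. }
assert (E : is_RInt (fun x => RInt (f x) c d) a b
   (minus (RInt (fun y => RInt (fun u => f u y) a b) c d)
          (RInt (fun y => RInt (fun u => f u y) a a) c d))).
{ apply (is_RInt_derive (V := R_CompleteNormedModule)
    (fun z => RInt (fun y => RInt (fun u => f u y) a z) c d)).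
  - intros x _. apply D2.
  - intros x _. apply RInt_param_continuous; auto. }
apply is_RInt_unique in E. rewrite E.
rewrite (RInt_ext (fun y => RInt (fun u => f u y) a a) (fun _ => 0)).
- rewrite RInt_const. unfold minus, plus, opp, scal. simpl. unfold mult. simpl. ring.
- intros y _. apply (RInt_point (V := R_CompleteNormedModule)).
Qed.

(** The retraction of the line onto [[a, b]]. Composing with it extends a function continuous on a
    rectangle to the whole plane, where continuity can be demanded everywhere. *)
Definition clamp (a b x : R) : R := Rmax a (Rmin b x).

Lemma clamp_in (a b x : R) : a <= b -> a <= clamp a b x <= b.
Proof. intros H. unfold clamp, Rmax, Rmin. destruct (Rle_dec b x); destruct (Rle_dec a _); lra. Qed.

Lemma clamp_id (a b x : R) : a <= x <= b -> clamp a b x = x.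
Proof. intros H. unfold clamp, Rmax, Rmin. destruct (Rle_dec b x); destruct (Rle_dec a _); lra. Qed.

Lemma clamp_Lipschitz (a b x y : R) : a <= b -> Rabs (clamp a b x - clamp a b y) <= Rabs (x - y).
Proof.
intros H. unfold clamp, Rmax, Rmin.
destruct (Rle_dec b x), (Rle_dec b y), (Rle_dec a b), (Rle_dec a x), (Rle_dec a y);
  unfold Rabs; repeat (destruct (Rcase_abs _)); lra.
Qed.

Lemma RInt_swap (f : R -> R -> R) (a b c d : R) : a <= b -> c <= d ->
  (forall x y, a <= x <= b -> c <= y <= d -> continuity_2d_pt f x y) ->
  RInt (fun x => RInt (f x) c d) a b = RInt (fun y => RInt (fun x => f x y) a b) c d.
Proof.
intros Hab Hcd H.
set (g := fun x y => f (clamp a b x) (clamp c d y)).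
assert (E : forall x y, a < x < b -> c < y < d -> f x y = g x y).
{ intros x y Hx Hy. unfold g. rewrite !clamp_id; [reflexivity | lra | lra]. }
transitivity (RInt (fun x => RInt (g x) c d) a b).
{ apply RInt_ext. rewrite Rmin_left, Rmax_right by exact Hab. intros x Hx.
  apply RInt_ext. rewrite Rmin_left, Rmax_right by exact Hcd. intros y Hy. apply E; auto. }
transitivity (RInt (fun y => RInt (fun x => g x y) a b) c d).
2: { apply RInt_ext. rewrite Rmin_left, Rmax_right by exact Hcd. intros y Hy.
     apply RInt_ext. rewrite Rmin_left, Rmax_right by exact Hab. intros x Hx. symmetry. apply E;
       auto. }
apply RInt_swap_global; [exact Hab | exact Hcd|].
intros x y eps.
destruct (H _ _ (clamp_in a b x Hab) (clamp_in c d y Hcd) eps) as [del Hdel].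
exists del. intros u v Hu Hv. apply Hdel.
- eapply Rle_lt_trans; [apply clamp_Lipschitz, Hab | exact Hu].
- eapply Rle_lt_trans; [apply clamp_Lipschitz, Hcd | exact Hv].
Qed.

Lemma CInt_swap (H : C -> C) (a b c d : R) : a <= b -> c <= d ->
  (forall x y, a <= x <= b -> c <= y <= d -> ccont H (x, y)) ->
  CInt (fun x => CInt (fun y => H (x, y)) c d) a b =
  CInt (fun y => CInt (fun x => H (x, y)) a b) c d.
Proof.
intros Hab Hcd Hc. unfold CInt. apply injective_projections; cbn [fst snd].
- apply (RInt_swap (fun x y => fst (H (x, y)))); auto. intros x y Hx Hy.
  apply (ccont_continuity_2d (fun p => fst (H p))), cont_Re, Hc; auto.
- apply (RInt_swap (fun x y => snd (H (x, y)))); auto. intros x y Hx Hy.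
  apply (ccont_continuity_2d (fun p => snd (H p))), cont_Im, Hc; auto.
Qed.

(** * Integrals along segments and triangles *)

Definition seg (f : C -> C) (a b : C) : C :=
  ((b - a) * CInt (fun t => f (a + RtoC t * (b - a))) 0 1)%C.

Definition tri (f : C -> C) (a b c : C) : C := (seg f a b + seg f b c + seg f c a)%C.

Definition cont_disk (rad : R) (f : C -> C) : Prop := forall z, Cmod z < rad -> ccont f z.

Definition holo (rad : R) (f : C -> C) : Prop :=
  forall z, Cmod z < rad -> exists d, cder f z d.

Lemma holo_cont (rad : R) (f : C -> C) : holo rad f -> cont_disk rad f.
Proof. intros H z Hz. destruct (H z Hz) as [d Hd]. eapply der_cont, Hd. Qed.

Lemma rcont_affine (a b : C) (t : R) : rcont (fun u => a + RtoC u * b)%C t.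
Proof. apply cont_plus; [apply cont_const|]. apply cont_mult; [apply cont_embed
  | apply cont_const]. Qed.

Lemma rder_affine (a b : C) (t : R) : rder (fun u => a + RtoC u * b)%C t b.
Proof.
eapply der_eq.
2: { apply der_plus; [apply der_const|].
     apply (der_mult RtoC RtoC (fun _ => b) t 1 0); [apply der_embed | apply der_const]. }
cbv beta. ring.
Qed.

Lemma Cmod_segment (a b : C) (t M : R) : 0 <= t <= 1 -> Cmod a <= M -> Cmod b <= M ->
  Cmod (a + RtoC t * (b - a)) <= M.
Proof.
intros Ht Ha Hb.
replace (a + RtoC t * (b - a))%C with (RtoC (1 - t) * a + RtoC t * b)%C
  by (rewrite RtoC_minus; ring).
eapply Rle_trans; [apply Cmod_triangle|]. rewrite !Cmod_mult, !Cmod_R, !Rabs_pos_eq by lra. nra.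
Qed.

Lemma Cmod_segment_lt (a b : C) (t M : R) : 0 <= t <= 1 -> Cmod a < M -> Cmod b < M ->
  Cmod (a + RtoC t * (b - a)) < M.
Proof.
intros Ht Ha Hb. apply Rle_lt_trans with (Rmax (Cmod a) (Cmod b)).
- apply Cmod_segment; [exact Ht | apply Rmax_l | apply Rmax_r].
- apply Rmax_lub_lt; assumption.
Qed.

Lemma contseg_segment (rad : R) (f : C -> C) (a b : C) (u v : R) : cont_disk rad f ->
  Cmod a < rad -> Cmod b < rad -> 0 <= Rmin u v -> Rmax u v <= 1 ->
  contseg (fun t => f (a + RtoC t * (b - a)))%C u v.
Proof.
intros Hf Ha Hb Hu Hv t Ht. apply cont_comp; [|apply rcont_affine].
apply Hf, Cmod_segment_lt; auto; lra.
Qed.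

Lemma Rmin01 : Rmin 0 1 = 0. Proof. apply Rmin_left; lra. Qed.
Lemma Rmax01 : Rmax 0 1 = 1. Proof. apply Rmax_right; lra. Qed.

Lemma contseg01 (rad : R) (f : C -> C) (a b : C) : cont_disk rad f ->
  Cmod a < rad -> Cmod b < rad -> contseg (fun t => f (a + RtoC t * (b - a)))%C 0 1.
Proof.
intros Hf Ha Hb. eapply contseg_segment; eauto; rewrite ?Rmin01, ?Rmax01; lra.
Qed.

Lemma CInt_swap_bounds (g : R -> C) (a b : R) : contseg g a b -> CInt g b a = (- CInt g a b)%C.
Proof.
intros H. assert (H' : contseg g b a).
{ intros t Ht. apply H. rewrite Rmin_comm, Rmax_comm. exact Ht. }
assert (Z : contseg g a a).
{ intros t Ht. apply H. rewrite Rmin_left, Rmax_left in Ht by lra.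
  replace t with a by lra. split; [apply Rmin_l | apply Rmax_l]. }
pose proof (CInt_Chasles g a b a H H') as E.
assert (CInt g a a = 0)%C as E0.
{ unfold CInt. rewrite !(RInt_point (V := R_CompleteNormedModule)). reflexivity. }
rewrite E0 in E. replace (CInt g b a) with ((CInt g a b + CInt g b a) - CInt g a b)%C by ring.
rewrite E. ring.
Qed.

Lemma seg_rev (rad : R) (f : C -> C) (a b : C) : cont_disk rad f ->
  Cmod a < rad -> Cmod b < rad -> seg f b a = (- seg f a b)%C.
Proof.
intros Hf Ha Hb. unfold seg. set (g := fun t => f (a + RtoC t * (b - a))%C).
assert (Hg : contseg g 0 1) by (apply (contseg01 rad); auto).
assert (Hg' : contseg g 1 0).
{ intros t Ht. apply Hg. rewrite Rmin_comm, Rmax_comm. exact Ht. }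
assert (E := CInt_affine g (-1) 1 0 1).
replace (-1 * 0 + 1) with 1 in E by ring. replace (-1 * 1 + 1) with 0 in E by ring.
specialize (E Hg'). rewrite (CInt_swap_bounds g 0 1 Hg) in E.
assert (Hh : contseg (fun t => g (-1 * t + 1)%R) 0 1).
{ intros t Ht. rewrite Rmin01, Rmax01 in Ht.
  apply cont_local with (f := fun t => f (b + RtoC t * (a - b))%C) (eta := 1); [lra| |].
  - intros y _. unfold g. f_equal. rewrite RtoC_plus, RtoC_mult.
    replace (RtoC (-1)) with (-(1))%C by (rewrite <- RtoC_opp; reflexivity). ring.
  - apply (contseg01 rad f b a); auto. rewrite Rmin01, Rmax01. exact Ht. }
rewrite CInt_scal in E by exact Hh.
rewrite (CInt_ext (fun t => f (b + RtoC t * (a - b)))%C (fun t => g (-1 * t + 1)%R)).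
- replace (CInt (fun t => g (-1 * t + 1)%R) 0 1)
    with (- (RtoC (-1) * CInt (fun t => g (-1 * t + 1)%R) 0 1))%C.
  + rewrite E. fold g. ring.
  + replace (RtoC (-1)) with (-(1))%C by (rewrite <- RtoC_opp; reflexivity). ring.
- intros t _. unfold g. f_equal. rewrite RtoC_plus, RtoC_mult.
    replace (RtoC (-1)) with (-(1))%C by (rewrite <- RtoC_opp; reflexivity). ring.
Qed.

Definition mid (a b : C) : C := ((a + b) / RtoC 2)%C.

Lemma RtoC_2_neq_0 : RtoC 2 <> 0%C.
Proof. intros H. apply RtoC_inj in H. lra. Qed.

Lemma RtoC_half : RtoC (/ 2) = (/ RtoC 2)%C.
Proof. apply RtoC_inv. lra. Qed.

Lemma mid_segment (a b : C) : mid a b = (a + RtoC (/ 2) * (b - a))%C.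
Proof.
unfold mid. rewrite RtoC_half. pose proof RtoC_2_neq_0. 
replace (RtoC 2) with (1 + 1)%C in * by (rewrite <- RtoC_plus; f_equal; ring). field; auto.
Qed.

Lemma seg_mid (rad : R) (f : C -> C) (a b : C) : cont_disk rad f ->
  Cmod a < rad -> Cmod b < rad -> seg f a b = (seg f a (mid a b) + seg f (mid a b) b)%C.
Proof.
intros Hf Ha Hb. unfold seg. set (g := fun t => f (a + RtoC t * (b - a))%C).
assert (H1 : contseg g 0 (/ 2)).
{ apply (contseg_segment rad); auto; [rewrite Rmin_left | rewrite Rmax_right]; lra. }
assert (H2 : contseg g (/ 2) 1).
{ apply (contseg_segment rad); auto; [rewrite Rmin_left | rewrite Rmax_right]; lra. }
rewrite <- (CInt_Chasles g 0 (/ 2) 1) by auto.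
assert (E1 := CInt_affine g (/ 2) 0 0 1). assert (E2 := CInt_affine g (/ 2) (/ 2) 0 1).
replace (/ 2 * 0 + 0) with 0 in E1 by ring. replace (/ 2 * 1 + 0) with (/ 2) in E1 by ring.
replace (/ 2 * 0 + / 2) with (/ 2) in E2 by ring. replace (/ 2 * 1 + / 2) with 1 in E2 by field.
rewrite <- (E1 H1), <- (E2 H2).
assert (Hm : Cmod (mid a b) < rad).
{ rewrite mid_segment. apply Cmod_segment_lt; auto; lra. }
assert (Q1 : forall t, g (/ 2 * t + 0) = f (a + RtoC t * (mid a b - a))%C).
{ intros t. unfold g. f_equal. rewrite mid_segment, RtoC_plus, RtoC_mult. ring. }
assert (Q2 : forall t, g (/ 2 * t + / 2) = f (mid a b + RtoC t * (b - mid a b))%C).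
{ intros t. unfold g. f_equal. rewrite RtoC_plus, RtoC_mult, mid_segment, RtoC_half.
  pose proof RtoC_2_neq_0. replace (RtoC 2) with (1 + 1)%C in * by (rewrite <- RtoC_plus;
    f_equal; ring).
  field; auto. }
rewrite (CInt_ext _ (fun t => RtoC (/ 2) * f (a + RtoC t * (mid a b - a)))%C 0 1)
  by (intros t _; rewrite Q1; reflexivity).
rewrite (CInt_ext (fun t => RtoC (/ 2) * g (/ 2 * t + / 2)%R)%C
                  (fun t => RtoC (/ 2) * f (mid a b + RtoC t * (b - mid a b)))%C 0 1)
  by (intros t _; rewrite Q2; reflexivity).
rewrite !CInt_scal by (apply (contseg01 rad); auto).
set (I1 := CInt (fun t => f (a + RtoC t * (mid a b - a))%C) 0 1).
set (I2 := CInt (fun t => f (mid a b + RtoC t * (b - mid a b))%C) 0 1).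
replace (mid a b - a)%C with (RtoC (/ 2) * (b - a))%C by (rewrite mid_segment; ring).
replace (b - mid a b)%C with (RtoC (/ 2) * (b - a))%C.
- ring.
- rewrite mid_segment, RtoC_half. pose proof RtoC_2_neq_0.
  replace (RtoC 2) with (1 + 1)%C in * by (rewrite <- RtoC_plus; f_equal; ring). field; auto.
Qed.

Lemma seg_FTC (G g : C -> C) (a b : C) :
  (forall t, 0 <= t <= 1 -> cder G (a + RtoC t * (b - a))%C (g (a + RtoC t * (b - a))%C)) ->
  contseg (fun t => g (a + RtoC t * (b - a)))%C 0 1 -> seg g a b = (G b - G a)%C.
Proof.
intros HG Hg. unfold seg. rewrite <- CInt_scal by exact Hg.
rewrite (CInt_FTC (fun t => G (a + RtoC t * (b - a))%C)).
- f_equal; f_equal.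
  + ring.
  + f_equal. ring.
- rewrite Rmin01, Rmax01. intros t Ht.
  eapply der_eq.
  2: { apply (der_comp RtoC G (fun t => a + RtoC t * (b - a))%C); [apply HG, Ht
    | apply rder_affine]. }
  ring.
- apply contseg_scal, Hg.
Qed.

Lemma cder_quadratic (c0 c1 z0 z : C) :
  cder (fun z => c0 * z + c1 * ((z - z0) * (z - z0) / RtoC 2))%C z (c0 + c1 * (z - z0))%C.
Proof.
eapply der_eq.
2: { apply der_plus.
     - apply (der_scal _ c0 (fun z => z) z 1), der_embed.
     - apply (der_scal _ c1 (fun z => (z - z0) * (z - z0) / RtoC 2)%C z (((1 - 0) * (z - z0)
         + (z - z0) * (1 - 0)) * / RtoC 2 + (z - z0) * (z - z0) * 0)%C).
       apply (der_mult (fun z : C => z) (fun z => (z - z0) * (z - z0))%C (fun _ => / RtoC 2)%C z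
         ((1 - 0) * (z - z0) + (z - z0) * (1 - 0))%C 0).
       + apply (der_mult (fun z : C => z) (fun z => z - z0)%C (fun z => z - z0)%C z (1 - 0) (1 -
           0)); (apply der_minus; [apply der_embed | apply der_const]).
       + apply der_const. }
cbv beta. pose proof RtoC_2_neq_0. replace (RtoC 2) with (1 + 1)%C in * by (rewrite <- RtoC_plus;
  f_equal; ring).
field; auto.
Qed.

(** An affine function has a primitive. In Goursat's argument the first-order part of [f] therefore
    contributes nothing. *)
Lemma tri_affine (c0 c1 z0 a b c : C) : tri (fun z => c0 + c1 * (z - z0))%C a b c = 0%C.
Proof.
assert (K : forall z, ccont (fun z => c0 + c1 * (z - z0))%C z).
{ intros z. apply cont_plus; [apply cont_const|]. apply cont_mult; [apply cont_const|].
  apply cont_minus; [apply cont_embed | apply cont_const]. }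
assert (E : forall u v, seg (fun z => c0 + c1 * (z - z0))%C u v =
  (c0 * v + c1 * ((v - z0) * (v - z0) / RtoC 2)
   - (c0 * u + c1 * ((u - z0) * (u - z0) / RtoC 2)))%C).
{ intros u v. apply (seg_FTC (fun z => c0 * z + c1 * ((z - z0) * (z - z0) / RtoC 2))%C).
  - intros t _. apply cder_quadratic.
  - intros t _. apply (cont_comp RtoC (fun z => c0 + c1 * (z - z0))%C); [apply K
      | apply rcont_affine]. }
unfold tri. rewrite !E. ring.
Qed.

(** * Goursat and Cauchy *)

Lemma pow_inv2_S (L : R) (n : nat) : L / 2 ^ S n = L / 2 ^ n / 2.
Proof. simpl. field. apply pow_nonzero. lra. Qed.

Lemma div_pow2_nonneg (L : R) (n : nat) : 0 <= L -> 0 <= L / 2 ^ n.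
Proof. intros H. apply Rdiv_le_0_compat; [exact H | apply pow_lt; lra]. Qed.

Lemma geometric_limit_R (u : nat -> R) (L : R) :
  (forall n, Rabs (u (S n) - u n) <= L / 2 ^ n) ->
  exists l, forall n, Rabs (u n - l) <= 2 * (L / 2 ^ n).
Proof.
intros H.
assert (HL : 0 <= L).
{ specialize (H 0%nat). simpl in H. pose proof (Rabs_pos (u 1%nat - u 0%nat)). lra. }
(* The subtracted last term of the geometric tail is what lets the induction on [k] close. *)
assert (K : forall n k, Rabs (u (n + k)%nat - u n) <= 2 * (L / 2 ^ n) - 2 * (L / 2 ^ (n + k))).
{ intros n k. induction k as [|k IH].
  - rewrite Nat.add_0_r, Rminus_diag, Rabs_R0. lra.
  - rewrite Nat.add_succ_r, pow_inv2_S.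
    replace (u (S (n + k)) - u n) with ((u (S (n + k)) - u (n + k)%nat) + (u (n
      + k)%nat - u n)) by ring.
    eapply Rle_trans; [apply Rabs_triang|]. specialize (H (n + k)%nat). lra. }
assert (B : forall n k, Rabs (u (n + k)%nat - u n) <= 2 * (L / 2 ^ n)).
{ intros n k. eapply Rle_trans; [apply K|]. pose proof (div_pow2_nonneg L (n + k) HL). lra. }
assert (Small : forall eps, 0 < eps -> exists N, 4 * (L / 2 ^ N) < eps).
{ intros eps He. destruct (pow_lt_1_zero (/ 2)) with (y := eps / (4 * (L + 1))) as [N HN].
  - rewrite Rabs_pos_eq; lra.
  - apply Rdiv_lt_0_compat; lra.
  - exists N. specialize (HN N (Nat.le_refl N)). rewrite Rabs_pos_eq in HN by (apply pow_le; lra).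
    rewrite pow_inv in HN. unfold Rdiv at 1.
    assert (0 < / 2 ^ N) by (apply Rinv_0_lt_compat, pow_lt; lra).
    apply (Rmult_lt_compat_l (4 * (L + 1))) in HN; [|lra].
    replace (4 * (L + 1) * (eps / (4 * (L + 1)))) with eps in HN by (field; lra). nra. }
destruct (Rcomplete.R_complete u) as [l Hl].
{ intros eps He. destruct (Small eps He) as [N HN]. exists N. intros n m Hn Hm. unfold Rdist.
  replace (u n - u m) with ((u n - u N) - (u m - u N)) by ring.
  replace n with (N + (n - N))%nat by lia. replace m with (N + (m - N))%nat by lia.
  pose proof (B N (n - N)%nat). pose proof (B N (m - N)%nat).
  eapply Rle_lt_trans; [apply Rabs_triang|]. rewrite Rabs_Ropp. lra. }
exists l. intros n. apply le_epsilon. intros eps He. destruct (Hl eps He) as [N HN].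
specialize (HN (n + N)%nat ltac:(lia)). unfold Rdist in HN. pose proof (B n N) as Bn.
replace (u n - l) with ((u (n + N)%nat - l) - (u (n + N)%nat - u n)) by ring.
eapply Rle_trans; [apply Rabs_triang|]. rewrite Rabs_Ropp. lra.
Qed.

Lemma geometric_limit (u : nat -> C) (L : R) :
  (forall n, Cmod (u (S n) - u n) <= L / 2 ^ n) ->
  exists l, forall n, Cmod (u n - l) <= 4 * (L / 2 ^ n).
Proof.
intros H.
destruct (geometric_limit_R (fun n => fst (u n)) L) as [x Hx].
{ intros n. eapply Rle_trans; [apply (Re_le_Cmod (u (S n) - u n)) | apply H]. }
destruct (geometric_limit_R (fun n => snd (u n)) L) as [y Hy].
{ intros n. eapply Rle_trans; [apply (Im_le_Cmod (u (S n) - u n)) | apply H]. }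
exists (x, y). intros n. eapply Rle_trans; [apply Cmod_le_Re_Im|]. simpl.
specialize (Hx n). specialize (Hy n). unfold Rminus in *. lra.
Qed.

Lemma mid_mid (a b c : C) (L : R) : Cmod (b - a) <= L ->
  Cmod (mid c a - mid c b) <= L / 2.
Proof.
intros H. rewrite !mid_segment.
replace (c + RtoC (/ 2) * (a - c) - (c + RtoC (/ 2) * (b - c)))%C
  with (RtoC (/ 2) * (a - b))%C by ring.
rewrite Cmod_mult, Cmod_R, Rabs_pos_eq, Cmod_minus_sym by lra. lra.
Qed.

Lemma mid_left (a b : C) (L : R) : Cmod (b - a) <= L -> Cmod (mid a b - a) <= L / 2.
Proof.
intros H. rewrite mid_segment.
replace (a + RtoC (/ 2) * (b - a) - a)%C with (RtoC (/ 2) * (b - a))%C by ring.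
rewrite Cmod_mult, Cmod_R, Rabs_pos_eq by lra. lra.
Qed.

Lemma mid_sym (a b : C) : mid a b = mid b a.
Proof. unfold mid. f_equal. ring. Qed.

Lemma mid_in (a b : C) (M : R) : Cmod a <= M -> Cmod b <= M -> Cmod (mid a b) <= M.
Proof. intros Ha Hb. rewrite mid_segment. apply Cmod_segment; auto; lra. Qed.

(** Each side splits at its midpoint, and the central triangle runs through every midline against
    the corner triangle that shares it. *)
Lemma tri_split (rad : R) (f : C -> C) (a b c : C) : cont_disk rad f ->
  Cmod a < rad -> Cmod b < rad -> Cmod c < rad ->
  tri f a b c = (tri f a (mid a b) (mid c a) + tri f (mid a b) b (mid b c)
                 + tri f (mid c a) (mid b c) c + tri f (mid a b) (mid b c) (mid c a))%C.
Proof.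
intros Hf Ha Hb Hc.
assert (Hm : forall u v, Cmod u < rad -> Cmod v < rad -> Cmod (mid u v) < rad).
{ intros u v Hu Hv. rewrite mid_segment. apply Cmod_segment_lt; auto; lra. }
unfold tri.
rewrite (seg_mid rad f a b), (seg_mid rad f b c), (seg_mid rad f c a) by auto.
rewrite (seg_rev rad f (mid c a) (mid a b)), (seg_rev rad f (mid a b) (mid b c)),
  (seg_rev rad f (mid b c) (mid c a)) by auto.
ring.
Qed.

(** The invariant of the bisection: sides halve, while the integral loses at most a factor four per
    step. The bound [M] keeps all triangles in a compact disk, so that their limit lies in the open
    one. *)
Definition small_triangle (f : C -> C) (M L eta : R) (n : nat) (T : C * C * C) : Prop :=
  let '(a, b, c) := T in
  (Cmod a <= M /\ Cmod b <= M /\ Cmod c <= M) /\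
  (Cmod (b - a) <= L / 2 ^ n /\ Cmod (c - b) <= L / 2 ^ n /\ Cmod (a - c) <= L / 2 ^ n) /\
  eta / 2 ^ n / 2 ^ n <= Cmod (tri f a b c).

Local Ltac dist_sym := first [eassumption | rewrite Cmod_minus_sym; eassumption].

Lemma small_triangle_step (rad : R) (f : C -> C) (M L eta : R) (n : nat) (T : C * C * C) :
  cont_disk rad f -> M < rad -> small_triangle f M L eta n T ->
  exists T', small_triangle f M L eta (S n) T' /\
    Cmod (fst (fst T') - fst (fst T)) <= L / 2 ^ n.
Proof.
intros Hf HM. destruct T as [[a b] c]. intros [[Ma [Mb Mc]] [[Lab [Lbc Lca]] Ht]].
assert (E := tri_split rad f a b c Hf ltac:(lra) ltac:(lra) ltac:(lra)).
pose proof (Cmod_nonneg (b - a)%C) as P.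
set (l := L / 2 ^ n) in *. set (h := eta / 2 ^ n / 2 ^ n) in *.
assert (Hh : eta / 2 ^ S n / 2 ^ S n = h / 4).
{ unfold h. simpl. field. apply pow_nonzero. lra. }
assert (Hl : L / 2 ^ S n = l / 2) by apply pow_inv2_S.
unfold small_triangle. rewrite Hh, Hl. clear Hh Hl.
destruct (Rle_dec (h / 4) (Cmod (tri f a (mid a b) (mid c a)))) as [H1|H1].
{ exists (a, mid a b, mid c a). cbn [fst]. repeat split; auto using mid_in.
  - apply mid_left, Lab.
  - rewrite (mid_sym c a). apply mid_mid; dist_sym.
  - rewrite (mid_sym c a), Cmod_minus_sym. apply mid_left. rewrite Cmod_minus_sym. exact Lca.
  - replace (a - a)%C with (RtoC 0) by ring. rewrite Cmod_0. lra. }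
destruct (Rle_dec (h / 4) (Cmod (tri f (mid a b) b (mid b c)))) as [H2|H2].
{ exists (mid a b, b, mid b c). cbn [fst]. repeat split; auto using mid_in.
  - rewrite (mid_sym a b), Cmod_minus_sym. apply mid_left. rewrite Cmod_minus_sym. exact Lab.
  - apply mid_left, Lbc.
  - rewrite (mid_sym a b). apply mid_mid; dist_sym.
  - pose proof (mid_left a b l Lab). lra. }
destruct (Rle_dec (h / 4) (Cmod (tri f (mid c a) (mid b c) c))) as [H3|H3].
{ exists (mid c a, mid b c, c). cbn [fst]. repeat split; auto using mid_in.
  - rewrite (mid_sym b c). apply mid_mid; dist_sym.
  - rewrite (mid_sym b c), Cmod_minus_sym. apply mid_left. rewrite Cmod_minus_sym. exact Lbc.
  - apply mid_left, Lca.
  - rewrite (mid_sym c a). pose proof (mid_left a c l). rewrite Cmod_minus_sym in H.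
      specialize (H Lca). lra. }
destruct (Rle_dec (h / 4) (Cmod (tri f (mid a b) (mid b c) (mid c a)))) as [H4|H4].
{ exists (mid a b, mid b c, mid c a). cbn [fst]. repeat split; auto using mid_in.
  - rewrite (mid_sym a b). apply mid_mid; dist_sym.
  - rewrite (mid_sym b c). apply mid_mid; dist_sym.
  - rewrite (mid_sym c a). apply mid_mid; dist_sym.
  - pose proof (mid_left a b l Lab). lra. }
exfalso. apply Rnot_le_lt in H1, H2, H3, H4.
assert (Cmod (tri f a b c) < h); [|lra].
rewrite E. eapply Rle_lt_trans; [apply Cmod_triangle|].
eapply Rle_lt_trans; [apply Rplus_le_compat_r, Cmod_triangle|].
eapply Rle_lt_trans; [apply Rplus_le_compat_r, Rplus_le_compat_r, Cmod_triangle|]. lra.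
Qed.

Lemma dependent_choice {A : Type} (P : nat -> A -> Prop) (Q : nat -> A -> A -> Prop) (x0 : A) :
  P 0%nat x0 -> (forall n x, P n x -> exists y, P (S n) y /\ Q n x y) ->
  exists u : nat -> A, u 0%nat = x0 /\ forall n, P n (u n) /\ Q n (u n) (u (S n)).
Proof.
intros H0 H.
set (next := fun n x => epsilon (inhabits x0) (fun y => P (S n) y /\ Q n x y)).
set (u := fix u n := match n with O => x0 | S n => next n (u n) end).
assert (K : forall n x, P n x -> P (S n) (next n x) /\ Q n x (next n x)).
{ intros n x Hx. exact (epsilon_spec (inhabits x0) (fun y => P (S n) y /\ Q n x y) (H n x Hx)). }
exists u. split; [reflexivity|].
assert (Pn : forall n, P n (u n)).
{ induction n as [|n IH]; [exact H0|]. exact (proj1 (K n (u n) IH)). }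
intros n. split; [apply Pn|]. exact (proj2 (K n (u n) (Pn n))).
Qed.

Lemma seg_minus (rad : R) (f g : C -> C) (a b : C) : cont_disk rad f -> cont_disk rad g ->
  Cmod a < rad -> Cmod b < rad ->
  seg (fun z => f z - g z)%C a b = (seg f a b - seg g a b)%C.
Proof.
intros Hf Hg Ha Hb. unfold seg. rewrite CInt_minus by (apply (contseg01 rad); auto). ring.
Qed.

Lemma seg_Cmod_le (rad : R) (f : C -> C) (a b : C) (M : R) : cont_disk rad f ->
  Cmod a < rad -> Cmod b < rad ->
  (forall t, 0 <= t <= 1 -> Cmod (f (a + RtoC t * (b - a))%C) <= M) ->
  Cmod (seg f a b) <= Cmod (b - a) * M.
Proof.
intros Hf Ha Hb HM. unfold seg. rewrite Cmod_mult. apply Rmult_le_compat_l; [apply Cmod_nonneg|].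
replace M with (M * (1 - 0)) by ring. apply CInt_Cmod_le; [lra| |exact HM].
apply (contseg01 rad); auto.
Qed.

Theorem Goursat (rad : R) (f : C -> C) (a b c : C) : holo rad f ->
  Cmod a < rad -> Cmod b < rad -> Cmod c < rad -> tri f a b c = 0%C.
Proof.
intros Hf Ha Hb Hc. pose proof (holo_cont rad f Hf) as Cf.
destruct (Req_dec (Cmod (tri f a b c)) 0) as [E|NE]; [apply Cmod_eq_0, E|]. exfalso.
set (eta := Cmod (tri f a b c)) in *.
assert (He : 0 < eta) by (pose proof (Cmod_nonneg (tri f a b c)); unfold eta in *; lra).
set (M := Rmax (Cmod a) (Rmax (Cmod b) (Cmod c))).
assert (HM : M < rad) by (unfold M; repeat apply Rmax_lub_lt; auto).
assert (Ma : Cmod a <= M) by apply Rmax_l.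
assert (Mb : Cmod b <= M) by (eapply Rle_trans; [apply Rmax_l | apply Rmax_r]).
assert (Mc : Cmod c <= M) by (eapply Rle_trans; [apply Rmax_r | apply Rmax_r]).
(* The [+ 1] makes [L] positive even for a degenerate triangle. *)
set (L := Cmod (b - a) + Cmod (c - b) + Cmod (a - c) + 1).
pose proof (Cmod_nonneg (b - a)%C). pose proof (Cmod_nonneg (c - b)%C).
pose proof (Cmod_nonneg (a - c)%C).
assert (HL : 0 < L) by (unfold L; lra).
destruct (dependent_choice (small_triangle f M L eta)
  (fun n T T' => Cmod (fst (fst T') - fst (fst T)) <= L / 2 ^ n) (a, b, c)) as [u [_ Hu]].
{ unfold small_triangle. simpl. fold eta. unfold Rdiv. rewrite !Rinv_1, !Rmult_1_r.
  repeat split; auto; unfold L; lra. }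
{ intros n T HT. apply (small_triangle_step rad); auto. }
destruct (geometric_limit (fun n => fst (fst (u n))) L) as [z Hz].
{ intros n. apply Hu. }
assert (Small : forall eps, 0 < eps -> exists N, L / 2 ^ N < eps).
{ intros eps Heps. destruct (pow_lt_1_zero (/ 2)) with (y := eps / L) as [N HN].
  - rewrite Rabs_pos_eq; lra.
  - apply Rdiv_lt_0_compat; lra.
  - exists N. specialize (HN N (Nat.le_refl N)). rewrite Rabs_pos_eq in HN by (apply pow_le; lra).
    rewrite pow_inv in HN. apply (Rmult_lt_compat_l L) in HN; [|lra].
    replace (L * (eps / L)) with eps in HN by (field; lra). exact HN. }
assert (Mz : Cmod z <= M).
{ apply le_epsilon. intros eps Heps. destruct (Small (eps / 4) ltac:(lra)) as [N HN].
  specialize (Hz N). destruct (Hu N) as [Hs _]. destruct (u N) as [[p q] s].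
  destruct Hs as [[Hp _] _]. cbn [fst] in Hz.
  pose proof (Cmod_triangle_rev z p). rewrite Cmod_minus_sym in Hz. lra. }
destruct (Hf z ltac:(lra)) as [d Hd].
(* The limit point is within [5 l] of the [N]-th triangle (its first vertex is within [4 l]), so
   each side contributes at most [l * (k * 5 l)]. The total [15 k l^2] falls below the lower bound
   [20 k l^2]. *)
assert (Hk : 0 < eta / (20 * (L * L))).
{ apply Rdiv_lt_0_compat; [lra|]. nra. }
set (k := eta / (20 * (L * L))) in *.
destruct (Hd k Hk) as [del [Hdel Hd']].
destruct (Small (del / 5) ltac:(lra)) as [N HN].
specialize (Hz N). destruct (Hu N) as [Hs _]. destruct (u N) as [[p q] s].
destruct Hs as [[Mp [Mq Ms]] [[Lpq [Lqs Lsp]] Ht]]. cbn [fst] in Hz.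
pose proof (div_pow2_nonneg L N ltac:(lra)) as Pl. set (l := L / 2 ^ N) in *.
set (g := fun y => (f z + d * (y - z))%C).
assert (Cg : cont_disk rad g).
{ intros y _. apply cont_plus; [apply cont_const|]. apply cont_mult; [apply cont_const|].
  apply cont_minus; [apply cont_embed | apply cont_const]. }
assert (Cfg : cont_disk rad (fun y => f y - g y)%C) by (intros y Hy; apply cont_minus; auto).
assert (E : tri f p q s = tri (fun y => f y - g y)%C p q s).
{ transitivity (tri f p q s - tri g p q s)%C.
  - unfold g. rewrite tri_affine. ring.
  - unfold tri. rewrite !(seg_minus rad f g) by (auto; lra). ring. }
assert (B : forall v, Cmod (v - p) <= l -> Cmod (f v - g v) <= k * (5 * l)).
{ intros v Hv.
  assert (D : Cmod (v - z) <= 5 * l).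
  { replace (v - z)%C with ((v - p) + (p - z))%C by ring.
    eapply Rle_trans; [apply Cmod_triangle|]. lra. }
  replace (f v - g v)%C with (f v - f z - d * (v - z))%C by (unfold g; ring).
  eapply Rle_trans; [apply Hd'; lra|]. apply Rmult_le_compat_l; lra. }
assert (S1 : forall v w, Cmod v <= M -> Cmod w <= M -> Cmod (w - v) <= l ->
  Cmod (v - p) <= l -> Cmod (w - p) <= l ->
  Cmod (seg (fun y => f y - g y)%C v w) <= l * (k * (5 * l))).
{ intros v w Mv Mw Lvw Lv Lw.
  apply Rle_trans with (Cmod (w - v) * (k * (5 * l))).
  - apply (seg_Cmod_le rad); auto; try lra. intros t Ht'. apply B.
    replace (v + RtoC t * (w - v) - p)%C with ((v - p) + RtoC t * ((w - p) - (v - p)))%C by ring.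
    apply Cmod_segment; auto.
  - apply Rmult_le_compat_r; [|exact Lvw]. apply Rmult_le_pos; lra. }
assert (Lp : Cmod (p - p) <= l).
{ replace (p - p)%C with (RtoC 0) by ring. rewrite Cmod_0. exact Pl. }
assert (Ls : Cmod (s - p) <= l) by (rewrite Cmod_minus_sym; exact Lsp).
pose proof (S1 p q Mp Mq Lpq Lp Lpq) as T1.
pose proof (S1 q s Mq Ms Lqs Lpq Ls) as T2.
pose proof (S1 s p Ms Mp Lsp Ls Lp) as T3.
assert (T : Cmod (tri f p q s) <= 15 * k * (l * l)).
{ rewrite E. unfold tri. eapply Rle_trans; [apply Cmod_triangle|].
  eapply Rle_trans; [apply Rplus_le_compat_r, Cmod_triangle|]. lra. }
assert (Q : eta / 2 ^ N / 2 ^ N = 20 * k * (l * l)).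
{ unfold k, l. field. split; [apply pow_nonzero; lra | lra]. }
rewrite Q in Ht.
assert (Pl0 : 0 < l) by (unfold l; apply Rdiv_lt_0_compat; [exact HL | apply pow_lt; lra]).
assert (Pk : 0 < k * (l * l)) by (apply Rmult_lt_0_compat; [exact Hk | nra]). lra.
Qed.

(** The primitive integrates [f] along the radius. By Goursat on the triangle [0, z, y] its
    increment is the integral from [z] to [y], and continuity of [f] suffices from there. *)
Lemma disk_primitive (rad : R) (f : C -> C) : 0 < rad -> holo rad f ->
  exists G : C -> C, G 0%C = 0%C /\ forall z, Cmod z < rad -> cder G z (f z).
Proof.
intros Hrad Hf. pose proof (holo_cont rad f Hf) as Cf.
assert (H0 : Cmod 0 < rad) by (rewrite Cmod_0; exact Hrad).
exists (fun z => seg f 0 z). split.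
{ unfold seg. ring. }
intros z Hz eps He. destruct (Cf z Hz eps He) as [d [Hd Hc]].
exists (Rmin d (rad - Cmod z)). split; [apply Rmin_glb_lt; lra|].
intros y Hy.
destruct (lt_Rmin _ _ _ Hy) as [Hy1 Hy2].
assert (Ry : Cmod y < rad) by (pose proof (Cmod_triangle_rev y z); lra).
pose proof (Goursat rad f 0 z y Hf H0 Hz Ry) as T. unfold tri in T.
rewrite (seg_rev rad f 0 y) in T by auto.
assert (E : (seg f 0 y - seg f 0 z - f z * (y - z))%C = seg (fun x => f x - f z)%C z y).
{ rewrite (seg_minus rad f (fun _ => f z)) by (auto; intros x _; apply cont_const).
  assert (K : seg (fun _ => f z) z y = (f z * (y - z))%C).
  { unfold seg. rewrite CInt_const. rewrite RtoC_minus. ring. }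
  rewrite K. 
  replace (seg f z y) with ((seg f 0 z + seg f z y + - seg f 0 y) - seg f 0 z
    + seg f 0 y)%C by ring.
  rewrite T. ring. }
rewrite E, Rmult_comm. apply (seg_Cmod_le rad); auto.
- intros x Hx. apply cont_minus; [auto | apply cont_const].
- intros t Ht. apply Rlt_le, Hc.
  replace (z + RtoC t * (y - z) - z)%C with (RtoC t * (y - z))%C by ring.
  rewrite Cmod_mult, Cmod_R, Rabs_pos_eq by lra.
  pose proof (Cmod_nonneg (y - z)%C). nra.
Qed.

(** * Cauchy's formula on circles *)

Lemma cont_rcomp {X : Type} (e : X -> C) (g : R -> C) (h : X -> R) (x : X) :
  rcont g (h x) -> cont_via e (fun y => RtoC (h y)) x -> cont_via e (fun y => g (h y)) x.
Proof.
intros Hg Hh eps He. destruct (Hg eps He) as [d [Hd H]].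
destruct (Hh d Hd) as [d' [Hd' H']]. exists d'. split; auto.
Qed.

Lemma Cmod_polar (r t : R) : 0 <= r -> Cmod (polar r t) = r.
Proof.
intros Hr. apply Rsqr_inj; [apply Cmod_ge_0 | exact Hr|]. unfold Rsqr. rewrite Cmod_sqr.
simpl. pose proof (sin2_cos2 t) as H. unfold Rsqr in H.
replace (r * cos t * (r * cos t) + r * sin t * (r * sin t))
  with (r * r * (sin t * sin t + cos t * cos t)) by ring.
rewrite H. ring.
Qed.

Lemma rder_polar (r t : R) : rder (polar r) t (Ci * polar r t)%C.
Proof.
apply rder_components. split; simpl; auto_derive; auto; ring.
Qed.

Lemma rcont_polar (r t : R) : rcont (polar r) t.
Proof. eapply der_cont, rder_polar. Qed.

Lemma polar_exists (z : C) : exists t, - PI <= t <= PI /\ z = polar (Cmod z) t.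
Proof.
destruct (Req_dec (Cmod z) 0) as [E|NE].
{ exists 0. pose proof PI_RGT_0. split; [lra|]. apply Cmod_eq_0 in E. rewrite E, Cmod_0.
  unfold polar. apply injective_projections; simpl; ring. }
pose proof (Cmod_nonneg z). set (m := Cmod z) in *.
assert (Hm : 0 < m) by lra.
pose proof (Cmod_sqr z) as S. fold m in S. destruct z as [x y]. cbn [fst snd] in S.
assert (Hx : -1 <= x / m <= 1).
{ assert (- m <= x <= m) by nra. split.
  - apply Rmult_le_reg_r with m; [exact Hm|]. field_simplify; lra.
  - apply Rmult_le_reg_r with m; [exact Hm|]. field_simplify; lra. }
pose proof (acos_bound (x / m)) as Hb. pose proof PI_RGT_0.
assert (Hs : sin (acos (x / m)) * m = Rabs y).
{ rewrite sin_acos by exact Hx. unfold Rsqr.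
  rewrite <- (sqrt_Rsqr_abs y). rewrite <- (sqrt_Rsqr m) at 3 by lra.
  rewrite <- sqrt_mult_alt.
  - f_equal. unfold Rsqr. field_simplify; [nra | lra].
  - assert (x / m * (x / m) <= 1) by nra. lra. }
destruct (Rle_dec 0 y) as [Hy|Hy].
- exists (acos (x / m)). split; [lra|]. unfold polar. rewrite cos_acos by exact Hx.
  rewrite Rabs_pos_eq in Hs by exact Hy.
  apply injective_projections; simpl; [field; lra | lra].
- exists (- acos (x / m)). split; [lra|]. unfold polar. rewrite cos_neg, sin_neg,
    cos_acos by exact Hx.
  rewrite Rabs_left in Hs by lra.
  apply injective_projections; simpl; [field; lra | lra].
Qed.

Lemma polar_periodic (r t : R) : polar r (t + 2 * PI) = polar r t.
Proof. unfold polar. rewrite cos_plus, sin_plus, cos_2PI, sin_2PI. apply injective_projections;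
  simpl; ring. Qed.

Lemma polar_PI_neg (r : R) : polar r (- PI) = polar r PI.
Proof. rewrite <- (polar_periodic r (- PI)). f_equal. ring. Qed.

(** This replaces the deformation of contours. In the applications [A (l, t)] is the angular
    derivative of a periodic function, so its mean vanishes; this is asked for [0 < l < 1] only,
    because the periodic function in [Cauchy_C1] is divided by [l]. *)
Lemma homotopy (H A : C -> C) :
  (forall l t, 0 <= l <= 1 -> - PI <= t <= PI -> rder (fun l => H (l, t)) l (A (l, t))) ->
  (forall l t, 0 <= l <= 1 -> - PI <= t <= PI -> ccont A (l, t)) ->
  contseg (fun t => H (0, t)) (- PI) PI -> contseg (fun t => H (1, t)) (- PI) PI ->
  (forall l, 0 < l < 1 -> CInt (fun t => A (l, t)) (- PI) PI = 0%C) ->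
  CInt (fun t => H (1, t)) (- PI) PI = CInt (fun t => H (0, t)) (- PI) PI.
Proof.
intros HA HC C0 C1 HI. pose proof PI_RGT_0 as HP.
assert (E : CInt (fun t => H (1, t) - H (0, t))%C (- PI) PI = 0%C).
{ transitivity (CInt (fun t => CInt (fun l => A (l, t)) 0 1) (- PI) PI).
  - apply CInt_ext. rewrite Rmin_left, Rmax_right by lra. intros t Ht. symmetry.
    apply (CInt_FTC (fun l => H (l, t))); rewrite ?Rmin01, ?Rmax01.
    + intros l Hl. apply HA; lra.
    + intros l Hl. rewrite Rmin01, Rmax01 in Hl.
      intros eps He. destruct (HC l t Hl ltac:(lra) eps He) as [d [Hd H']].
      exists d. split; [exact Hd|]. intros y Hy. apply H'.
      replace ((y, t) - (l, t))%C with (RtoC y - RtoC l)%C; [exact Hy|].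
      apply injective_projections; simpl; ring.
  - rewrite <- (CInt_swap A 0 1 (- PI) PI) by (auto; lra).
    rewrite (CInt_ext _ (fun _ => 0%C)).
    + rewrite CInt_const. ring.
    + rewrite Rmin01, Rmax01. exact HI. }
rewrite CInt_minus in E by assumption.
replace (CInt (fun t => H (1, t)) (- PI) PI) with
  (CInt (fun t => H (1, t)) (- PI) PI - CInt (fun t => H (0, t)) (- PI) PI
   + CInt (fun t => H (0, t)) (- PI) PI)%C by ring.
rewrite E. ring.
Qed.

Lemma sub_neq_0 (s z : C) : Cmod z < Cmod s -> (s - z)%C <> 0%C.
Proof.
intros H. apply Cmod_pos_neq. pose proof (Cmod_triangle_rev s z). lra.
Qed.

Lemma Cmod_scal_le (l : R) (z : C) : 0 <= l <= 1 -> Cmod (RtoC l * z) <= Cmod z.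
Proof.
intros Hl. rewrite Cmod_mult, Cmod_R, Rabs_pos_eq by lra. pose proof (Cmod_nonneg z). nra.
Qed.

Lemma ccont_fst (p : C) : ccont (fun p => RtoC (fst p)) p.
Proof. apply cont_Re, cont_embed. Qed.

Lemma ccont_snd (p : C) : ccont (fun p => RtoC (snd p)) p.
Proof. apply cont_Im, cont_embed. Qed.

Lemma ccont_polar_snd (r : R) (p : C) : ccont (fun p => polar r (snd p)) p.
Proof. apply cont_rcomp; [apply rcont_polar | apply ccont_snd]. Qed.

(** The pole is moved along the segment from [zeta] to the centre, where the integrand is [1]. *)
Lemma CInt_kernel (r : R) (zeta : C) : 0 < r -> Cmod zeta < r ->
  CInt (fun t => polar r t / (polar r t - zeta))%C (- PI) PI = RtoC (2 * PI).
Proof.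
intros Hr Hz. pose proof PI_RGT_0 as HP.
assert (NZ : forall l t, 0 <= l <= 1 -> (polar r t - RtoC l * zeta)%C <> 0%C).
{ intros l t Hl. apply sub_neq_0. rewrite Cmod_polar by lra.
  eapply Rle_lt_trans; [apply Cmod_scal_le, Hl | exact Hz]. }
pose (H := fun p : C => (polar r (snd p) / (polar r (snd p) - RtoC (fst p) * zeta))%C).
pose (A := fun p : C => (polar r (snd p) * zeta / ((polar r (snd p) - RtoC (fst p) * zeta)
                          * (polar r (snd p) - RtoC (fst p) * zeta)))%C).
assert (K : CInt (fun t => H (1, t)) (- PI) PI = CInt (fun t => H (0, t)) (- PI) PI).
{ apply (homotopy H A); unfold H, A; cbn [fst snd].
  - intros l t Hl Ht. eapply der_eq.
    2: { apply (der_div RtoC (fun _ => polar r t) (fun l => polar r t - RtoC l * zeta)%C l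
           0 (0 - (1 * zeta + RtoC l * 0))).
      + apply NZ, Hl.
      + apply der_const.
      + apply der_minus; [apply der_const|]. apply der_mult; [apply der_embed | apply der_const]. }
    cbv beta. field. apply NZ, Hl.
  - intros l t Hl Ht. apply cont_div.
    + cbn [fst snd]. apply Cmult_neq_0; apply NZ, Hl.
    + apply cont_mult; [apply ccont_polar_snd | apply cont_const].
    + apply cont_mult; apply cont_minus; try apply ccont_polar_snd;
        apply cont_mult; (apply ccont_fst || apply cont_const).
  - intros t _. apply cont_div; [apply NZ; lra | apply rcont_polar|].
    apply cont_minus; [apply rcont_polar | apply cont_const].
  - intros t _. apply cont_div; [apply NZ; lra | apply rcont_polar|].
    apply cont_minus; [apply rcont_polar | apply cont_const].
  - intros l Hl.
    (* Since [s = polar r t] satisfies [s' = i s], this is a periodic primitive of the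
       [l]-derivative [s zeta / (s - l zeta)^2]. *)
    rewrite (CInt_FTC (fun t => (Ci * zeta) * / (polar r t - RtoC l * zeta))%C).
    + rewrite polar_PI_neg. ring.
    + intros t _. eapply der_eq.
      2: { apply der_scal. apply (der_inv RtoC (fun t => polar r t - RtoC l * zeta)%C t (Ci
        * polar r t - 0)).
           - apply NZ; lra.
           - apply der_minus; [apply rder_polar | apply der_const]. }
      cbv beta.
      replace (Ci * zeta * (- (Ci * polar r t - 0) /
         ((polar r t - RtoC l * zeta) * (polar r t - RtoC l * zeta))))%C
       with (- (Ci * Ci) * (polar r t * zeta /
         ((polar r t - RtoC l * zeta) * (polar r t - RtoC l * zeta))))%C
        by (field; apply NZ; lra).
      replace (- (Ci * Ci))%C with (RtoC 1); [ring|].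
      unfold Ci. apply injective_projections; simpl; ring.
    + intros t _. apply cont_div.
      * apply Cmult_neq_0; apply NZ; lra.
      * apply cont_mult; [apply rcont_polar | apply cont_const].
      * apply cont_mult; apply cont_minus; (apply rcont_polar || apply cont_const). }
unfold H in K. cbn [fst snd] in K.
rewrite (CInt_ext _ (fun t => polar r t / (polar r t - RtoC 1 * zeta))%C).
2: { intros t _. f_equal. f_equal. ring. }
rewrite K. rewrite (CInt_ext _ (fun _ => 1%C)).
2: { intros t _. field. intros E. apply (NZ 0 t ltac:(lra)). rewrite E. ring. }
rewrite CInt_const, Cmult_1_r. f_equal. ring.
Qed.

Lemma Ci_neq_0 : Ci <> 0%C.
Proof. intros E. apply (f_equal snd) in E. simpl in E. lra. Qed.

Lemma RtoC_neq_0 (x : R) : x <> 0 -> RtoC x <> 0%C.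
Proof. intros H E. apply H, RtoC_inj, E. Qed.

(** The argument of [G] is contracted to [zeta + l (s - zeta)] while the kernel is kept. The
    [l]-derivative cancels the denominator and leaves [g s], which is the angular derivative of
    [G / (i l)] at the contracted point. At [l = 0] only the kernel is left to integrate. *)
Lemma Cauchy_C1 (rad r : R) (G g : C -> C) (zeta : C) :
  (forall z, Cmod z < rad -> cder G z (g z)) -> cont_disk rad g -> 0 < r < rad -> Cmod zeta < r ->
  CInt (fun t => G (polar r t) * (polar r t / (polar r t - zeta)))%C (- PI) PI
  = (RtoC (2 * PI) * G zeta)%C.
Proof.
intros HG Cg Hr Hz. pose proof PI_RGT_0 as HP.
assert (NZ : forall t, (polar r t - zeta)%C <> 0%C).
{ intros t. apply sub_neq_0. rewrite Cmod_polar by lra. exact Hz. }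
assert (In : forall l t, 0 <= l <= 1 -> Cmod (zeta + RtoC l * (polar r t - zeta)) < rad).
{ intros l t Hl. apply Cmod_segment_lt; [exact Hl | lra | rewrite Cmod_polar; lra]. }
assert (CG : cont_disk rad G) by (intros z Hz'; eapply der_cont, HG, Hz').
pose (H := fun p : C => (G (zeta + RtoC (fst p) * (polar r (snd p) - zeta))
                         * (polar r (snd p) / (polar r (snd p) - zeta)))%C).
pose (A := fun p : C => (g (zeta + RtoC (fst p) * (polar r (snd p) - zeta)) * polar r (snd p))%C).
assert (K : CInt (fun t => H (1, t)) (- PI) PI = CInt (fun t => H (0, t)) (- PI) PI).
{ assert (CH : forall l, 0 <= l <= 1 -> contseg (fun t => H (l, t)) (- PI) PI).
  { intros l Hl t _. unfold H. cbn [fst snd]. apply cont_mult.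
    - apply (cont_comp RtoC G); [apply CG, In, Hl|].
      apply cont_plus; [apply cont_const|]. apply cont_mult; [apply cont_const|].
      apply cont_minus; [apply rcont_polar | apply cont_const].
    - apply cont_div; [apply NZ | apply rcont_polar|].
      apply cont_minus; [apply rcont_polar | apply cont_const]. }
  apply (homotopy H A); [| |apply CH; lra|apply CH; lra|]; unfold H, A; cbn [fst snd].
  - intros l t Hl Ht. eapply der_eq.
    2: { apply (der_mult RtoC (fun l => G (zeta + RtoC l * (polar r t - zeta))%C)
           (fun _ => polar r t / (polar r t - zeta))%C l
           (g (zeta + RtoC l * (polar r t - zeta))%C * (polar r t - zeta)) 0).
      + apply (der_comp RtoC G (fun l => zeta + RtoC l * (polar r t - zeta))%C); [apply HG, In,
          Hl | apply rder_affine].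
      + apply der_const. }
    cbv beta. field. apply NZ.
  - intros l t Hl Ht. apply cont_mult; [|apply ccont_polar_snd].
    apply (cont_comp (fun z => z) g).
    + cbn [fst snd]. apply Cg, In, Hl.
    + apply cont_plus; [apply cont_const|]. apply cont_mult; [apply ccont_fst|].
      apply cont_minus; [apply ccont_polar_snd | apply cont_const].
  - intros l Hl. assert (Nl : RtoC l <> 0%C) by (apply RtoC_neq_0; lra).
    rewrite (CInt_FTC (fun t => / (Ci * RtoC l) * G (zeta + RtoC l * (polar r t - zeta)))%C).
    + rewrite polar_PI_neg. ring.
    + intros t _. eapply der_eq.
      2: { apply der_scal.
           apply (der_comp RtoC G (fun t => zeta + RtoC l * (polar r t - zeta))%C t
             (g (zeta + RtoC l * (polar r t - zeta))%C) (0 + RtoC l * (Ci * polar r t - 0))).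
           - apply HG, In; lra.
           - apply der_plus; [apply der_const|].
             apply (der_scal RtoC (RtoC l) (fun t => polar r t - zeta)%C).
             apply der_minus; [apply rder_polar | apply der_const]. }
      cbv beta. field. split; [exact Nl | apply Ci_neq_0].
    + intros t _. apply cont_mult; [|apply rcont_polar].
      apply (cont_comp RtoC g); [apply Cg, In; lra|].
      apply cont_plus; [apply cont_const|]. apply cont_mult; [apply cont_const|].
      apply cont_minus; [apply rcont_polar | apply cont_const]. }
unfold H in K. cbn [fst snd] in K.
rewrite (CInt_ext _ (fun t => G (zeta + RtoC 1 * (polar r t - zeta))
                              * (polar r t / (polar r t - zeta)))%C).
2: { intros t _. f_equal. f_equal. ring. }
rewrite K. rewrite (CInt_ext _ (fun t => G zeta * (polar r t / (polar r t - zeta)))%C).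
2: { intros t _. f_equal. f_equal. ring. }
rewrite CInt_scal.
2: { intros t _; apply cont_div; [apply NZ | apply rcont_polar|].
     apply cont_minus; [apply rcont_polar | apply cont_const]. }
rewrite CInt_kernel by lra. ring.
Qed.

Lemma cder_unique (f : C -> C) (z d d' : C) : cder f z d -> cder f z d' -> d = d'.
Proof.
intros H H'. apply cder_is_derive in H. apply cder_is_derive in H'.
rewrite <- (is_C_derive_unique _ _ _ H). apply is_C_derive_unique, H'.
Qed.

Lemma cder_C_derive (f : C -> C) (z d : C) : cder f z d -> C_derive f z = d.
Proof. intros H. apply is_C_derive_unique, cder_is_derive, H. Qed.

Lemma holo_C_derive (rad : R) (f : C -> C) (z : C) :
  holo rad f -> Cmod z < rad -> cder f z (C_derive f z).
Proof. intros H Hz. destruct (H z Hz) as [d Hd]. rewrite (cder_C_derive _ _ _ Hd). exact Hd. Qed.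

Lemma cder_of_quadratic (f : C -> C) (z d : C) (M eta : R) : 0 < eta ->
  (forall y, Cmod (y - z) < eta ->
     Cmod (f y - f z - d * (y - z)) <= M * (Cmod (y - z) * Cmod (y - z))) ->
  cder f z d.
Proof.
intros He H eps Heps. set (M' := Rmax M 1).
assert (HM : 0 < M') by (eapply Rlt_le_trans; [apply Rlt_0_1 | apply Rmax_r]).
assert (HM' : M <= M') by apply Rmax_l.
exists (Rmin eta (eps / M')). split; [apply Rmin_glb_lt; [exact He | apply Rdiv_lt_0_compat; lra]|].
intros y Hy.
destruct (lt_Rmin _ _ _ Hy) as [Hy1 Hy2].
eapply Rle_trans; [apply H, Hy1|]. pose proof (Cmod_nonneg (y - z)%C). set (h := Cmod (y - z)) in *.
apply (Rmult_lt_compat_l M') in Hy2; [|exact HM].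
replace (M' * (eps / M')) with eps in Hy2 by (field; lra). nra.
Qed.

Lemma contseg_bounded (g : R -> C) (a b : R) : a <= b -> contseg g a b ->
  exists M, 0 < M /\ forall t, a <= t <= b -> Cmod (g t) <= M.
Proof.
intros Hab Hg.
destruct (continuity_ab_maj (fun t => Cmod (g t)) a b Hab) as [m [Hm _]].
{ intros t Ht. apply continuity_pt_filterlim. refine (proj1 (rcont_continuous (fun t => Cmod (g t))
    t) _). apply cont_Cmod, Hg.
  rewrite Rmin_left, Rmax_right by exact Hab. exact Ht. }
exists (Rmax 1 (Cmod (g m))). split; [eapply Rlt_le_trans; [apply Rlt_0_1 | apply Rmax_l]|].
intros t Ht. eapply Rle_trans; [apply Hm, Ht | apply Rmax_r].
Qed.

(** A quadratic remainder with a constant independent of [t] survives integration, which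
    differentiability at each single [t] would not. *)
Lemma CInt_param_der (K : C -> R -> C) (D : R -> C) (z : C) (a b M eta : R) : a <= b -> 0 < eta ->
  (forall y, Cmod (y - z) < eta -> contseg (K y) a b) -> contseg D a b ->
  (forall y t, Cmod (y - z) < eta -> a <= t <= b ->
     Cmod (K y t - K z t - D t * (y - z)) <= M * (Cmod (y - z) * Cmod (y - z))) ->
  cder (fun y => CInt (K y) a b) z (CInt D a b).
Proof.
intros Hab He HK HD HM. apply cder_of_quadratic with (M := M * (b - a)) (eta := eta); [exact He|].
intros y Hy.
assert (Hz : contseg (K z) a b).
{ apply HK. replace (z - z)%C with (RtoC 0) by ring. rewrite Cmod_0. exact He. }
assert (E : (CInt (K y) a b - CInt (K z) a b - CInt D a b * (y - z))%C =
            CInt (fun t => K y t - K z t - D t * (y - z))%C a b).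
{ rewrite (CInt_ext (fun t => K y t - K z t - D t * (y - z))%C
              (fun t => (K y t - K z t) - (y - z) * D t)%C) by (intros t _; ring).
  rewrite CInt_minus, CInt_minus, CInt_scal; auto; [ring| |apply contseg_scal, HD].
  intros t Ht. apply cont_minus; auto. apply HK; auto. }
rewrite E. replace (M * (b - a) * (Cmod (y - z) * Cmod (y - z)))
  with (M * (Cmod (y - z) * Cmod (y - z)) * (b - a)) by ring.
apply CInt_Cmod_le; [exact Hab| |intros t Ht; apply HM; auto].
intros t Ht. apply cont_minus; [apply cont_minus; auto; apply HK; auto|].
apply cont_mult; [auto | apply cont_const].
Qed.

Lemma contseg_Cauchy_kernel (c : R -> C) (r : R) (z : C) : contseg c (- PI) PI -> Cmod z < r ->
  contseg (fun t => c t / (polar r t - z))%C (- PI) PI.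
Proof.
intros Hc Hz t Ht. pose proof (Cmod_nonneg z). apply cont_div.
- apply sub_neq_0. rewrite Cmod_polar; lra.
- apply Hc, Ht.
- apply cont_minus; [apply rcont_polar | apply cont_const].
Qed.

Lemma kernel_lower (r : R) (z : C) (t rho : R) : Cmod z <= rho -> rho < r ->
  r - rho <= Cmod (polar r t - z).
Proof.
intros Hz Hr. pose proof (Cmod_nonneg z). pose proof (Cmod_triangle_rev (polar r t) z) as T.
rewrite Cmod_polar in T by lra. lra.
Qed.

Lemma Cauchy_kernel_quadratic (c s y z : C) (M m : R) : 0 < m -> Cmod c <= M ->
  m <= Cmod (s - y) -> m <= Cmod (s - z) ->
  Cmod (c / (s - y) - c / (s - z) - c / ((s - z) * (s - z)) * (y - z))
   <= M / (m * m * m) * (Cmod (y - z) * Cmod (y - z)).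
Proof.
intros Hm Hc Hy Hz.
assert (Ny : (s - y)%C <> 0%C) by (apply Cmod_pos_neq; lra).
assert (Nz : (s - z)%C <> 0%C) by (apply Cmod_pos_neq; lra).
replace (c / (s - y) - c / (s - z) - c / ((s - z) * (s - z)) * (y - z))%C
  with (c * ((y - z) * (y - z)) / ((s - y) * (s - z) * (s - z)))%C by (field; auto).
rewrite Cmod_div by (repeat apply Cmult_neq_0; auto). rewrite !Cmod_mult.
pose proof (Cmod_nonneg (y - z)%C). pose proof (Cmod_nonneg c).
set (h := Cmod (y - z)) in *. set (p := Cmod (s - y)) in *. set (q := Cmod (s - z)) in *.
replace (M / (m * m * m) * (h * h)) with (M * (h * h) / (m * m * m)) by (field; lra).
assert (0 < m * m * m) by (repeat apply Rmult_lt_0_compat; lra).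
assert (m * m * m <= p * q * q) by (repeat apply Rmult_le_compat; nra).
apply Rmult_le_compat; [nra | apply Rlt_le, Rinv_0_lt_compat; lra | nra
  | apply Rinv_le_contravar; lra].
Qed.

Lemma Cauchy_integral_der (c : R -> C) (r : R) (z : C) : contseg c (- PI) PI -> Cmod z < r ->
  cder (fun y => CInt (fun t => c t / (polar r t - y))%C (- PI) PI) z
    (CInt (fun t => c t / ((polar r t - z) * (polar r t - z)))%C (- PI) PI).
Proof.
intros Hc Hz. pose proof PI_RGT_0. pose proof (Cmod_nonneg z).
destruct (contseg_bounded c (- PI) PI ltac:(lra) Hc) as [M [HM HcM]].
set (m := (r - Cmod z) / 2). assert (Hm : 0 < m) by (unfold m; lra).
assert (Near : forall y, Cmod (y - z) < m -> Cmod y <= r - m /\ r - m < r).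
{ intros y Hy. pose proof (Cmod_triangle_rev y z). unfold m in *. lra. }
assert (NZ : forall y t, Cmod (y - z) < m -> m <= Cmod (polar r t - y)).
{ intros y t Hy. destruct (Near y Hy) as [A B]. pose proof (kernel_lower r y t _ A B). lra. }
assert (Zz : Cmod (z - z) < m).
{ replace (z - z)%C with (RtoC 0) by ring. rewrite Cmod_0. exact Hm. }
apply CInt_param_der with (M := M / (m * m * m)) (eta := m); [lra | exact Hm | | |].
- intros y Hy. apply contseg_Cauchy_kernel; [exact Hc|]. destruct (Near y Hy); lra.
- intros t Ht. apply cont_div; [|apply Hc, Ht|].
  + apply Cmult_neq_0; apply Cmod_pos_neq; specialize (NZ z t Zz); lra.
  + apply cont_mult; apply cont_minus; (apply rcont_polar || apply cont_const).
- intros y t Hy Ht. apply Cauchy_kernel_quadratic; auto.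
Qed.

(** [f] is only continuous here, so [Cauchy_C1] is applied to its primitive [G]. Differentiating
    that formula in [zeta] produces the kernel [s / (s - zeta)^2], and an integration by parts along
    the circle moves the derivative onto [G]. *)
Lemma Cauchy_C1_derivative (rad r : R) (G f : C -> C) (zeta : C) :
  (forall z, Cmod z < rad -> cder G z (f z)) -> cont_disk rad f -> 0 < r < rad -> Cmod zeta < r ->
  CInt (fun t => f (polar r t) * (polar r t / (polar r t - zeta)))%C (- PI) PI
  = (RtoC (2 * PI) * f zeta)%C.
Proof.
intros HG Cf Hr Hz. pose proof PI_RGT_0 as HP.
assert (In : forall t, Cmod (polar r t) < rad) by (intros t; rewrite Cmod_polar; lra).
assert (NZ : forall t, (polar r t - zeta)%C <> 0%C).
{ intros t. apply sub_neq_0. rewrite Cmod_polar by lra. exact Hz. }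
assert (Cp : forall t, rcont (fun t => polar r t - zeta)%C t).
{ intros t. apply cont_minus; [apply rcont_polar | apply cont_const]. }
assert (CG : forall t, rcont (fun t => G (polar r t)) t).
{ intros t. apply (cont_comp RtoC G); [eapply der_cont, HG, In | apply rcont_polar]. }
assert (CF : forall t, rcont (fun t => f (polar r t)) t).
{ intros t. apply (cont_comp RtoC f); [apply Cf, In | apply rcont_polar]. }
pose (c := fun t => (G (polar r t) * polar r t)%C).
assert (Cc : contseg c (- PI) PI) by (intros t _; apply cont_mult; [apply CG | apply rcont_polar]).
pose proof (Cauchy_integral_der c r zeta Cc Hz) as D.
assert (D' : cder (fun y => CInt (fun t => c t / (polar r t - y))%C (- PI) PI) zeta
               (RtoC (2 * PI) * f zeta)%C).
{ apply der_local with (f := fun y => (RtoC (2 * PI) * G y)%C) (eta := r - Cmod zeta); [lra| |].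
  - intros y Hy. pose proof (Cmod_triangle_rev y zeta).
    rewrite <- (Cauchy_C1 rad r G f y HG Cf Hr ltac:(lra)).
    apply CInt_ext. intros t _. unfold c, Cdiv. ring.
  - apply der_scal, HG. lra. }
rewrite <- (cder_unique _ _ _ _ D D').
assert (E : CInt (fun t => Ci * (f (polar r t) * (polar r t / (polar r t - zeta))
   - c t / ((polar r t - zeta) * (polar r t - zeta))))%C (- PI) PI = 0%C).
{ rewrite (CInt_FTC (fun t => G (polar r t) / (polar r t - zeta))%C).
  - rewrite polar_PI_neg. ring.
  - intros t _. eapply der_eq.
    2: { apply (der_div RtoC (fun t => G (polar r t)) (fun t => polar r t - zeta)%C t
           (f (polar r t) * (Ci * polar r t)) (Ci * polar r t - 0)).
      + apply NZ.
      + apply (der_comp RtoC G); [apply HG, In | apply rder_polar].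
      + apply der_minus; [apply rder_polar | apply der_const]. }
    cbv beta. unfold c. field. apply NZ.
  - intros t _. apply cont_mult; [apply cont_const|]. apply cont_minus.
    + apply cont_mult; [apply CF|]. apply cont_div; [apply NZ | apply rcont_polar | apply Cp].
    + apply cont_div; [apply Cmult_neq_0; apply NZ | | apply cont_mult; apply Cp].
      apply cont_mult; [apply CG | apply rcont_polar]. }
assert (S1 : contseg (fun t => f (polar r t) * (polar r t / (polar r t - zeta)))%C (- PI) PI).
{ intros t _. apply cont_mult; [apply CF|]. apply cont_div; [apply NZ | apply rcont_polar
    | apply Cp]. }
assert (S2 : contseg (fun t => c t / ((polar r t - zeta) * (polar r t - zeta)))%C (- PI) PI).
{ intros t Ht. apply cont_div; [apply Cmult_neq_0; apply NZ | apply Cc, Ht | apply cont_mult;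
    apply Cp]. }
rewrite CInt_scal, CInt_minus in E; auto.
2: { intros t Ht. apply cont_minus; auto. }
set (I1 := CInt (fun t => f (polar r t) * (polar r t / (polar r t - zeta)))%C (- PI) PI) in *.
set (I2 := CInt (fun t => c t / ((polar r t - zeta) * (polar r t - zeta)))%C (- PI) PI) in *.
replace I1 with (/ Ci * (Ci * (I1 - I2)) + I2)%C by (field; apply Ci_neq_0).
rewrite E. ring.
Qed.

(** Goursat's theorem enters only through the primitive that it provides. *)
Theorem Cauchy (rad r : R) (f : C -> C) (zeta : C) :
  holo rad f -> 0 < r < rad -> Cmod zeta < r ->
  CInt (fun t => f (polar r t) * (polar r t / (polar r t - zeta)))%C (- PI) PI
  = (RtoC (2 * PI) * f zeta)%C.
Proof.
intros Hf Hr Hz. destruct (disk_primitive rad f ltac:(lra) Hf) as [G [_ HG]].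
apply (Cauchy_C1_derivative rad r G); auto. apply holo_cont, Hf.
Qed.

Lemma Cauchy_der (rad r : R) (f : C -> C) (zeta : C) :
  holo rad f -> 0 < r < rad -> Cmod zeta < r ->
  (RtoC (2 * PI) * C_derive f zeta)%C =
  CInt (fun t => f (polar r t) * polar r t / ((polar r t - zeta) * (polar r t - zeta)))%C (- PI) PI.
Proof.
intros Hf Hr Hz.
apply (cder_unique (fun y => RtoC (2 * PI) * f y)%C zeta).
- apply der_scal. apply (holo_C_derive rad); [exact Hf | lra].
- apply der_local with (eta := r - Cmod zeta)
    (f := fun y => CInt (fun t => f (polar r t) * polar r t / (polar r t - y))%C (- PI) PI);
      [lra| |].
  + intros y Hy. pose proof (Cmod_triangle_rev y zeta).
    rewrite <- (Cauchy rad r f y Hf Hr ltac:(lra)).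
    apply CInt_ext. intros t _. unfold Cdiv. ring.
  + apply (Cauchy_integral_der (fun t => f (polar r t) * polar r t)%C r zeta); [|exact Hz].
    intros t _. apply cont_mult; [|apply rcont_polar].
    apply (cont_comp RtoC f); [apply (holo_cont rad); [exact Hf | rewrite Cmod_polar; lra]
      | apply rcont_polar].
Qed.

Lemma RtoC_2PI_neq_0 : RtoC (2 * PI) <> 0%C.
Proof. apply RtoC_neq_0. pose proof PI_RGT_0. lra. Qed.

(** Uniformity on the closed disk comes from writing [f] as a Cauchy integral over a circle of
    radius between [rho] and [rad], from which all points considered keep a fixed distance. *)
Lemma Taylor_quadratic (rad rho : R) (f : C -> C) : holo rad f -> 0 < rho < rad ->
  exists M, forall y z, Cmod y <= rho -> Cmod z <= rho ->
    Cmod (f y - f z - C_derive f z * (y - z)) <= M * (Cmod (y - z) * Cmod (y - z)).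
Proof.
intros Hf Hrho. pose proof PI_RGT_0 as HP.
set (r := (rho + rad) / 2). assert (Hr : 0 < r < rad) by (unfold r; lra).
pose (c := fun t => (f (polar r t) * polar r t)%C).
assert (Cc : contseg c (- PI) PI).
{ intros t _. apply cont_mult; [|apply rcont_polar].
  apply (cont_comp RtoC f); [apply (holo_cont rad); [exact Hf | rewrite Cmod_polar; lra]
    | apply rcont_polar]. }
destruct (contseg_bounded c (- PI) PI ltac:(lra) Cc) as [M [HM HcM]].
set (m := r - rho). assert (Hm : 0 < m) by (unfold m, r; lra).
exists (M / (m * m * m)). intros y z Hy Hz.
assert (Ny : forall t, m <= Cmod (polar r t - y)) by (intros t; apply kernel_lower; [exact Hy
  | unfold r; lra]).
assert (Nz : forall t, m <= Cmod (polar r t - z)) by (intros t; apply kernel_lower; [exact Hz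
  | unfold r; lra]).
assert (NZ : forall t, (polar r t - z)%C <> 0%C) by (intros t; apply Cmod_pos_neq;
  specialize (Nz t); lra).
assert (S1 : forall x, Cmod x <= rho -> contseg (fun t => c t / (polar r t - x))%C (- PI) PI).
{ intros x Hx. apply contseg_Cauchy_kernel; [exact Cc | unfold r; lra]. }
assert (S2 : contseg (fun t => c t / ((polar r t - z) * (polar r t - z)))%C (- PI) PI).
{ intros t Ht. apply cont_div; [apply Cmult_neq_0; apply NZ | apply Cc, Ht|].
  apply cont_mult; apply cont_minus; (apply rcont_polar || apply cont_const). }
assert (V : forall x, Cmod x <= rho ->
  (RtoC (2 * PI) * f x)%C = CInt (fun t => c t / (polar r t - x))%C (- PI) PI).
{ intros x Hx. rewrite <- (Cauchy rad r f x Hf Hr ltac:(unfold r; lra)).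
  apply CInt_ext. intros t _. unfold c, Cdiv. ring. }
assert (E : (RtoC (2 * PI) * (f y - f z - C_derive f z * (y - z)))%C =
  CInt (fun t => c t / (polar r t - y) - c t / (polar r t - z)
     - c t / ((polar r t - z) * (polar r t - z)) * (y - z))%C (- PI) PI).
{ rewrite (CInt_ext (fun t => c t / (polar r t - y) - c t / (polar r t - z)
     - c t / ((polar r t - z) * (polar r t - z)) * (y - z))%C
    (fun t => (c t / (polar r t - y) - c t / (polar r t - z))
     - (y - z) * (c t / ((polar r t - z) * (polar r t - z))))%C) by (intros t _; unfold Cdiv; ring).
  rewrite CInt_minus, CInt_minus, CInt_scal; auto using contseg_scal.
  - rewrite <- !V by assumption.
    unfold c. rewrite <- (Cauchy_der rad r f z Hf Hr ltac:(unfold r; lra)). ring.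
  - intros t Ht. apply cont_minus; apply S1; auto. }
assert (B : Cmod (RtoC (2 * PI) * (f y - f z - C_derive f z * (y - z)))
  <= M / (m * m * m) * (Cmod (y - z) * Cmod (y - z)) * (PI - - PI)).
{ rewrite E. apply CInt_Cmod_le; [lra| |].
  - intros t Ht. apply cont_minus; [apply cont_minus; apply S1; auto|].
    apply cont_mult; [apply S2, Ht | apply cont_const].
  - intros t Ht. apply Cauchy_kernel_quadratic; auto. }
rewrite Cmod_mult, Cmod_R, Rabs_pos_eq in B by lra.
apply Rmult_le_reg_r with (PI - - PI); [lra|]. lra.
Qed.

(** The sum of the Taylor remainders from [z] to [y] and from [y] to [z] is [(f' y - f' z) (y - z)],
    so [f'] is locally Lipschitz. *)
Lemma holo_derive_cont (rad : R) (f : C -> C) : holo rad f -> cont_disk rad (C_derive f).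
Proof.
intros Hf z Hz eps He. pose proof (Cmod_nonneg z). set (rho := (Cmod z + rad) / 2).
destruct (Taylor_quadratic rad rho f Hf ltac:(unfold rho; lra)) as [M HM].
set (M' := Rmax 0 M). assert (HM0 : 0 <= M') by apply Rmax_l. assert (HMM : M
  <= M') by apply Rmax_r.
exists (Rmin (rho - Cmod z) (eps / (2 * M' + 1))).
split; [apply Rmin_glb_lt; [unfold rho; lra | apply Rdiv_lt_0_compat; lra]|].
intros y Hy. destruct (lt_Rmin _ _ _ Hy) as [Hy1 Hy2]. pose proof (Cmod_triangle_rev y z).
destruct (Req_dec (Cmod (y - z)) 0) as [E|NE].
{ apply Cmod_eq_0 in E. replace y with z by (replace y with ((y - z) + z)%C by ring; rewrite E;
    ring).
  replace (C_derive f z - C_derive f z)%C with (RtoC 0) by ring. rewrite Cmod_0. exact He. }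
pose proof (HM y z ltac:(lra) ltac:(unfold rho in *; lra)) as A.
pose proof (HM z y ltac:(unfold rho in *; lra) ltac:(lra)) as B.
rewrite (Cmod_minus_sym z y) in B. pose proof (Cmod_nonneg (y - z)).
set (h := Cmod (y - z)) in *.
assert (K : Cmod (C_derive f y - C_derive f z) * h <= 2 * M' * h * h).
{ unfold h at 1. rewrite <- Cmod_mult.
  replace ((C_derive f y - C_derive f z) * (y - z))%C
    with ((f y - f z - C_derive f z * (y - z)) + (f z - f y - C_derive f y * (z - y)))%C by ring.
  eapply Rle_trans; [apply Cmod_triangle|]. assert (0 <= h * h) by nra. nra. }
apply Rmult_le_reg_r in K; [|lra].
apply (Rmult_lt_compat_r (2 * M' + 1)) in Hy2; [|lra].
replace (eps / (2 * M' + 1) * (2 * M' + 1)) with eps in Hy2 by (field; lra). lra.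
Qed.

(** The derivative is continuous and has [f] as a primitive, so [Cauchy_C1_derivative] represents it
    as a Cauchy integral, which is differentiable. *)
Theorem holo_derive (rad : R) (f : C -> C) : holo rad f -> holo rad (C_derive f).
Proof.
intros Hf z Hz. pose proof (Cmod_nonneg z). pose proof (holo_derive_cont rad f Hf) as Cf.
set (r := (Cmod z + rad) / 2).
assert (Hr : 0 < r < rad) by (unfold r; lra). assert (Hzr : Cmod z < r) by (unfold r; lra).
eexists.
apply der_local with (eta := r - Cmod z) (f := fun y => (/ RtoC (2 * PI) *
  CInt (fun t => C_derive f (polar r t) * polar r t / (polar r t - y)) (- PI) PI)%C); [lra| |].
- intros y Hy. pose proof (Cmod_triangle_rev y z).
  rewrite (CInt_ext _ (fun t => C_derive f (polar r t) * (polar r t / (polar r t - y)))%C)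
    by (intros t _; unfold Cdiv; ring).
  rewrite (Cauchy_C1_derivative rad r f (C_derive f) y); [field;
    apply RtoC_2PI_neq_0| |exact Cf|exact Hr|lra].
  intros x Hx. apply (holo_C_derive rad); assumption.
- apply der_scal, (Cauchy_integral_der (fun t => C_derive f (polar r t) * polar r t)%C r z);
    [|exact Hzr].
  intros t _. apply cont_mult; [|apply rcont_polar].
  apply (cont_comp RtoC (C_derive f)); [apply Cf; rewrite Cmod_polar; lra | apply rcont_polar].
Qed.

(** * Poisson formula, Schwarz and Jack lemmas *)

Lemma mean_value (rad r : R) (f : C -> C) : holo rad f -> 0 < r < rad ->
  CInt (fun t => f (polar r t)) (- PI) PI = (RtoC (2 * PI) * f 0)%C.
Proof.
intros Hf Hr. rewrite <- (Cauchy rad r f 0 Hf Hr) by (rewrite Cmod_0; lra).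
apply CInt_ext. intros t _. field. intros E. 
apply (f_equal Cmod) in E. rewrite Cmod_polar, Cmod_0 in E; lra.
Qed.

Lemma mean_value_Re (rad r : R) (f : C -> C) : holo rad f -> 0 < r < rad ->
  RInt (fun t => fst (f (polar r t))) (- PI) PI = 2 * PI * fst (f 0%C).
Proof.
intros Hf Hr. pose proof (mean_value rad r f Hf Hr) as E. apply (f_equal fst) in E.
cbn [fst CInt] in E. unfold CInt in E. cbn [fst] in E. rewrite E. simpl. ring.
Qed.

Definition poisson (r : R) (zeta : C) (t : R) : R :=
  (r * r - Cmod zeta * Cmod zeta)
  / (Cmod (polar r t - zeta) * Cmod (polar r t - zeta)).

Lemma Cconj_mult_Cmod (z : C) : (z * Cconj z)%C = RtoC (Cmod z * Cmod z).
Proof. rewrite Cmod_sqr. unfold Cconj. apply injective_projections; simpl; ring. Qed.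

Lemma Cconj_minus (z w : C) : Cconj (z - w) = (Cconj z - Cconj w)%C.
Proof. unfold Cconj. apply injective_projections; simpl; ring. Qed.

Lemma Cconj_neq_0 (z : C) : z <> 0%C -> Cconj z <> 0%C.
Proof.
intros H E. apply H. apply (f_equal Cconj) in E. unfold Cconj in E. destruct z as [x y].
simpl in E. apply injective_projections; simpl.
- apply (f_equal fst) in E. simpl in E. exact E.
- apply (f_equal snd) in E. simpl in E. lra.
Qed.

Lemma Cmod_Cconj (z : C) : Cmod (Cconj z) = Cmod z.
Proof. unfold Cmod, Cconj. simpl. f_equal. ring. Qed.

Lemma poisson_pos (r : R) (zeta : C) (t : R) : Cmod zeta < r -> 0 < poisson r zeta t.
Proof.
intros H. pose proof (Cmod_nonneg zeta).
assert (0 < Cmod (polar r t - zeta)).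
{ pose proof (kernel_lower r zeta t (Cmod zeta) ltac:(lra) H). lra. }
apply Rdiv_lt_0_compat; nra.
Qed.

(** On the circle [conj s = r^2 / s]. The first summand is the Cauchy kernel; the second is
    holomorphic in [s] on a larger disk and vanishes at [0], so its product with a holomorphic
    function has mean zero. *)
Lemma poisson_split (r : R) (zeta : C) (t : R) : 0 < r -> Cmod zeta < r ->
  RtoC (poisson r zeta t) = (polar r t / (polar r t - zeta)
    + Cconj zeta * polar r t / (RtoC (r * r) - Cconj zeta * polar r t))%C.
Proof.
intros Hr Hz. set (s := polar r t).
assert (Hs : Cmod s = r) by (apply Cmod_polar; lra).
assert (N1 : (s - zeta)%C <> 0%C) by (apply sub_neq_0; lra).
assert (N2 : (Cconj s - Cconj zeta)%C <> 0%C) by (rewrite <- Cconj_minus; apply Cconj_neq_0, N1).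
assert (N3 : s <> 0%C) by (apply Cmod_pos_neq; lra).
assert (P : 0 < Cmod (s - zeta)) by (apply Cmod_pos, N1).
unfold poisson. fold s. rewrite <- Hs at 1 2.
rewrite RtoC_div by nra. rewrite RtoC_minus.
rewrite <- Hs at 1 2.
rewrite <- !Cconj_mult_Cmod, Cconj_minus. field. repeat split; auto.
replace (s * Cconj s - Cconj zeta * s)%C with (s * (Cconj s - Cconj zeta))%C by ring.
apply Cmult_neq_0; assumption.
Qed.

(** In this form the kernel is visibly continuous, and harmonic in [zeta]. *)
Lemma poisson_Re (r : R) (zeta : C) (t : R) : 0 < r -> Cmod zeta < r ->
  poisson r zeta t = fst ((polar r t + zeta) / (polar r t - zeta))%C.
Proof.
intros Hr Hz. set (s := polar r t).
assert (Hs : Cmod s = r) by (apply Cmod_polar; lra).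
assert (N1 : (s - zeta)%C <> 0%C) by (apply sub_neq_0; lra).
assert (N2 : (Cconj s - Cconj zeta)%C <> 0%C) by (rewrite <- Cconj_minus; apply Cconj_neq_0, N1).
assert (P : 0 < Cmod (s - zeta)) by (apply Cmod_pos, N1).
assert (E : ((s + zeta) / (s - zeta))%C =
  (((s * Cconj s - zeta * Cconj zeta) + (zeta * Cconj s - s * Cconj zeta))
   * / ((s - zeta) * Cconj (s - zeta)))%C).
{ rewrite Cconj_minus. field. auto. }
rewrite E, !Cconj_mult_Cmod, <- RtoC_inv by nra. unfold poisson. fold s. rewrite Hs.
unfold Cconj. simpl. field. lra.
Qed.

Lemma poisson_continuous (r : R) (zeta : C) (t : R) : 0 < r -> Cmod zeta < r ->
  rcont (fun t => RtoC (poisson r zeta t)) t.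
Proof.
intros Hr Hz.
apply cont_local with (f := fun t => RtoC (fst ((polar r t
  + zeta) / (polar r t - zeta))%C)) (eta := 1); [lra| |].
- intros y _. rewrite poisson_Re by assumption. reflexivity.
- apply cont_Re, cont_div.
  + apply sub_neq_0. rewrite Cmod_polar; lra.
  + apply cont_plus; [apply rcont_polar | apply cont_const].
  + apply cont_minus; [apply rcont_polar | apply cont_const].
Qed.

Theorem Poisson_formula (rad r : R) (f : C -> C) (zeta : C) :
  holo rad f -> 0 < r < rad -> Cmod zeta < r ->
  CInt (fun t => f (polar r t) * RtoC (poisson r zeta t))%C (- PI) PI
  = (RtoC (2 * PI) * f zeta)%C.
Proof.
intros Hf Hr Hz. pose proof (Cmod_nonneg zeta) as P.
(* [|zeta| (2 r - |zeta|) = r^2 - (r - |zeta|)^2 < r^2], so the denominator [r^2 - conj zeta z] has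
   no zero on this disk, which exceeds radius [r]. *)
set (rad' := Rmin rad (2 * r - Cmod zeta)).
assert (Hr' : 0 < r < rad') by (unfold rad'; split; [lra | apply Rmin_glb_lt; lra]).
assert (NZ : forall z, Cmod z < rad' -> (RtoC (r * r) - Cconj zeta * z)%C <> 0%C).
{ intros z Hz'. apply sub_neq_0. rewrite Cmod_mult, Cmod_Cconj, Cmod_R, Rabs_pos_eq by nra.
  assert (Cmod z < 2 * r - Cmod zeta) by (eapply Rlt_le_trans; [exact Hz' | apply Rmin_r]).
  pose proof (Cmod_nonneg z). nra. }
pose (k := fun z => (f z * (Cconj zeta * z / (RtoC (r * r) - Cconj zeta * z)))%C).
assert (Hk : holo rad' k).
{ intros z Hz'. destruct (Hf z) as [d Hd]; [eapply Rlt_le_trans; [exact Hz' | apply Rmin_l]|].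
  eexists. apply der_mult; [exact Hd|]. apply der_div; [apply NZ, Hz' | |].
  - apply der_scal, der_embed.
  - apply der_minus; [apply der_const | apply der_scal, der_embed]. }
pose proof (mean_value rad' r k Hk Hr') as E0.
pose proof (Cauchy rad r f zeta Hf Hr Hz) as E1.
assert (In : forall t, Cmod (polar r t) < rad) by (intros t; rewrite Cmod_polar; lra).
assert (CF : forall t, rcont (fun t => f (polar r t)) t).
{ intros t. apply (cont_comp RtoC f); [apply (holo_cont rad f Hf), In | apply rcont_polar]. }
rewrite (CInt_ext _ (fun t => f (polar r t) * (polar r t / (polar r t - zeta)) + k (polar r t))%C).
2: { intros t _. unfold k. rewrite poisson_split by lra. unfold Cdiv. ring. }
rewrite CInt_plus.
- rewrite E0, E1. unfold k. replace (f 0 * (Cconj zeta * 0 / (RtoC (r * r) - Cconj zeta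
    * 0)))%C with (RtoC 0)
    by (unfold Cdiv; ring). ring.
- intros t _. apply cont_mult; [apply CF|]. apply cont_div.
  + apply sub_neq_0. rewrite Cmod_polar; lra.
  + apply rcont_polar.
  + apply cont_minus; [apply rcont_polar | apply cont_const].
- intros t _. apply (cont_comp RtoC k); [|apply rcont_polar].
  apply (holo_cont rad' k Hk). rewrite Cmod_polar; lra.
Qed.

Lemma Poisson_Re (rad r : R) (f : C -> C) (zeta : C) :
  holo rad f -> 0 < r < rad -> Cmod zeta < r ->
  RInt (fun t => poisson r zeta t * fst (f (polar r t))) (- PI) PI = 2 * PI * fst (f zeta).
Proof.
intros Hf Hr Hz. pose proof (Poisson_formula rad r f zeta Hf Hr Hz) as E.
apply (f_equal fst) in E. unfold CInt in E. cbn [fst] in E.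
rewrite (RInt_ext _ (fun t => fst (f (polar r t) * RtoC (poisson r zeta t))%C)).
- rewrite E. simpl. ring.
- intros t _. simpl. ring.
Qed.

Lemma poisson_mass (r : R) (zeta : C) : 0 < r -> Cmod zeta < r ->
  RInt (poisson r zeta) (- PI) PI = 2 * PI.
Proof.
intros Hr Hz.
assert (H1 : holo (r + 1) (fun _ => 1%C)) by (intros z _; eexists; apply der_const).
pose proof (Poisson_Re (r + 1) r (fun _ => 1%C) zeta H1 ltac:(lra) Hz) as E.
transitivity (2 * PI * fst (RtoC 1)); [|simpl; ring]. rewrite <- E.
apply RInt_ext. intros t _. simpl. ring.
Qed.

Lemma holo_circle_cont (rad r : R) (f : C -> C) (t : R) :
  holo rad f -> 0 < r < rad -> rcont (fun t => f (polar r t)) t.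
Proof.
intros Hf Hr. apply (cont_comp RtoC f); [|apply rcont_polar].
apply (holo_cont rad f Hf). rewrite Cmod_polar; lra.
Qed.

Lemma ex_RInt_rcont (g : R -> R) (a b : R) : (forall t, rcont (fun t => RtoC (g t)) t) ->
  ex_RInt g a b.
Proof.
intros H. apply (ex_RInt_continuous (V := R_CompleteNormedModule)). intros t _.
apply rcont_continuous, H.
Qed.

Lemma cont_RtoC_mult {X : Type} (e : X -> C) (f g : X -> R) (x : X) :
  cont_via e (fun y => RtoC (f y)) x -> cont_via e (fun y => RtoC (g y)) x ->
  cont_via e (fun y => RtoC (f y * g y)) x.
Proof.
intros Hf Hg. apply cont_local with (f := fun y => (RtoC (f y) * RtoC (g y))%C) (eta := 1);
  [lra| |].
- intros y _. symmetry. apply RtoC_mult.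
- apply cont_mult; assumption.
Qed.

Lemma ex_RInt_poisson (rad r : R) (f : C -> C) (zeta : C) :
  holo rad f -> 0 < r < rad -> Cmod zeta < r ->
  ex_RInt (fun t => poisson r zeta t * fst (f (polar r t))) (- PI) PI.
Proof.
intros Hf Hr Hz. apply ex_RInt_rcont. intros t. apply cont_RtoC_mult.
- apply poisson_continuous; lra.
- apply cont_Re. apply (holo_circle_cont rad); assumption.
Qed.

(** A unimodular [u] turns the value at [zeta] into a positive real, and the Poisson mean of
    [Re (u f)] is at most [M]. *)
Lemma maximum_principle (rad r M : R) (f : C -> C) (zeta : C) :
  holo rad f -> 0 < r < rad -> Cmod zeta < r ->
  (forall z, Cmod z = r -> Cmod (f z) <= M) -> Cmod (f zeta) <= M.
Proof.
intros Hf Hr Hz HM. pose proof PI_RGT_0 as HP.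
destruct (Req_dec (Cmod (f zeta)) 0) as [E|NE].
{ rewrite E. eapply Rle_trans; [|apply (HM (polar r 0)), Cmod_polar; lra]. apply Cmod_nonneg. }
pose proof (Cmod_nonneg (f zeta)) as P.
set (m := Cmod (f zeta)) in *. set (u := (Cconj (f zeta) / RtoC m)%C).
assert (Hm : RtoC m <> 0%C) by (apply RtoC_neq_0, NE).
assert (Hu : (u * f zeta)%C = RtoC m).
{ unfold u. replace (Cconj (f zeta) / RtoC m * f zeta)%C with (f zeta * Cconj (f zeta) / RtoC m)%C
    by (field; exact Hm).
  rewrite Cconj_mult_Cmod. fold m. rewrite RtoC_mult. field. exact Hm. }
assert (Mu : Cmod u = 1).
{ unfold u. rewrite Cmod_div by exact Hm. rewrite Cmod_R, Rabs_pos_eq, Cmod_Cconj by exact P.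
  fold m. field. exact NE. }
assert (Hg : holo rad (fun z => u * f z)%C).
{ intros z Hz'. destruct (Hf z Hz') as [d Hd]. eexists. apply der_scal, Hd. }
pose proof (Poisson_Re rad r _ zeta Hg Hr Hz) as E. cbv beta in E. rewrite Hu in E.
change (fst (RtoC m)) with m in E.
assert (L : RInt (fun t => poisson r zeta t * fst (u * f (polar r t))%C) (- PI) PI
            <= RInt (fun t => poisson r zeta t * M) (- PI) PI).
{ apply RInt_le; [lra | | |].
  - apply (ex_RInt_poisson rad r (fun z => u * f z)%C); assumption.
  - apply ex_RInt_rcont. intros t. apply cont_RtoC_mult; [apply poisson_continuous; lra
      | apply cont_const].
  - intros t _. apply Rmult_le_compat_l; [apply Rlt_le, poisson_pos, Hz|].
    eapply Rle_trans; [apply Rle_abs|]. eapply Rle_trans; [apply Re_le_Cmod|].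
    rewrite Cmod_mult, Mu, Rmult_1_l. apply HM, Cmod_polar. lra. }
rewrite E in L.
rewrite (RInt_ext _ (fun t => scal M (poisson r zeta t))) in L
  by (intros t _; unfold scal; simpl; unfold mult; simpl; ring).
rewrite (RInt_scal (V := R_CompleteNormedModule)), poisson_mass in L.
- unfold scal in L; simpl in L; unfold mult in L; simpl in L.
  apply Rmult_le_reg_l with (2 * PI); lra.
- lra.
- exact Hz.
- apply ex_RInt_rcont. intros t. apply poisson_continuous; lra.
Qed.

(** The quotient [w / z] is obtained as the Cauchy integral [g] of [w(s) / s], so that no removable
    singularity arises at [0]. The hypothesis [w 0 = 0] is what gives [y g(y) = w(y)]. *)
Theorem Schwarz_lemma (rad r M : R) (w : C -> C) :
  holo rad w -> w 0%C = 0%C -> 0 < r < rad ->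
  (forall z, Cmod z <= r -> Cmod (w z) <= M) ->
  forall z, Cmod z <= r -> Cmod (w z) <= M * (Cmod z / r).
Proof.
intros Hw W0 Hr HM z Hz. pose proof PI_RGT_0 as HP. pose proof (Cmod_nonneg z) as Pz.
destruct (Req_dec (Cmod z) r) as [E|NE].
{ rewrite E. replace (M * (r / r)) with M by (field; lra). apply HM, Hz. }
pose (g := fun y => (/ RtoC (2 * PI) * CInt (fun t => w (polar r t) / (polar r t - y)) (- PI)
  PI)%C).
assert (Cw : contseg (fun t => w (polar r t)) (- PI) PI)
  by (intros t _; apply (holo_circle_cont rad); assumption).
assert (Hg : holo r g).
{ intros y Hy. eexists. apply der_scal, (Cauchy_integral_der (fun t => w (polar r t)));
    assumption. }
assert (Eg : forall y, Cmod y < r -> (y * g y)%C = w y).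
{ intros y Hy. unfold g.
  assert (E : CInt (fun t => y * (w (polar r t) / (polar r t - y)))%C (- PI) PI
            = (RtoC (2 * PI) * w y)%C).
  { rewrite (CInt_ext _ (fun t => w (polar r t) * (polar r t / (polar r t - y)) - w (polar r t))%C).
    - rewrite CInt_minus, (Cauchy rad), (mean_value rad); auto; [rewrite W0; ring|].
      intros t Ht. apply cont_mult; [apply Cw, Ht|]. apply cont_div.
      + apply sub_neq_0. rewrite Cmod_polar; lra.
      + apply rcont_polar.
      + apply cont_minus; [apply rcont_polar | apply cont_const].
    - intros t _. field. apply sub_neq_0. rewrite Cmod_polar; lra. }
  rewrite CInt_scal in E by (apply contseg_Cauchy_kernel; auto).
  replace (y * (/ RtoC (2 * PI) * CInt (fun t => w (polar r t) / (polar r t - y)) (- PI) PI))%C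
    with (/ RtoC (2 * PI) * (y * CInt (fun t => w (polar r t) / (polar r t - y)) (- PI) PI))%C by
      ring.
  rewrite E. field. apply RtoC_2PI_neq_0. }
(* [g] is known to be holomorphic only inside the circle of radius [r], so the maximum principle is
   used on smaller circles before [r'] tends to [r]. *)
assert (B : forall r', Cmod z < r' < r -> Cmod (g z) * r' <= M).
{ intros r' Hr'. apply Rmult_le_reg_r with (/ r'); [apply Rinv_0_lt_compat; lra|].
  replace (Cmod (g z) * r' * / r') with (Cmod (g z)) by (field; lra).
  apply (maximum_principle r r' _ g z); auto; [lra | apply Hr'|].
  intros y Hy. apply Rmult_le_reg_l with r'; [lra|].
  rewrite <- Hy at 1. rewrite <- Cmod_mult, Eg by lra.
  replace (r' * (M * / r')) with M by (field; lra). apply HM. lra. }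
assert (B' : Cmod (g z) * r <= M).
{ destruct (Rle_dec (Cmod (g z) * r) M) as [L|L]; [exact L|]. apply Rnot_le_lt in L.
  pose proof (Cmod_nonneg (g z)) as Pg. exfalso.
  assert (HM0 : 0 <= M).
  { eapply Rle_trans; [apply Cmod_nonneg | apply (HM z Hz)]. }
  assert (Pg' : 0 < Cmod (g z)) by nra.
  set (r1 := Rmax (M / Cmod (g z)) (Cmod z)).
  assert (H1 : r1 < r).
  { unfold r1. apply Rmax_lub_lt; [|lra]. apply Rmult_lt_reg_l with (Cmod (g z)); [lra|].
    replace (Cmod (g z) * (M / Cmod (g z))) with M by (field; lra). lra. }
  assert (H2 : M / Cmod (g z) <= r1) by apply Rmax_l. assert (H3 : Cmod z <= r1) by apply Rmax_r.
  specialize (B ((r1 + r) / 2) ltac:(lra)).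
  apply (Rmult_le_compat_l (Cmod (g z))) in H2; [|lra].
  replace (Cmod (g z) * (M / Cmod (g z))) with M in H2 by (field; lra). nra. }
rewrite <- Eg by lra. rewrite Cmod_mult. 
apply Rmult_le_reg_r with r; [lra|].
replace (M * (Cmod z / r) * r) with (Cmod z * M) by (field; lra).
rewrite Rmult_assoc. apply Rmult_le_compat_l; assumption.
Qed.

Lemma derive_left_max (f : R -> R) (x l eta : R) : 0 < eta -> is_derive f x l ->
  (forall y, x - eta < y < x -> f y <= f x) -> 0 <= l.
Proof.
intros He Hd H. destruct (Rle_dec 0 l) as [L|L]; [exact L|]. exfalso. apply Rnot_le_lt in L.
apply (proj1 (is_derive_R_eps f x l)) with (eps := - l / 2) in Hd; [|lra].
destruct Hd as [d [Hd K]].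
set (h := Rmin d eta / 2).
assert (Hh : 0 < h /\ h < d /\ h < eta).
{ assert (0 < Rmin d eta) by (apply Rmin_glb_lt; auto).
  pose proof (Rmin_l d eta). pose proof (Rmin_r d eta). unfold h. lra. }
specialize (K (x - h)). specialize (H (x - h) ltac:(lra)).
replace (x - h - x) with (- h) in K by ring. rewrite Rabs_Ropp, Rabs_pos_eq in K by lra.
specialize (K ltac:(lra)). apply Rabs_le_between in K. nra.
Qed.

Lemma derive_local_max (f : R -> R) (x l eta : R) : 0 < eta -> is_derive f x l ->
  (forall y, x - eta < y < x + eta -> f y <= f x) -> l = 0.
Proof.
intros He Hd H. apply Rle_antisym.
- assert (0 <= - l); [|lra].
  apply (derive_left_max (fun y => f (- y)) (- x) (- l) eta He).
  + eapply is_derive_ext; [intros; reflexivity|].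
    replace (- l) with (scal (-1) l) by (unfold scal; simpl; unfold mult; simpl; ring).
    apply (is_derive_comp f (fun y => - y)).
    * rewrite Ropp_involutive. exact Hd.
    * auto_derive; auto.
  + intros y Hy. rewrite Ropp_involutive. apply H. lra.
- apply (derive_left_max f x l eta He Hd). intros y Hy. apply H. lra.
Qed.

Lemma is_derive_Cmod_sqr (g : R -> C) (t : R) (v : C) : rder g t v ->
  is_derive (fun u => Cmod (g u) * Cmod (g u)) t (2 * fst (Cconj (g t) * v)%C).
Proof.
intros H. apply rder_components in H. destruct H as [H1 H2].
apply is_derive_ext with (fun u => fst (g u) * fst (g u) + snd (g u) * snd (g u)).
{ intros u. symmetry. apply Cmod_sqr. }
replace (2 * fst (Cconj (g t) * v)%C) with
  ((fst v * fst (g t) + fst (g t) * fst v) + (snd v * snd (g t) + snd (g t) * snd v))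
  by (unfold Cconj; simpl; ring).
apply (is_derive_plus (K := R_AbsRing) (V := R_NormedModule)); apply Derive.is_derive_mult;
  assumption.
Qed.

Lemma rder_ray (f : C -> C) (z d : C) (t : R) : cder f (RtoC t * z)%C d ->
  rder (fun u => f (RtoC u * z)%C) t (d * z)%C.
Proof.
intros H. apply (der_comp RtoC f (fun u => RtoC u * z)%C t d z H).
eapply der_eq; [|apply (der_mult RtoC RtoC (fun _ => z) t 1 0); [apply der_embed
  | apply der_const]].
cbv beta. ring.
Qed.

Lemma rder_rotation (f : C -> C) (z d : C) : cder f z d ->
  rder (fun u => f (z * polar 1 u)%C) 0 (d * (Ci * z))%C.
Proof.
intros H.
assert (P : (z * polar 1 0)%C = z).
{ unfold polar. rewrite cos_0, sin_0. apply injective_projections; simpl; ring. }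
apply (der_comp RtoC f (fun u => z * polar 1 u)%C).
- rewrite P. exact H.
- eapply der_eq; [|apply der_scal, rder_polar]. rewrite <- P at 2. ring.
Qed.

(** Put [D = conj (w z0) z0 w'(z0)]. As [|w|^2] is maximal along the circle at [z0], its angular
    derivative [-2 Im D] vanishes. Schwarz's lemma gives [|w(u z0)| <= M u] for [u < 1] with
    equality at [1], so the radial derivative yields [Re D >= M^2]. Then [m = D / M^2]. *)
Theorem Jack_lemma (rad : R) (w : C -> C) (z0 d : C) :
  holo rad w -> w 0%C = 0%C -> 0 < Cmod z0 < rad -> w z0 <> 0%C -> cder w z0 d ->
  (forall z, Cmod z <= Cmod z0 -> Cmod (w z) <= Cmod (w z0)) ->
  exists m, 1 <= m /\ (z0 * d)%C = (RtoC m * w z0)%C.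
Proof.
intros Hw W0 Hz N Hd HM.
set (M := Cmod (w z0)) in *. assert (PM : 0 < M) by (apply Cmod_pos, N).
pose proof (Schwarz_lemma rad (Cmod z0) M w Hw W0 Hz HM) as S.
set (D := (Cconj (w z0) * (z0 * d))%C).
assert (Z1 : (RtoC 1 * z0)%C = z0) by ring.
assert (Rad : M * M <= fst D).
{ assert (Dr : is_derive (fun u => Cmod (w (RtoC u * z0)%C) * Cmod (w (RtoC u * z0)%C)
                            - M * M * (u * u)) 1 (2 * fst D - 2 * (M * M))).
  { apply (is_derive_minus (K := R_AbsRing) (V := R_NormedModule)
       (fun u => Cmod (w (RtoC u * z0)%C) * Cmod (w (RtoC u * z0)%C)) (fun u => M * M * (u * u))).
    - replace (2 * fst D) with (2 * fst (Cconj (w (RtoC 1 * z0)%C) * (d * z0))%C).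
      + apply (is_derive_Cmod_sqr (fun u => w (RtoC u * z0)%C)), rder_ray. rewrite Z1. exact Hd.
      + rewrite Z1. unfold D. rewrite (Cmult_comm d). reflexivity.
    - auto_derive; [auto | ring]. }
  assert (0 <= 2 * fst D - 2 * (M * M)); [|lra].
  apply (derive_left_max _ 1 _ 1 Rlt_0_1 Dr). intros y Hy. rewrite Z1. fold M.
  assert (Y : Cmod (RtoC y * z0) = y * Cmod z0) by (rewrite Cmod_mult, Cmod_R, Rabs_pos_eq; lra).
  specialize (S (RtoC y * z0)%C). rewrite Y in S.
  replace (M * (y * Cmod z0 / Cmod z0)) with (M * y) in S by (field; lra).
  specialize (S ltac:(nra)). pose proof (Cmod_nonneg (w (RtoC y * z0)%C)). nra. }
assert (Ang : snd D = 0).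
{ assert (Da : is_derive (fun u => Cmod (w (z0 * polar 1 u)%C) * Cmod (w (z0 * polar 1 u)%C)) 0
                 (- 2 * snd D)).
  { replace (- 2 * snd D) with (2 * fst (Cconj (w (z0 * polar 1 0)%C) * (d * (Ci * z0)))%C).
    - apply (is_derive_Cmod_sqr (fun u => w (z0 * polar 1 u)%C)), rder_rotation, Hd.
    - replace (z0 * polar 1 0)%C with z0.
      + unfold D. replace (Cconj (w z0) * (d * (Ci * z0)))%C with (Ci * (Cconj (w z0) * (z0
          * d)))%C by ring.
        generalize (Cconj (w z0) * (z0 * d))%C. intros x. simpl. ring.
      + unfold polar. rewrite cos_0, sin_0. apply injective_projections; simpl; ring. }
  apply (derive_local_max _ 0 _ 1 Rlt_0_1) in Da; [lra|]. intros y _.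
  replace (z0 * polar 1 0)%C with z0.
  - fold M. assert (Y : Cmod (z0 * polar 1 y) = Cmod z0) by (rewrite Cmod_mult, Cmod_polar; lra).
    specialize (HM (z0 * polar 1 y)%C ltac:(lra)).
    pose proof (Cmod_nonneg (w (z0 * polar 1 y)%C)). nra.
  - unfold polar. rewrite cos_0, sin_0. apply injective_projections; simpl; ring. }
exists (fst D / (M * M)). split.
- apply Rmult_le_reg_r with (M * M); [nra|].
  replace (fst D / (M * M) * (M * M)) with (fst D) by (field; lra). lra.
- assert (ED : D = RtoC (fst D)) by (apply injective_projections; [reflexivity | exact Ang]).
  assert (NM : RtoC (M * M) <> 0%C) by (apply RtoC_neq_0; nra).
  rewrite RtoC_div by nra. rewrite <- ED. unfold D. unfold M in NM |- *. rewrite <- Cconj_mult_Cmod.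
  field. split; [apply Cconj_neq_0|]; exact N.
Qed.

(** * Convex maps *)

Lemma cont_R_eps {X : Type} (e : X -> C) (g : X -> R) (x : X) (eps : R) :
  cont_via e (fun y => RtoC (g y)) x -> 0 < eps ->
  exists delta, 0 < delta /\ forall y, Cmod (e y - e x) < delta -> Rabs (g y - g x) < eps.
Proof.
intros H He. destruct (H eps He) as [d [Hd H']]. exists d. split; [exact Hd|].
intros y Hy. specialize (H' y Hy). rewrite <- RtoC_minus, Cmod_R in H'. exact H'.
Qed.

(** If the infimum were not attained, every point would have a neighbourhood on which [g] exceeds it
    by a fixed amount, vacuously off [B]. Radius and excess share the gauge [del], because
    compactness returns a single lower bound [d] of the gauge; this [d] contradicts the infimum. *)
Lemma compact_min (B : C -> Prop) (g : C -> R) (M m : R) :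
  (forall z, B z -> Cmod z <= M) ->
  (forall z, ~ B z -> exists delta, 0 < delta /\ forall y, Cmod (y - z) < delta -> ~ B y) ->
  (forall z, B z -> ccont (fun z => RtoC (g z)) z) ->
  (forall z, B z -> m <= g z) -> (exists z, B z) ->
  exists z0, B z0 /\ forall z, B z -> g z0 <= g z.
Proof.
intros HM Hcl Hg Hm [zb Hb].
destruct (completeness (fun x => exists z, B z /\ x = - g z)) as [s [Hs1 Hs2]].
{ exists (- m). intros x [z [Hz ->]]. specialize (Hm z Hz). lra. }
{ exists (- g zb), zb. auto. }
apply NNPP. intros Hno.
assert (Low : forall z, B z -> - s < g z).
{ intros z Hz. assert (- g z <= s) by (apply Hs1; exists z; auto).
  destruct (Req_dec (g z) (- s)) as [E|NE]; [|lra]. exfalso. apply Hno. exists z.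
  split; [exact Hz|]. intros y Hy. assert (- g y <= s) by (apply Hs1; exists y; auto). lra. }
assert (K : forall z, exists del : posreal,
  forall y, Cmod (y - z) < 2 * del -> B y -> - s + del < g y).
{ intros z. destruct (classic (B z)) as [Hz|Hz].
  - pose proof (Low z Hz). set (c := (g z + s) / 2). assert (Hc : 0 < c) by (unfold c; lra).
    destruct (cont_R_eps _ _ _ c (Hg z Hz) Hc) as [d [Hd H']].
    assert (Hdc : 0 < Rmin (d / 2) c) by (apply Rmin_glb_lt; lra).
    exists (mkposreal _ Hdc). simpl. intros y Hy _.
    pose proof (Rmin_l (d / 2) c). pose proof (Rmin_r (d / 2) c).
    specialize (H' y ltac:(lra)). apply Rabs_def2 in H'. unfold c in *. lra.
  - destruct (Hcl z Hz) as [d [Hd H']]. assert (Hd2 : 0 < d / 2) by lra.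
    exists (mkposreal _ Hd2). simpl. intros y Hy HB. exfalso. apply (H' y); [lra | exact HB]. }
pose (del := fun z => proj1_sig (constructive_indefinite_description _ (K z))).
assert (Hdel : forall z y, Cmod (y - z) < 2 * del z -> B y -> - s + del z < g y).
{ intros z. exact (proj2_sig (constructive_indefinite_description _ (K z))). }
destruct (compactness_value_2d (- M) M (- M) M (fun u v => del (u, v))) as [d Hd].
assert (U : s <= s - d); [|pose proof (cond_pos d); lra].
apply Hs2. intros x [z [Hz ->]]. specialize (HM z Hz).
pose proof (Re_le_Cmod z) as Rz. pose proof (Im_le_Cmod z) as Iz.
apply Rabs_le_between in Rz. apply Rabs_le_between in Iz.
apply NNPP. intros Hlt. apply (Hd (fst z) (snd z)); [lra | lra|].
intros [u [v [_ [_ [Hu [Hv Hdd]]]]]]. apply Hlt.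
assert (- s + del (u, v) < g z); [|lra]. apply Hdel; [|exact Hz].
eapply Rle_lt_trans; [apply Cmod_le_Re_Im|]. simpl. unfold Rminus in *. lra.
Qed.

Lemma nonneg_boundary (rad rho : R) (E : C -> R) (z : C) :
  (forall z, Cmod z < rad -> ccont (fun z => RtoC (E z)) z) ->
  (forall z, Cmod z < rho -> 0 < E z) -> 0 < Cmod z <= rho -> Cmod z < rad -> 0 <= E z.
Proof.
intros HE Hp Hz Hr. destruct (Rle_dec 0 (E z)) as [L|L]; [exact L|]. exfalso. apply Rnot_le_lt in L.
destruct (cont_R_eps _ _ _ (- E z) (HE z Hr) ltac:(lra)) as [d [Hd H']].
(* [(1 - h) z] lies on the radius through [z] at distance less than [d]; the second bound keeps
   [1 - h] nonnegative. *)
set (h := Rmin (d / 2) (Cmod z) / Cmod z).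
assert (0 < Rmin (d / 2) (Cmod z)) by (apply Rmin_glb_lt; lra).
pose proof (Rmin_l (d / 2) (Cmod z)). pose proof (Rmin_r (d / 2) (Cmod z)).
assert (Hh : h * Cmod z = Rmin (d / 2) (Cmod z)) by (unfold h; field; lra).
assert (Hh0 : 0 < h) by (apply Rdiv_lt_0_compat; lra).
assert (Hh1 : h <= 1) by (apply Rmult_le_reg_r with (Cmod z); lra).
specialize (H' (RtoC (1 - h) * z)%C).
replace (RtoC (1 - h) * z - z)%C with (RtoC (- h) * z)%C in H'
  by (rewrite RtoC_minus, RtoC_opp; ring).
rewrite Cmod_mult, Cmod_R, Rabs_Ropp, Rabs_pos_eq, Hh in H' by lra.
specialize (H' ltac:(lra)). apply Rabs_def2 in H'.
assert (0 < E (RtoC (1 - h) * z)%C); [|lra].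
apply Hp. rewrite Cmod_mult, Cmod_R, Rabs_pos_eq by lra. nra.
Qed.

(** A point of least modulus in the closed set where [E <= 0]. Arguments by contradiction on an open
    disk start from it, since no boundary values are available there. *)
Lemma first_contact (rad : R) (E : C -> R) (z1 : C) :
  (forall z, Cmod z < rad -> ccont (fun z => RtoC (E z)) z) -> 0 < E 0%C ->
  Cmod z1 < rad -> E z1 <= 0 ->
  exists z0, 0 < Cmod z0 <= Cmod z1 /\ E z0 = 0 /\ (forall z, Cmod z < Cmod z0 -> 0 < E z).
Proof.
intros HE H0 Hz1 E1.
destruct (compact_min (fun z => Cmod z <= Cmod z1 /\ E z <= 0) Cmod (Cmod z1) 0)
  as [z0 [[L0 Ez0] Hmin]].
- intros z [H _]. exact H.
- intros z Hz. destruct (Rle_dec (Cmod z) (Cmod z1)) as [L|L].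
  + assert (P : 0 < E z) by (apply Rnot_le_lt; intros N; apply Hz; auto).
    destruct (cont_R_eps _ _ _ (E z) (HE z ltac:(lra)) P) as [d [Hd H']].
    exists d. split; [exact Hd|]. intros y Hy [_ N]. specialize (H' y Hy).
    apply Rabs_def2 in H'. lra.
  + apply Rnot_le_lt in L. exists (Cmod z - Cmod z1). split; [lra|].
    intros y Hy [N _]. pose proof (Cmod_triangle_rev z y) as T.
    rewrite Cmod_minus_sym in T. lra.
- intros z _. apply cont_Cmod, cont_embed.
- intros z _. apply Cmod_nonneg.
- exists z1. split; [lra | exact E1].
- assert (P0 : 0 < Cmod z0).
  { apply Cmod_pos. intros ->. lra. }
  assert (Pos : forall z, Cmod z < Cmod z0 -> 0 < E z).
  { intros z Hz. apply Rnot_le_lt. intros N.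
    specialize (Hmin z ltac:(split; [lra | exact N])). lra. }
  exists z0. split; [lra|]. split; [|exact Pos].
  apply Rle_antisym; [exact Ez0|]. apply (nonneg_boundary rad (Cmod z0)); auto; lra.
Qed.

(* [|Q'|^2 Re (1 + z Q''/Q')]: its positivity also encodes [Q' <> 0]. *)
Definition curvature (Q : C -> C) (z : C) : R :=
  fst ((C_derive Q z + z * C_derive (C_derive Q) z) * Cconj (C_derive Q z))%C.

Definition convex_map (rad : R) (Q : C -> C) : Prop :=
  holo rad Q /\ forall z, Cmod z < rad -> 0 < curvature Q z.

Lemma convex_map_derive_neq_0 (rad : R) (Q : C -> C) (z : C) :
  convex_map rad Q -> Cmod z < rad -> C_derive Q z <> 0%C.
Proof.
intros [_ H] Hz E. specialize (H z Hz). unfold curvature in H. rewrite E in H.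
unfold Cconj in H. simpl in H. lra.
Qed.

Lemma Re_div_pos (x y : C) : y <> 0%C -> 0 < fst (x * Cconj y)%C <-> 0 < fst (x / y)%C.
Proof.
intros H. pose proof (Cmod_pos y H) as P.
assert (E : (x / y)%C = (x * Cconj y * RtoC (/ (Cmod y * Cmod y)))%C).
{ rewrite RtoC_inv by nra. rewrite <- Cconj_mult_Cmod. field. split; [apply Cconj_neq_0|];
    exact H. }
assert (F : fst (x / y)%C = fst (x * Cconj y)%C * / (Cmod y * Cmod y)).
{ rewrite E. generalize (x * Cconj y)%C. intros u. simpl. ring. }
assert (0 < / (Cmod y * Cmod y)) by (apply Rinv_0_lt_compat; nra).
rewrite F. split; intros K; [apply Rmult_lt_0_compat; assumption|].
apply Rmult_lt_reg_r with (/ (Cmod y * Cmod y)); [assumption|]. lra.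
Qed.

Lemma rder_zero_const (K : R -> C) (a b : R) : (forall t, rder K t 0%C) -> K a = K b.
Proof.
intros H. pose proof (CInt_FTC K (fun _ => 0%C) a b (fun t _ => H t)) as E.
rewrite CInt_const in E by (apply contseg_const).
replace (K a) with (K b - (K b - K a))%C by ring. rewrite <- E; [ring|].
apply contseg_const.
Qed.

Lemma rder_CInt (p : R -> C) (a t : R) : (forall t, rcont p t) ->
  rder (fun u => CInt p a u) t (p t).
Proof.
intros H. apply rder_components. unfold CInt. cbn [fst snd]. split.
- apply (is_derive_RInt (V := R_NormedModule) (fun u => fst (p u)) _ a t).
  + apply filter_forall. intros z. apply (RInt_correct (V := R_CompleteNormedModule)).
    apply contseg_ex_Re. intros u _. apply H.
  + apply rcont_fst, H.
- apply (is_derive_RInt (V := R_NormedModule) (fun u => snd (p u)) _ a t).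
  + apply filter_forall. intros z. apply (RInt_correct (V := R_CompleteNormedModule)).
    apply contseg_ex_Im. intros u _. apply H.
  + apply rcont_snd, H.
Qed.

(** Circle means run over [(-PI, PI)], whereas the support argument starts at [zeta] and runs over
    [(0, 2 PI)]. The shift by [PI] turns into the unimodular factor [- zeta / |zeta|]. *)
Lemma rotate_polar (zeta : C) (t : R) : 0 < Cmod zeta ->
  (zeta * polar 1 (t + PI) = (- zeta / RtoC (Cmod zeta)) * polar (Cmod zeta) t)%C.
Proof.
intros H. unfold polar. rewrite neg_cos, neg_sin.
assert (RtoC (Cmod zeta) <> 0%C) by (apply RtoC_neq_0; lra).
replace ((Cmod zeta * cos t)%R, (Cmod zeta * sin t)%R) with (RtoC (Cmod zeta) * (cos t, sin t))%C
  by (apply injective_projections; simpl; ring).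
replace ((1 * - cos t)%R, (1 * - sin t)%R) with (- (cos t, sin t))%C
  by (apply injective_projections; simpl; ring).
generalize (cos t, sin t). intros c. field. assumption.
Qed.

Lemma Cmod_unimodular (zeta : C) : 0 < Cmod zeta -> Cmod (- zeta / RtoC (Cmod zeta)) = 1.
Proof.
intros H. rewrite Cmod_div by (apply RtoC_neq_0; lra). rewrite Cmod_opp, Cmod_R, Rabs_pos_eq by lra.
field. lra.
Qed.

Lemma holo_rotate (rad : R) (f : C -> C) (u : C) : Cmod u = 1 -> holo rad f ->
  holo rad (fun z => f (u * z)%C).
Proof.
intros Hu Hf z Hz. destruct (Hf (u * z)%C) as [d Hd].
{ rewrite Cmod_mult, Hu. lra. }
eexists. apply (der_comp _ f (fun z => u * z)%C); [exact Hd|]. apply der_scal, der_embed.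
Qed.

Lemma mean_value_shift (rad : R) (f : C -> C) (zeta : C) : holo rad f -> 0 < Cmod zeta < rad ->
  RInt (fun t => fst (f (zeta * polar 1 t)%C)) 0 (2 * PI) = 2 * PI * fst (f 0%C).
Proof.
intros Hf Hz. set (u := (- zeta / RtoC (Cmod zeta))%C).
pose proof (Cmod_unimodular zeta ltac:(lra)) as Hu. fold u in Hu.
pose proof (mean_value_Re rad (Cmod zeta) _ (holo_rotate rad f u Hu Hf) Hz) as E. cbv beta in E.
replace (u * 0)%C with (RtoC 0) in E by ring. rewrite <- E.
pose proof (RInt_comp_lin (V := R_CompleteNormedModule)
  (fun t => fst (f (zeta * polar 1 t)%C)) 1 PI (- PI) PI) as S.
replace (1 * - PI + PI) with 0 in S by ring. replace (1 * PI + PI) with (2 * PI) in S by ring.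
rewrite <- S.
- apply RInt_ext. intros t _. unfold scal; simpl; unfold mult; simpl. rewrite Rmult_1_l.
  rewrite Rmult_1_l, rotate_polar by lra. reflexivity.
- apply ex_RInt_rcont. intros t. apply cont_Re.
  apply (cont_comp RtoC f (fun t => zeta * polar 1 t)%C).
  + apply (holo_cont rad f Hf). rewrite Cmod_mult, Cmod_polar; lra.
  + apply cont_mult; [apply cont_const | apply rcont_polar].
Qed.

Lemma sin_neg_between (x : R) : PI < x < 2 * PI -> sin x < 0.
Proof. intros H. apply sin_lt_0; lra. Qed.

(* The tangent direction [i zeta Q'] turns monotonically, through a total angle [2 PI] by the
   mean value property, so the curve stays strictly on one side of each tangent. *)
Lemma convex_support_circle (rad : R) (Q : C -> C) (zeta : C) (t : R) :
  convex_map rad Q -> 0 < Cmod zeta < rad -> 0 < t < 2 * PI ->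
  fst ((Q (zeta * polar 1 t) - Q zeta) * Cconj (zeta * C_derive Q zeta))%C < 0.
Proof.
intros HQ Hz Ht. pose proof HQ as [HoQ Hc].
pose proof (holo_derive rad Q HoQ) as HoQ1. pose proof (holo_derive rad _ HoQ1) as HoQ2.
assert (DQ : forall z, Cmod z < rad -> cder Q z (C_derive Q z)) by (intros;
  apply (holo_C_derive rad); auto).
assert (DQ1 : forall z, Cmod z < rad -> cder (C_derive Q) z (C_derive (C_derive Q) z))
  by (intros; apply (holo_C_derive rad); auto).
assert (NQ : forall z, Cmod z < rad -> C_derive Q z <> 0%C)
  by (intros; eapply convex_map_derive_neq_0; eauto).
pose (P := fun z => ((C_derive Q z + z * C_derive (C_derive Q) z) / C_derive Q z)%C).
assert (HP : holo rad P).
{ intros z Hz'. destruct (HoQ2 z Hz') as [d Hd]. eexists. apply der_div; [apply NQ, Hz' |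
    | apply DQ1, Hz'].
  apply der_plus; [apply DQ1, Hz'|]. apply der_mult; [apply der_embed | exact Hd]. }
assert (Pp : forall z, Cmod z < rad -> 0 < fst (P z)).
{ intros z Hz'. apply Re_div_pos; [apply NQ, Hz'|]. apply Hc, Hz'. }
pose (x := fun t => (zeta * polar 1 t)%C).
assert (Hx : forall t, Cmod (x t) < rad) by (intros u; unfold x; rewrite Cmod_mult, Cmod_polar;
  lra).
assert (Dx : forall t, rder x t (Ci * x t)%C).
{ intros u. eapply der_eq; [|apply der_scal, rder_polar]. unfold x. ring. }
assert (x0 : x 0 = zeta).
{ unfold x, polar. rewrite cos_0, sin_0. apply injective_projections; simpl; ring. }
assert (x2 : x (2 * PI) = zeta).
{ rewrite <- x0. unfold x. f_equal. rewrite <- (polar_periodic 1 0). f_equal. ring. }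
pose (p := fun t => P (x t)).
assert (Cp : forall t, rcont p t).
{ intros u. apply (cont_comp RtoC P); [apply (holo_cont rad P HP), Hx | eapply der_cont, Dx]. }
pose (J := fun t => CInt p 0 t).
pose (g := fun t => (x t * C_derive Q (x t))%C).
assert (Dg : forall t, rder g t (Ci * p t * g t)%C).
{ intros u. eapply der_eq.
  2: { apply der_mult; [apply Dx|]. apply (der_comp RtoC (C_derive Q)); [apply DQ1, Hx
    | apply Dx]. }
  unfold g, p, P. field. apply NQ, Hx. }
assert (Eg : forall t, g t = (g 0 * Cexp (Ci * J t))%C).
{ intros u.
  assert (K : forall t, rder (fun t => g t * Cexp (- (Ci * J t)))%C t 0%C).
  { intros v. eapply der_eq.
    2: { apply der_mult; [apply Dg|]. apply (der_comp RtoC Cexp (fun t => - (Ci * J t))%C);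
      [apply cder_Cexp|].
         apply der_opp, der_scal, rder_CInt, Cp. }
    cbv beta. ring. }
  pose proof (rder_zero_const _ u 0 K) as E. cbv beta in E.
  assert (J0 : J 0 = 0%C).
  { unfold J, CInt. rewrite !(RInt_point (V := R_CompleteNormedModule)). reflexivity. }
  rewrite J0 in E. replace (- (Ci * 0))%C with (RtoC 0) in E by ring. rewrite Cexp_0,
    Cmult_1_r in E.
  rewrite <- E. replace (g u * Cexp (- (Ci * J u)) * Cexp (Ci * J u))%C
    with (g u * (Cexp (Ci * J u) * Cexp (- (Ci * J u))))%C by ring.
  rewrite Cexp_opp. ring. }
assert (g0 : g 0 = (zeta * C_derive Q zeta)%C) by (unfold g; rewrite x0; reflexivity).
assert (Ng : 0 < Cmod (g 0)).
{ apply Cmod_pos. rewrite g0. apply Cmult_neq_0; [apply Cmod_pos_neq; lra | apply NQ; lra]. }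
(* As [g = g 0 * exp (i J)], the real part of [J] is the angle through which the tangent has turned,
   and minus its imaginary part is the logarithm of the stretch. *)
pose (B := fun t => fst (J t)).
assert (DB : forall t, is_derive B t (fst (p t))).
{ intros u. apply (proj1 (rder_components J u (p u))), rder_CInt, Cp. }
assert (B0 : B 0 = 0).
{ unfold B, J, CInt. cbn [fst]. apply (RInt_point (V := R_CompleteNormedModule)). }
assert (B2 : B (2 * PI) = 2 * PI).
{ unfold B, J, CInt. cbn [fst]. unfold p, x. rewrite (mean_value_shift rad P zeta HP Hz).
  assert (P0 : P 0%C = 1%C).
  { unfold P. field. apply NQ. rewrite Cmod_0. lra. }
  rewrite P0. simpl. ring. }
assert (Inc : forall a b, a < b -> B a < B b).
{ intros a b Hab. destruct (MVT_cor2 B (fun t => fst (p t)) a b Hab) as [c [Hc1 Hc2]].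
  { intros c _. apply is_derive_Reals, DB. }
  specialize (Pp (x c) (Hx c)). fold (p c) in Pp. nra. }
pose (G := fun t => fst ((Q (x t) - Q zeta) * Cconj (g 0))%C).
pose (dG := fun t => - (Cmod (g 0) * Cmod (g 0) * exp (- snd (J t))) * sin (B t)).
assert (DG : forall t, is_derive G t (dG t)).
{ intros u.
  assert (D : rder (fun t => (Q (x t) - Q zeta) * Cconj (g 0))%C u (Ci * g u * Cconj (g 0))%C).
  { eapply der_eq.
    2: { apply der_mult; [|apply der_const]. apply der_minus; [|apply der_const].
         apply (der_comp RtoC Q); [apply DQ, Hx | apply Dx]. }
    cbv beta. unfold g. ring. }
  apply rder_components in D. destruct D as [D _].
  replace (dG u) with (fst (Ci * g u * Cconj (g 0))%C); [exact D|].
  rewrite (Eg u).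
  replace (Ci * (g 0 * Cexp (Ci * J u)) * Cconj (g 0))%C
    with (Ci * Cexp (Ci * J u) * (g 0 * Cconj (g 0)))%C by ring.
  rewrite Cconj_mult_Cmod. unfold dG, B, Cexp, Re, Im. destruct (J u) as [j1 j2]. simpl.
  replace (0 * j1 - 1 * j2) with (- j2) by ring. replace (0 * j2 + 1 * j1) with j1 by ring. ring. }
assert (G0 : G 0 = 0) by (unfold G; rewrite x0; simpl; ring).
assert (G2 : G (2 * PI) = 0) by (unfold G; rewrite x2; simpl; ring).
rewrite <- g0. change (G t < 0).
pose proof PI_RGT_0 as HPI.
assert (Pe : forall t, 0 < Cmod (g 0) * Cmod (g 0) * exp (- snd (J t))).
{ intros u. pose proof (exp_pos (- snd (J u))). repeat apply Rmult_lt_0_compat; auto. }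
(* [G] vanishes at [0] and at [2 PI], falls while the angle [B] is below [PI] and rises afterwards.
   The mean value theorem is used on the side of [t] where the derivative keeps its sign. *)
destruct (Rle_dec (B t) PI) as [L|L].
- destruct (MVT_cor2 G dG 0 t ltac:(lra)) as [c [Hc1 Hc2]].
  { intros c _. apply is_derive_Reals, DG. }
  assert (0 < sin (B c)).
  { pose proof (Inc 0 c ltac:(lra)). pose proof (Inc c t ltac:(lra)). apply sin_gt_0; lra. }
  assert (dG c < 0).
  { unfold dG. specialize (Pe c). nra. }
  rewrite G0 in Hc1. nra.
- apply Rnot_le_lt in L. destruct (MVT_cor2 G dG t (2 * PI) ltac:(lra)) as [c [Hc1 Hc2]].
  { intros c _. apply is_derive_Reals, DG. }
  assert (sin (B c) < 0).
  { pose proof (Inc t c ltac:(lra)). pose proof (Inc c (2 * PI) ltac:(lra)).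
      apply sin_neg_between; lra. }
  assert (0 < dG c).
  { unfold dG. specialize (Pe c). nra. }
  rewrite G2 in Hc1. nra.
Qed.

(** The harmonic function [Re ((Q zeta - Q y) conj g0)] is positive on the circle except at
    [y = zeta], hence positive inside by the Poisson integral. *)
Lemma convex_support (rad : R) (Q : C -> C) (zeta z : C) :
  convex_map rad Q -> Cmod zeta < rad -> Cmod z < Cmod zeta ->
  0 < fst ((Q zeta - Q z) * Cconj (zeta * C_derive Q zeta))%C.
Proof.
intros HQ Hzeta Hz. pose proof PI_RGT_0 as HPI. pose proof (Cmod_nonneg z).
set (rho := Cmod zeta) in *.
set (u := (- zeta / RtoC rho)%C).
assert (Hu : Cmod u = 1) by (apply Cmod_unimodular; fold rho; lra).
assert (Nu : u <> 0%C) by (apply Cmod_pos_neq; lra).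
set (g0 := (zeta * C_derive Q zeta)%C).
pose (h := fun y => ((Q zeta - Q y) * Cconj g0)%C).
assert (Hh : holo rad h).
{ intros y Hy. eexists. apply der_mult; [|apply der_const]. apply der_minus; [apply der_const|].
  apply (holo_C_derive rad); [apply HQ | exact Hy]. }
pose proof (holo_rotate rad h u Hu Hh) as Hhu.
assert (Hy : Cmod (z / u) < rho).
{ rewrite Cmod_div, Hu by exact Nu. unfold Rdiv. rewrite Rinv_1. lra. }
pose proof (Poisson_Re rad rho _ (z / u)%C Hhu ltac:(lra) Hy) as E. cbv beta in E.
replace (u * (z / u))%C with z in E by (field; exact Nu).
change (0 < fst (h z)).
assert (0 < 2 * PI * fst (h z)); [|nra]. rewrite <- E.
apply RInt_gt_0; [lra | |].
- intros t Ht. apply Rmult_lt_0_compat; [apply poisson_pos, Hy|].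
  pose proof (convex_support_circle rad Q zeta (t + PI) HQ ltac:(fold rho; lra) ltac:(lra)) as S.
  rewrite rotate_polar in S by (fold rho; lra). fold rho u g0 in S. unfold h.
  replace ((Q zeta - Q (u * polar rho t)) * Cconj g0)%C
    with (- ((Q (u * polar rho t) - Q zeta) * Cconj g0))%C by ring.
  generalize dependent ((Q (u * polar rho t) - Q zeta) * Cconj g0)%C. intros c Hc. simpl. lra.
- intros t _. apply rcont_continuous, cont_RtoC_mult; [apply poisson_continuous; lra|].
  apply cont_Re. exact (holo_circle_cont rad rho (fun y => h (u * y)%C) t Hhu ltac:(lra)).
Qed.

Lemma circle_point (z : C) (rho : R) : Cmod z = rho -> exists t, - PI <= t <= PI /\ z = polar rho t.
Proof. intros <-. apply polar_exists. Qed.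

(** A form of the argument principle: if [Q - W] had no zero, [z Q' / (Q - W)] would be holomorphic
    with value [0] at the centre, while its real part is positive on the whole circle. *)
Lemma support_covers (rad rho : R) (Q : C -> C) (W : C) : holo rad Q -> 0 < rho < rad ->
  (forall zeta, Cmod zeta = rho -> 0 < fst ((Q zeta - W) * Cconj (zeta * C_derive Q zeta))%C) ->
  exists z, Cmod z < rho /\ Q z = W.
Proof.
intros HQ Hrho HS. pose proof PI_RGT_0 as HPI. apply NNPP. intros Hno.
assert (NW : forall z, Cmod z <= rho -> (Q z - W)%C <> 0%C).
{ intros z Hz E. assert (EQ : Q z = W) by (replace (Q z) with ((Q z - W) + W)%C by ring;
    rewrite E; ring).
  destruct (Req_dec (Cmod z) rho) as [Ez|Nz].
  - specialize (HS z Ez). rewrite E in HS. unfold Cconj in HS. simpl in HS. lra.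
  - apply Hno. exists z. split; [lra | exact EQ]. }
(* The quotient [k] must be holomorphic beyond the circle. Zeros of [Q - W] outside it are avoided
   by stopping at the one of least modulus. *)
assert (Ext : exists rad', rho < rad' <= rad /\ forall z, Cmod z < rad' -> (Q z - W)%C <> 0%C).
{ destruct (classic (exists z1, Cmod z1 < rad /\ (Q z1 - W)%C = 0%C)) as [[z1 [Hz1 E1]]|N].
  - destruct (first_contact rad (fun z => Cmod (Q z - W)) z1) as [z0 [Hz0 [E0 Hpos]]].
    + intros z Hz. apply cont_Cmod, cont_minus; [apply (holo_cont rad Q HQ), Hz | apply cont_const].
    + apply Cmod_pos, NW. rewrite Cmod_0. lra.
    + exact Hz1.
    + rewrite E1, Cmod_0. lra.
    + exists (Cmod z0). split.
      * split; [|lra]. apply Rnot_le_lt. intros L. apply (NW z0 L), Cmod_eq_0, E0.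
      * intros z Hz. apply Cmod_pos_neq, Hpos, Hz.
  - exists rad. split; [lra|]. intros z Hz E. apply N. exists z. auto. }
destruct Ext as [rad' [Hr' NW']].
pose (k := fun z => (z * C_derive Q z / (Q z - W))%C).
assert (Hk : holo rad' k).
{ intros z Hz. destruct (holo_derive rad Q HQ z ltac:(lra)) as [d Hd].
  eexists. apply der_div; [apply NW', Hz | |].
  - apply der_mult; [apply der_embed | exact Hd].
  - apply der_minus; [apply (holo_C_derive rad); [exact HQ | lra] | apply der_const]. }
pose proof (mean_value_Re rad' rho k Hk ltac:(lra)) as E.
assert (k0 : fst (k 0%C) = 0).
{ unfold k. replace (0 * C_derive Q 0 / (Q 0 - W))%C with (RtoC 0) by (unfold Cdiv; ring).
    reflexivity. }
rewrite k0, Rmult_0_r in E.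
assert (0 < RInt (fun t => fst (k (polar rho t))) (- PI) PI); [|lra].
apply RInt_gt_0; [lra | |].
- intros t _. unfold k. apply Re_div_pos.
  + apply NW. rewrite Cmod_polar; lra.
  + specialize (HS (polar rho t) ltac:(apply Cmod_polar; lra)).
    revert HS. generalize (Q (polar rho t) - W)%C (polar rho t * C_derive Q (polar rho t))%C.
    intros c d. unfold Cconj. simpl. lra.
- intros t _. apply rcont_fst, (holo_circle_cont rad'); [exact Hk | lra].
Qed.

(** By compactness the support inequality for [Q z1] holds on the circle with a uniform margin
    [S t0]. It persists for [W] within [S t0 / K], where [K] bounds [|zeta Q'|], and then
    [support_covers] applies. *)
Lemma convex_open_image (rad rho : R) (Q : C -> C) (z1 : C) : convex_map rad Q ->
  Cmod z1 < rho -> rho < rad ->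
  exists delta, 0 < delta /\ forall W, Cmod (W - Q z1) < delta ->
    exists z, Cmod z < rho /\ Q z = W.
Proof.
intros HQ Hz1 Hrho. pose proof PI_RGT_0 as HPI. pose proof (Cmod_nonneg z1).
pose (g := fun t => (polar rho t * C_derive Q (polar rho t))%C).
pose (S := fun t => fst ((Q (polar rho t) - Q z1) * Cconj (g t))%C).
assert (Cg : forall t, rcont g t).
{ intros t. apply cont_mult; [apply rcont_polar|].
  apply (holo_circle_cont rad); [apply holo_derive, HQ | lra]. }
assert (CS : forall t, rcont (fun t => RtoC (S t)) t).
{ intros t. apply cont_Re, cont_mult; [|apply cont_conj, Cg].
  apply cont_minus; [apply (holo_circle_cont rad); [apply HQ | lra] | apply cont_const]. }
destruct (contseg_bounded g (- PI) PI ltac:(lra) (fun t _ => Cg t)) as [K [HK HgK]].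
destruct (continuity_ab_min S (- PI) PI ltac:(lra)) as [t0 [Hmin Ht0]].
{ intros t _. apply continuity_pt_filterlim. refine (proj1 (rcont_continuous S t) (CS t)). }
assert (c0 : 0 < S t0).
{ apply (convex_support rad); [exact HQ | |]; rewrite Cmod_polar; lra. }
exists (S t0 / K). split; [apply Rdiv_lt_0_compat; assumption|].
intros W HW. apply (support_covers rad); [apply HQ | lra|].
intros zeta Hzeta. destruct (circle_point zeta rho Hzeta) as [t [Ht ->]]. fold (g t).
specialize (Hmin t Ht). specialize (HgK t Ht).
replace ((Q (polar rho t) - W) * Cconj (g t))%C
  with ((Q (polar rho t) - Q z1) * Cconj (g t) - (W - Q z1) * Cconj (g t))%C by ring.
assert (Rabs (fst ((W - Q z1) * Cconj (g t))%C) < S t0).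
{ eapply Rle_lt_trans; [apply Re_le_Cmod|]. rewrite Cmod_mult, Cmod_Cconj.
  apply Rle_lt_trans with (Cmod (W - Q z1) * K).
  - apply Rmult_le_compat_l; [apply Cmod_nonneg | exact HgK].
  - apply (Rmult_lt_compat_r K) in HW; [|exact HK].
    replace (S t0 / K * K) with (S t0) in HW by (field; lra). exact HW. }
apply Rabs_def2 in H0.
change (0 < S t - fst ((W - Q z1) * Cconj (g t))%C). lra.
Qed.

(** The strict support inequality at the point of larger modulus separates its value from all values
    inside and, in the circle version, from the other values on its own circle. *)
Lemma convex_injective (rad : R) (Q : C -> C) (z1 z2 : C) : convex_map rad Q ->
  Cmod z1 < rad -> Cmod z2 < rad -> Q z1 = Q z2 -> z1 = z2.
Proof.
assert (Main : forall z1 z2, convex_map rad Q -> Cmod z1 <= Cmod z2 -> Cmod z2 < rad ->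
  Q z1 = Q z2 -> z1 = z2).
{ intros y1 y2 HQ Hle Hr E. destruct (Req_dec (Cmod y1) (Cmod y2)) as [Em|Nm].
  - destruct (Req_dec (Cmod y2) 0) as [Z|NZ].
    { rewrite (Cmod_eq_0 y2 Z). apply Cmod_eq_0. lra. }
    pose proof (Cmod_nonneg y2). assert (N2 : y2 <> 0%C) by (apply Cmod_pos_neq; lra).
    destruct (circle_point (y1 / y2)%C 1) as [t [Ht Et]].
    { rewrite Cmod_div, Em by exact N2. field. exact NZ. }
    assert (E1 : y1 = (y2 * polar 1 t)%C) by (rewrite <- Et; field; exact N2).
    assert (Out : forall t, 0 < t < 2 * PI -> y1 <> (y2 * polar 1 t)%C).
    { intros s Hs Es. pose proof (convex_support_circle rad Q y2 s HQ ltac:(lra) Hs) as S.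
      rewrite <- Es, E in S. replace (Q y2 - Q y2)%C with (RtoC 0) in S by ring.
      unfold Cconj in S. simpl in S. lra. }
    destruct (Rtotal_order t 0) as [L|[L|L]].
    + exfalso. apply (Out (t + 2 * PI)); [lra|]. rewrite polar_periodic. exact E1.
    + rewrite E1, L. unfold polar. rewrite cos_0, sin_0. apply injective_projections; simpl; ring.
    + exfalso. apply (Out t); [pose proof PI_RGT_0; lra | exact E1].
  - exfalso. pose proof (convex_support rad Q y2 y1 HQ Hr ltac:(lra)) as S. rewrite E in S.
    replace (Q y2 - Q y2)%C with (RtoC 0) in S by ring. unfold Cconj in S. simpl in S. lra. }
intros HQ H1 H2 E. destruct (Rle_dec (Cmod z1) (Cmod z2)) as [L|L].
- apply Main; auto.
- symmetry. apply Main; auto. lra.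
Qed.

(** * Averages of convex maps and subordination *)

(* The differential form of [Q(z) = alpha int_0^1 s^(alpha-1) q(s z) ds]. *)
Definition averages (alpha rad : R) (Q q : C -> C) : Prop :=
  forall z, Cmod z < rad -> (RtoC alpha * Q z + z * C_derive Q z)%C = (RtoC alpha * q z)%C.

Lemma averages_derive (alpha rad : R) (Q q : C -> C) (z : C) :
  holo rad Q -> holo rad q -> averages alpha rad Q q -> Cmod z < rad ->
  (RtoC alpha * C_derive Q z + (C_derive Q z + z * C_derive (C_derive Q) z))%C
  = (RtoC alpha * C_derive q z)%C.
Proof.
intros HQ Hq HA Hz. apply (cder_unique (fun z => RtoC alpha * q z)%C z).
- apply der_local with (f := fun z => (RtoC alpha * Q z + z
    * C_derive Q z)%C) (eta := rad - Cmod z); [lra| |].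
  + intros y Hy. pose proof (Cmod_triangle_rev y z). apply HA. lra.
  + eapply der_eq.
    2: { apply der_plus; [apply der_scal, (holo_C_derive rad Q z HQ Hz)|].
         apply der_mult; [apply der_embed | apply (holo_C_derive rad _ z (holo_derive rad Q HQ)
           Hz)]. }
    cbv beta. ring.
- apply der_scal, (holo_C_derive rad q z Hq Hz).
Qed.

Lemma curvature_cont (rad : R) (Q : C -> C) (z : C) : holo rad Q -> Cmod z < rad ->
  ccont (fun z => RtoC (curvature Q z)) z.
Proof.
intros HQ Hz. pose proof (holo_derive rad Q HQ) as H1. pose proof (holo_derive rad _ H1) as H2.
pose proof (holo_cont rad _ H1 z Hz) as C1. pose proof (holo_cont rad _ H2 z Hz) as C2.
unfold curvature. apply cont_Re, cont_mult; [|apply cont_conj, C1].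
apply cont_plus; [exact C1|]. apply cont_mult; [apply cont_embed | exact C2].
Qed.

(** A zero of the curvature at a first contact might come from [Q' = 0]. This is excluded because
    [|t Q'(t z)|^2] has the derivative [2 t curvature(t z)], so it increases along the radius. *)
Lemma derive_nonzero_of_curvature (rad : R) (Q : C -> C) (z : C) : holo rad Q -> 0 < Cmod z < rad ->
  (forall y, Cmod y < Cmod z -> 0 < curvature Q y) -> C_derive Q z <> 0%C.
Proof.
intros HQ Hz HE E.
assert (D : forall t, 0 < t <= 1 -> is_derive
  (fun t => Cmod (RtoC t * C_derive Q (RtoC t * z)) * Cmod (RtoC t * C_derive Q (RtoC t * z))) t
  (2 * t * curvature Q (RtoC t * z)%C)).
{ intros t Ht. assert (Htz : Cmod (RtoC t * z) < rad).
  { rewrite Cmod_mult, Cmod_R, Rabs_pos_eq by lra. nra. }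
  replace (2 * t * curvature Q (RtoC t * z)%C) with (2 * fst (Cconj (RtoC t
    * C_derive Q (RtoC t * z))
    * (1 * C_derive Q (RtoC t * z) + RtoC t * (C_derive (C_derive Q) (RtoC t * z) * z)))%C).
  - apply (is_derive_Cmod_sqr (fun t => RtoC t * C_derive Q (RtoC t * z))%C).
    apply (der_mult RtoC RtoC (fun t => C_derive Q (RtoC t * z)%C)); [apply der_embed|].
    apply (rder_ray (C_derive Q)).
    apply (holo_C_derive rad); [apply holo_derive, HQ | exact Htz].
  - unfold curvature. generalize (C_derive Q (RtoC t * z)%C) (C_derive (C_derive Q) (RtoC t * z)%C).
    intros c d. unfold Cconj. simpl. ring. }
destruct (MVT_cor2 (fun t => Cmod (RtoC t * C_derive Q (RtoC t * z)) * Cmod (RtoC t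
  * C_derive Q (RtoC t * z)))
   (fun t => 2 * t * curvature Q (RtoC t * z)%C) (/ 2) 1 ltac:(lra)) as [c [Hc1 Hc2]].
{ intros c Hc. apply is_derive_Reals, D. lra. }
cbv beta in Hc1.
replace (RtoC 1 * z)%C with z in Hc1 by ring. rewrite E in Hc1.
replace (RtoC 1 * 0)%C with (RtoC 0) in Hc1 by ring. rewrite Cmod_0 in Hc1.
assert (0 < curvature Q (RtoC c * z)%C).
{ apply HE. rewrite Cmod_mult, Cmod_R, Rabs_pos_eq by lra. nra. }
pose proof (Cmod_nonneg (RtoC (/ 2) * C_derive Q (RtoC (/ 2) * z))%C). nra.
Qed.

Lemma is_derive_fst (g : R -> C) (t : R) (v : C) : rder g t v ->
  is_derive (fun u => fst (g u)) t (fst v).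
Proof. intros H. apply (proj1 (rder_components g t v)), H. Qed.

Lemma is_derive_opp_fst (g : R -> C) (t : R) (v : C) :
  rder g t v -> is_derive (fun u => - fst (g u)) t (- fst v).
Proof. intros H. apply (is_derive_opp (K := R_AbsRing) (V := R_NormedModule) (fun u => fst (g u))),
  is_derive_fst, H. Qed.

(* With [P = 1 + z Q''/Q'] the differentiated equation reads [Q' (alpha + P) = alpha q'], whence
   [P + z P'/(alpha + P) = 1 + z q''/q'].  At a first point where [Re P = 0], [z P'] is a
   nonpositive real, so the left-hand side has nonpositive real part. *)
Theorem averages_convex (alpha rad : R) (Q q : C -> C) : 0 < alpha -> 0 < rad ->
  holo rad Q -> convex_map rad q -> averages alpha rad Q q -> convex_map rad Q.
Proof.
intros Ha Hrad HQ Hq HA. split; [exact HQ|]. intros z1 Hz1. apply Rnot_le_lt. intros E1.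
pose proof (holo_derive rad Q HQ) as HQ1. pose proof (holo_derive rad _ HQ1) as HQ2.
pose proof (holo_derive rad q (proj1 Hq)) as Hq1.
assert (HD : forall z, Cmod z < rad ->
  (RtoC alpha * C_derive Q z + (C_derive Q z + z * C_derive (C_derive Q) z))%C
  = (RtoC alpha * C_derive q z)%C) by (intros z Hz; apply (averages_derive alpha rad); auto;
    apply Hq).
assert (Na : RtoC alpha <> 0%C) by (apply RtoC_neq_0; lra).
assert (R0 : Cmod 0 < rad) by (rewrite Cmod_0; exact Hrad).
assert (E0 : 0 < curvature Q 0%C).
{ assert (N : C_derive Q 0%C <> 0%C).
  { intros N. specialize (HD 0%C R0). rewrite N in HD.
    apply (convex_map_derive_neq_0 rad q 0%C Hq R0).
    replace (C_derive q 0%C) with (/ RtoC alpha * (RtoC alpha * C_derive q 0%C))%C by (field;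
      exact Na).
    rewrite <- HD. ring. }
  unfold curvature. replace ((C_derive Q 0%C + 0 * C_derive (C_derive Q) 0%C)
    * Cconj (C_derive Q 0%C))%C
    with (C_derive Q 0%C * Cconj (C_derive Q 0%C))%C by ring.
  rewrite Cconj_mult_Cmod. pose proof (Cmod_pos _ N). simpl. nra. }
destruct (first_contact rad (curvature Q) z1) as [z0 [Hz0 [Ez0 Hpos]]]; auto.
{ intros z Hz. apply (curvature_cont rad); assumption. }
assert (Rz0 : Cmod z0 < rad) by lra.
pose (P := fun z => ((C_derive Q z + z * C_derive (C_derive Q) z) / C_derive Q z)%C).
assert (NQin : forall z, Cmod z < Cmod z0 -> C_derive Q z <> 0%C).
{ intros z Hz N. specialize (Hpos z Hz). unfold curvature in Hpos. rewrite N in Hpos.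
  unfold Cconj in Hpos. simpl in Hpos. lra. }
assert (NQ : forall z, Cmod z = Cmod z0 -> C_derive Q z <> 0%C).
{ intros z Hz. apply (derive_nonzero_of_curvature rad); [exact HQ | lra|]. rewrite Hz. exact Hpos. }
pose proof (NQ z0 eq_refl) as N0.
assert (Pge : forall z, Cmod z <= Cmod z0 -> 0 <= fst (P z)).
{ intros z Hz. destruct (Req_dec (Cmod z) (Cmod z0)) as [Em|Nm].
  - destruct (Rle_dec 0 (fst (P z))) as [L|L]; [exact L|]. exfalso. apply Rnot_le_lt in L.
    assert (K : 0 <= curvature Q z).
    { apply (nonneg_boundary rad (Cmod z0)); [|exact Hpos|lra|lra].
      intros y Hy. apply (curvature_cont rad); assumption. }
    assert (0 < fst (- P z)%C) by (change (0 < - fst (P z)); lra).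
    assert (0 < fst ((- (C_derive Q z + z * C_derive (C_derive Q) z)) * Cconj (C_derive Q z))%C).
    { apply Re_div_pos; [apply NQ, Em|].
      replace (- (C_derive Q z + z * C_derive (C_derive Q) z) / C_derive Q z)%C with (- P z)%C;
        [exact H|].
      unfold P. field. apply NQ, Em. }
    unfold curvature in K. revert H0 K.
    generalize (C_derive Q z + z * C_derive (C_derive Q) z)%C (Cconj (C_derive Q z)).
    intros c d. simpl. lra.
  - apply Rlt_le, Re_div_pos; [apply NQin; lra|]. apply Hpos. lra. }
assert (HP : exists D, cder P z0 D).
{ destruct (HQ2 z0 Rz0) as [d Hd]. eexists. apply der_div; [exact N0| |apply (holo_C_derive rad);
    eassumption].
  apply der_plus; [apply (holo_C_derive rad); eassumption|]. apply der_mult; [apply der_embed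
    | exact Hd]. }
destruct HP as [D HP].
assert (ReP0 : fst (P z0) = 0).
{ pose proof (Cmod_pos _ N0).
  assert (E : P z0 = ((C_derive Q z0 + z0 * C_derive (C_derive Q) z0) * Cconj (C_derive Q z0)
     * RtoC (/ (Cmod (C_derive Q z0) * Cmod (C_derive Q z0))))%C).
  { rewrite RtoC_inv by nra. rewrite <- Cconj_mult_Cmod. unfold P. field.
    split; [apply Cconj_neq_0|]; exact N0. }
  rewrite E. unfold curvature in Ez0. revert Ez0.
  generalize ((C_derive Q z0 + z0 * C_derive (C_derive Q) z0) * Cconj (C_derive Q z0))%C.
  intros c Hc. simpl. rewrite Hc. ring. }
assert (Zr : (RtoC 1 * z0)%C = z0) by ring.
assert (Za : (z0 * polar 1 0)%C = z0).
{ unfold polar. rewrite cos_0, sin_0. apply injective_projections; simpl; ring. }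
(* [Re P] is nonnegative on the closed disk and vanishes at [z0]: its outward radial derivative is
   at most [0] and its angular derivative is [0]. These are the real part of [z0 P'] and minus its
   imaginary part. *)
assert (K1 : fst (D * z0)%C <= 0).
{ assert (0 <= - fst (D * z0)%C); [|lra].
  apply (derive_left_max (fun u => - fst (P (RtoC u * z0)%C)) 1 _ 1 Rlt_0_1).
  - apply (is_derive_opp_fst (fun u => P (RtoC u * z0)%C)), rder_ray. rewrite Zr. exact HP.
  - intros y Hy. rewrite Zr, ReP0. specialize (Pge (RtoC y * z0)%C).
    rewrite Cmod_mult, Cmod_R, Rabs_pos_eq in Pge by lra. specialize (Pge ltac:(nra)). lra. }
assert (K2 : snd (D * z0)%C = 0).
{ assert (K : - fst (D * (Ci * z0))%C = 0).
  { apply (derive_local_max (fun u => - fst (P (z0 * polar 1 u)%C)) 0 _ 1 Rlt_0_1).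
    - apply (is_derive_opp_fst (fun u => P (z0 * polar 1 u)%C)), rder_rotation, HP.
    - intros y _. rewrite Za, ReP0. specialize (Pge (z0 * polar 1 y)%C).
      rewrite Cmod_mult, Cmod_polar in Pge by lra. specialize (Pge ltac:(lra)). lra. }
  rewrite <- K. replace (D * (Ci * z0))%C with (Ci * (D * z0))%C by ring.
  generalize (D * z0)%C. intros c. simpl. ring. }
assert (Nap : (RtoC alpha + P z0)%C <> 0%C).
{ intros N. apply (f_equal fst) in N. change (alpha + fst (P z0) = 0) in N. lra. }
assert (A1 : (C_derive Q z0 * (RtoC alpha + P z0))%C = (RtoC alpha * C_derive q z0)%C).
{ rewrite <- HD by exact Rz0. unfold P. field. exact N0. }
assert (A2 : (C_derive (C_derive Q) z0 * (RtoC alpha + P z0) + C_derive Q z0 * D)%C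
             = (RtoC alpha * C_derive (C_derive q) z0)%C).
(* The relation [Q' (alpha + P) = alpha q'] is to be differentiated at [z0], so it is needed on a
   full neighbourhood; within [d] the derivative of [Q] does not vanish. *)
{ destruct (holo_cont rad _ HQ1 z0 Rz0 (Cmod (C_derive Q z0)) (Cmod_pos _ N0)) as [d [Hd Hc]].
  apply (cder_unique (fun z => RtoC alpha * C_derive q z)%C z0).
  - apply der_local with (f := fun z => (C_derive Q z * (RtoC alpha + P z))%C)
      (eta := Rmin d (rad - Cmod z0)); [apply Rmin_glb_lt; lra| |].
    + intros y Hy.
      destruct (lt_Rmin _ _ _ Hy) as [Y1 Y2].
      pose proof (Cmod_triangle_rev y z0). specialize (Hc y Y1).
      assert (Ny : C_derive Q y <> 0%C).
      { intros N. rewrite N in Hc. replace (0 - C_derive Q z0)%C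
          with (- C_derive Q z0)%C in Hc by ring.
        rewrite Cmod_opp in Hc. lra. }
      rewrite <- HD by lra. unfold P. field. exact Ny.
    + eapply der_eq; [|apply der_mult; [apply (holo_C_derive rad _ z0 HQ1 Rz0)|
        apply der_plus; [apply der_const | exact HP]]]. cbv beta. ring.
  - apply der_scal, (holo_C_derive rad _ z0 Hq1 Rz0). }
pose proof (convex_map_derive_neq_0 rad q z0 Hq Rz0) as Nq.
assert (Fin : ((C_derive q z0 + z0 * C_derive (C_derive q) z0) / C_derive q z0)%C
              = (P z0 + (D * z0) / (RtoC alpha + P z0))%C).
{ transitivity ((RtoC alpha * C_derive q z0 + z0 * (RtoC alpha * C_derive (C_derive q) z0))
                / (RtoC alpha * C_derive q z0))%C; [field; auto|].
  rewrite <- A1, <- A2. unfold P at 4. 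
  transitivity ((C_derive Q z0 + z0 * C_derive (C_derive Q) z0) / C_derive Q z0
                 + D * z0 / (RtoC alpha + P z0))%C; [field; auto | reflexivity]. }
destruct Hq as [_ Hcq]. specialize (Hcq z0 Rz0). unfold curvature in Hcq.
apply (proj1 (Re_div_pos _ _ Nq)) in Hcq. rewrite Fin in Hcq.
assert (ED : (D * z0)%C = RtoC (fst (D * z0)%C)) by (apply injective_projections; [reflexivity
  | exact K2]).
assert (fst (D * z0 / (RtoC alpha + P z0))%C <= 0).
{ apply Rnot_lt_le. intros L. apply Re_div_pos in L; [|exact Nap].
  rewrite ED in L. revert L ReP0 K1. generalize (P z0) (fst (D * z0)%C). intros c k L Hc Hk.
  unfold Cconj in L. simpl in L. rewrite Hc in L. nra. }
change (0 < fst (P z0) + fst (D * z0 / (RtoC alpha + P z0))%C) in Hcq. lra.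
Qed.

(** * Lifting through a convex map, and subordination of averages *)

Definition subordinate (rad : R) (p q : C -> C) : Prop :=
  exists w, holo rad w /\ w 0%C = 0%C /\ (forall z, Cmod z < rad -> Cmod (w z) <= Cmod z) /\
    forall z, Cmod z < rad -> p z = q (w z).

(** Where [f] vanishes, continuity of [g] is enough. This serves when [g] is the inverse of a
    difference quotient, or contains [power0], which need not be differentiable at [0]. *)
Lemma der_mult_vanishing {X : Type} (e f g : X -> C) (x : X) (d : C) :
  f x = 0%C -> der_via e f x d -> cont_via e g x -> der_via e (fun y => f y * g y)%C x (d * g x).
Proof.
intros Hf Hd Hg eps He.
pose proof (Cmod_nonneg d) as Nd. pose proof (Cmod_nonneg (g x)) as Ng.
destruct (cont_locally_bounded e g x Hg) as [d0 [Hd0 H0]].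
set (A := Cmod (g x) + 1) in *. set (B := Cmod d + 1).
destruct (Hd (eps / 2 / A)) as [d1 [Hd1 H1]]; [repeat apply Rdiv_lt_0_compat; unfold A; lra|].
destruct (Hg (eps / 2 / B)) as [d2 [Hd2 H2]]; [repeat apply Rdiv_lt_0_compat; unfold B; lra|].
exists (Rmin d0 (Rmin d1 d2)). split; [repeat apply Rmin_glb_lt; assumption|]. intros y Hy.
destruct (lt_Rmin _ _ _ Hy) as [Hy0 Hy'].
destruct (lt_Rmin _ _ _ Hy') as [Hy1 Hy2].
specialize (H0 y Hy0). specialize (H1 y Hy1). specialize (H2 y Hy2).
pose proof (Cmod_nonneg (e y - e x)%C) as P. set (h := Cmod (e y - e x)) in *.
replace (f y * g y - f x * g x - d * g x * (e y - e x))%C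
  with ((f y - f x - d * (e y - e x)) * g y + d * (e y - e x) * (g y - g x))%C by (rewrite Hf;
    ring).
eapply Rle_trans; [apply Cmod_triangle|]. rewrite !Cmod_mult. fold h.
assert (Q1 : Cmod (f y - f x - d * (e y - e x)) * Cmod (g y) <= eps / 2 * h).
{ apply Rle_trans with (eps / 2 / A * h * A).
  - apply Rmult_le_compat; [apply Cmod_nonneg | apply Cmod_nonneg | exact H1 | exact H0].
  - right. field. unfold A. lra. }
assert (Q2 : Cmod d * h * Cmod (g y - g x) <= eps / 2 * h).
{ apply Rle_trans with (B * h * (eps / 2 / B)).
  - apply Rmult_le_compat; [nra | apply Cmod_nonneg | unfold B; nra | lra].
  - right. field. unfold B. lra. }
lra.
Qed.

Definition quotient_ext (Q : C -> C) (z0 z : C) : C :=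
  if excluded_middle_informative (z = z0) then C_derive Q z0 else ((Q z - Q z0) / (z - z0))%C.

Lemma quotient_ext_cont (Q : C -> C) (z0 : C) :
  cder Q z0 (C_derive Q z0) -> ccont (quotient_ext Q z0) z0.
Proof.
intros H eps He. destruct (H (eps / 2)) as [d [Hd H']]; [lra|]. exists d. split; [exact Hd|].
intros y Hy. unfold quotient_ext. destruct (excluded_middle_informative (z0 = z0)) as [_|N];
  [|easy].
destruct (excluded_middle_informative (y = z0)) as [E|N].
- replace (C_derive Q z0 - C_derive Q z0)%C with (RtoC 0) by ring. rewrite Cmod_0. exact He.
- assert (Nz : (y - z0)%C <> 0%C).
  { intros E. apply N. replace y with ((y - z0) + z0)%C by ring. rewrite E. ring. }
  pose proof (Cmod_pos _ Nz). specialize (H' y Hy).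
  replace ((Q y - Q z0) / (y - z0) - C_derive Q z0)%C
    with ((Q y - Q z0 - C_derive Q z0 * (y - z0)) / (y - z0))%C by (field; exact Nz).
  rewrite Cmod_div by exact Nz.
  apply Rmult_lt_reg_r with (Cmod (y - z0)); [assumption|].
  replace (Cmod (Q y - Q z0 - C_derive Q z0 * (y - z0)) / Cmod (y - z0) * Cmod (y - z0))
    with (Cmod (Q y - Q z0 - C_derive Q z0 * (y - z0))) by (field; lra).
  nra.
Qed.

(** The derivative of an inverse map in Caratheodory's form: [w(y) - w(z)] is [P y - P z], which
    vanishes at [z], times the inverse of the continuous extension of the difference quotient of
    [Q]. Injectivity keeps that quotient away from zero. *)
Lemma cder_of_lift (rad : R) (Q P w : C -> C) (z : C) (eta : R) : convex_map rad Q -> 0 < eta ->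
  (forall y, Cmod (y - z) < eta -> Cmod (w y) < rad /\ Q (w y) = P y) ->
  ccont w z -> cder P z (C_derive P z) -> cder w z (C_derive P z * / C_derive Q (w z))%C.
Proof.
intros HQ He Hw Cw DP.
assert (Z0 : Cmod (z - z) < eta).
{ replace (z - z)%C with (RtoC 0) by ring. rewrite Cmod_0. exact He. }
destruct (Hw z Z0) as [Rw Ew].
pose proof (convex_map_derive_neq_0 rad Q (w z) HQ Rw) as N.
assert (Ez : quotient_ext Q (w z) (w z) = C_derive Q (w z)).
{ unfold quotient_ext. destruct (excluded_middle_informative (w z = w z)); easy. }
apply der_local with (f := fun y => (w z + (P y - P z)
  * / quotient_ext Q (w z) (w y))%C) (eta := eta);
  [exact He| |].
- intros y Hy. destruct (Hw y Hy) as [Ry Ey]. rewrite <- Ey, <- Ew. unfold quotient_ext.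
  destruct (excluded_middle_informative (w y = w z)) as [E|NE].
  + rewrite E. ring.
  + assert (N1 : (w y - w z)%C <> 0%C).
    { intros E. apply NE. replace (w y) with ((w y - w z) + w z)%C by ring. rewrite E. ring. }
    assert (N2 : (Q (w y) - Q (w z))%C <> 0%C).
    { intros E. apply NE, (convex_injective rad Q); auto.
      replace (Q (w y)) with ((Q (w y) - Q (w z)) + Q (w z))%C by ring. rewrite E. ring. }
    field. auto.
- eapply der_eq.
  2: { apply der_plus; [apply der_const|].
       apply (der_mult_vanishing _ (fun y => P y - P z)%C (fun y => / quotient_ext Q (w z) (w y))%C
         z
                (C_derive P z - 0)).
       - ring.
       - apply der_minus; [exact DP | apply der_const].
       - apply cont_inv; [rewrite Ez; exact N|].
         apply (cont_comp _ (quotient_ext Q (w z))); [|exact Cw].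
         apply quotient_ext_cont, (holo_C_derive rad); [apply HQ | exact Rw]. }
  cbv beta. rewrite Ez. ring.
Qed.

(** [Q] stays at a positive distance from [Q (w z)] on the compact set of points at least [eps] away
    from [w z]. Near [z] the value [P y] has a preimage of modulus below [rho], which is [w y] by
    injectivity, so the compact disk of radius [rho] suffices. *)
Lemma lift_cont (rad : R) (Q P w : C -> C) (z : C) (eta : R) : convex_map rad Q -> 0 < eta ->
  (forall y, Cmod (y - z) < eta -> Cmod (w y) < rad /\ Q (w y) = P y) ->
  ccont P z -> ccont w z.
Proof.
intros HQ Heta Hw CP eps He.
assert (Z0 : Cmod (z - z) < eta).
{ replace (z - z)%C with (RtoC 0) by ring. rewrite Cmod_0. exact Heta. }
destruct (Hw z Z0) as [Rw Ew].
set (rho := (Cmod (w z) + rad) / 2).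
destruct (convex_open_image rad rho Q (w z) HQ ltac:(unfold rho; lra) ltac:(unfold rho; lra))
  as [d1 [Hd1 H1]].
assert (Far : exists c, 0 < c /\ forall x, Cmod x <= rho -> eps <= Cmod (x - w z) ->
  c <= Cmod (Q x - Q (w z))).
{ destruct (classic (exists x, Cmod x <= rho /\ eps <= Cmod (x - w z))) as [Hex|Hno].
  - destruct (compact_min (fun x => Cmod x <= rho /\ eps <= Cmod (x - w z))
      (fun x => Cmod (Q x - Q (w z))) rho 0) as [x0 [[Rx0 Ex0] Hmin]].
    + intros x [H _]. exact H.
    + intros x Hx. destruct (Rle_dec (Cmod x) rho) as [L|L].
      * assert (L' : Cmod (x - w z) < eps) by (apply Rnot_le_lt; auto).
        exists (eps - Cmod (x - w z)). split; [lra|]. intros y Hy [_ Hy2].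
        replace (y - w z)%C with ((y - x) + (x - w z))%C in Hy2 by ring.
        pose proof (Cmod_triangle (y - x)%C (x - w z)%C). lra.
      * apply Rnot_le_lt in L. exists (Cmod x - rho). split; [lra|]. intros y Hy [Hy1 _].
        pose proof (Cmod_triangle_rev x y) as T. rewrite Cmod_minus_sym in T. lra.
    + intros x [Hx _]. apply cont_Cmod, cont_minus; [|apply cont_const].
      apply (holo_cont rad); [apply HQ | unfold rho in *; lra].
    + intros x _. apply Cmod_nonneg.
    + exact Hex.
    + exists (Cmod (Q x0 - Q (w z))). split; [|intros x Hx1 Hx2; apply Hmin; auto].
      apply Cmod_pos. intros E.
      assert (x0 = w z).
      { apply (convex_injective rad Q); auto; [unfold rho in *; lra|].
        replace (Q x0) with ((Q x0 - Q (w z)) + Q (w z))%C by ring. rewrite E. ring. }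
      subst x0. replace (w z - w z)%C with (RtoC 0) in Ex0 by ring. rewrite Cmod_0 in Ex0. lra.
  - exists 1. split; [lra|]. intros x Hx1 Hx2. exfalso. apply Hno. exists x. auto. }
destruct Far as [c [Hc Far]].
destruct (CP (Rmin d1 c)) as [d2 [Hd2 H2]]; [apply Rmin_glb_lt; assumption|].
exists (Rmin eta d2). split; [apply Rmin_glb_lt; assumption|]. intros y Hy.
destruct (Hw y) as [Ry Ey]; [eapply Rlt_le_trans; [exact Hy | apply Rmin_l]|].
specialize (H2 y (Rlt_le_trans _ _ _ Hy (Rmin_r _ _))). rewrite <- Ey, <- Ew in H2.
destruct (H1 (Q (w y))) as [x [Hx Ex]]; [eapply Rlt_le_trans; [exact H2 | apply Rmin_l]|].
assert (x = w y) by (apply (convex_injective rad Q); auto; unfold rho in *; lra). subst x.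
apply Rnot_le_lt. intros L. specialize (Far (w y) (Rlt_le _ _ Hx) L).
assert (Cmod (Q (w y) - Q (w z)) < c) by (eapply Rlt_le_trans; [exact H2 | apply Rmin_r]). lra.
Qed.

(* Where [|w|] is maximal on [|z| <= |z1|], Jack's lemma gives [z0 w'(z0) = m zeta0] with [m >= 1],
   hence [alpha p(z0) = alpha q(zeta0) + (m - 1) zeta0 Q'(zeta0)], which lies outside the tangent
   of the convex curve [q(|z| = |zeta0|)] at [q(zeta0)]. *)
Lemma lift_bound (alpha rad sigma : R) (Q q P p w : C -> C) (z1 : C) : 0 < alpha ->
  convex_map rad Q -> convex_map rad q -> averages alpha rad Q q ->
  holo rad P -> averages alpha rad P p -> subordinate rad p q ->
  sigma <= rad -> P 0%C = Q 0%C ->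
  (forall z, Cmod z < sigma -> Cmod (w z) < rad /\ Q (w z) = P z) ->
  holo sigma w -> Cmod z1 < sigma -> Cmod (w z1) <= Cmod z1.
Proof.
intros Ha HQ Hq AQ HP AP Hpq Hs H0 Hw Dw Hz1.
apply Rnot_lt_le. intros Hbad. pose proof (Cmod_nonneg z1) as N1.
destruct (compact_min (fun z => Cmod z <= Cmod z1) (fun z => - Cmod (w z)) (Cmod z1) (- rad))
  as [z0 [Hz0 Hmax]].
{ auto. }
{ intros z Hz. apply Rnot_le_lt in Hz. exists (Cmod z - Cmod z1). split; [lra|].
  intros y Hy L. pose proof (Cmod_triangle_rev z y) as T. rewrite Cmod_minus_sym in T. lra. }
{ intros z Hz. apply cont_local with (f := fun z => (- RtoC (Cmod (w z)))%C) (eta := 1); [lra| |].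
  - intros y _. symmetry. apply RtoC_opp.
  - apply cont_opp, cont_Cmod, (holo_cont sigma); [exact Dw | lra]. }
{ intros z Hz. destruct (Hw z ltac:(lra)). lra. }
{ exists z1. lra. }
assert (M1 : Cmod (w z1) <= Cmod (w z0)) by (specialize (Hmax z1 (Rle_refl _)); lra).
assert (S0 : Cmod 0 < sigma) by (rewrite Cmod_0; lra).
assert (W0 : w 0%C = 0%C).
{ destruct (Hw 0%C S0) as [R0 E0]. apply (convex_injective rad Q); auto.
  - rewrite Cmod_0. lra.
  - rewrite E0. exact H0. }
assert (Nw : w z0 <> 0%C) by (apply Cmod_pos_neq; lra).
assert (Pz0 : 0 < Cmod z0) by (apply Cmod_pos; intros E; apply Nw; rewrite E; exact W0).
destruct (Dw z0 ltac:(lra)) as [d Hd].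
destruct (Jack_lemma sigma w z0 d Dw W0 ltac:(lra) Nw Hd) as [m [Hm Em]].
{ intros z Hz. specialize (Hmax z ltac:(lra)). lra. }
destruct (Hw z0 ltac:(lra)) as [Rw0 Ew0].
set (x0 := w z0) in *.
assert (EP : C_derive P z0 = (C_derive Q x0 * d)%C).
{ apply cder_C_derive. apply der_local with (f := fun z => Q (w z)) (eta := sigma - Cmod z0);
    [lra| |].
  - intros y Hy. pose proof (Cmod_triangle_rev y z0). apply Hw. lra.
  - apply (der_comp _ Q w); [apply (holo_C_derive rad); [apply HQ | exact Rw0] | exact Hd]. }
destruct Hpq as [w1 [_ [_ [Bw1 Ew1]]]].
assert (Rz0 : Cmod z0 < rad) by lra.
specialize (Bw1 z0 Rz0). specialize (Ew1 z0 Rz0).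
pose proof (AP z0 Rz0) as A1. rewrite EP, <- Ew0, Ew1 in A1.
pose proof (AQ x0 Rw0) as A2.
pose proof (convex_support rad q x0 (w1 z0) Hq Rw0 ltac:(lra)) as Sup.
pose proof (averages_derive alpha rad Q q x0 (proj1 HQ) (proj1 Hq) AQ Rw0) as A3.
(* The averaging relations give [alpha (q x0 - q (w1 z0)) = (1 - m) x0 Q'(x0)]. Multiplied by the
   conjugate normal, the left side has positive real part, because [|w1 z0| <= |z0| < |x0|]. On the
   right, [alpha q' = alpha Q' + (Q' + x0 Q'')] makes the factor of [1 - m] positive through the
   curvature. *)
assert (K : (RtoC alpha * RtoC alpha * ((q x0 - q (w1 z0)) * Cconj (x0 * C_derive q x0)))%C =
  (RtoC (1 - m) * RtoC (Cmod x0 * Cmod x0) * (C_derive Q x0 * Cconj (RtoC alpha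
    * C_derive q x0)))%C).
{ transitivity ((RtoC alpha * q x0 - RtoC alpha * q (w1 z0)) * Cconj x0 * (RtoC alpha
    * Cconj (C_derive q x0)))%C.
  { unfold Cconj. apply injective_projections; simpl; ring. }
  rewrite <- A1, <- A2, <- Cconj_mult_Cmod.
  replace (RtoC alpha * Cconj (C_derive q x0))%C with (Cconj (RtoC alpha * C_derive q x0))
    by (unfold Cconj; apply injective_projections; simpl; ring).
  replace (z0 * (C_derive Q x0 * d))%C with (C_derive Q x0 * (z0 * d))%C by ring. rewrite Em.
  rewrite RtoC_minus. ring. }
rewrite <- A3 in K.
pose proof (proj2 HQ x0 Rw0) as Cu. unfold curvature in Cu.
assert (K2 : 0 < fst (C_derive Q x0 * Cconj (RtoC alpha * C_derive Q x0
   + (C_derive Q x0 + x0 * C_derive (C_derive Q) x0)))%C).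
{ revert Cu. generalize (C_derive Q x0) (C_derive Q x0 + x0 * C_derive (C_derive Q) x0)%C.
  intros c e Ce. unfold Cconj in *. simpl in *. nra. }
revert K K2 Sup.
generalize (C_derive Q x0 * Cconj (RtoC alpha * C_derive Q x0
   + (C_derive Q x0 + x0 * C_derive (C_derive Q) x0)))%C.
generalize ((q x0 - q (w1 z0)) * Cconj (x0 * C_derive q x0))%C.
intros c e Ke Pe Pc. apply (f_equal fst) in Ke. simpl in Ke.
assert (L : alpha * alpha * fst c = (1 - m) * (Cmod x0 * Cmod x0) * fst e).
{ ring_simplify in Ke. ring_simplify. exact Ke. }
assert (0 < alpha * alpha * fst c) by (repeat apply Rmult_lt_0_compat; assumption).
assert (0 <= Cmod x0 * Cmod x0 * fst e) by (pose proof (Cmod_nonneg x0); nra).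
nra.
Qed.

(** A continuity method for [w = Q^(-1) o P]. On any disk on which [P] takes values of [Q] only,
    [lift_bound] gives [|w| <= |z|]. At an uncovered point of least modulus [sigma] the value of [P]
    would be a limit of values of [Q] on the compact disk [|x| <= sigma], hence covered. *)
Theorem averages_subordinate (alpha rad : R) (Q q P p : C -> C) : 0 < alpha -> 0 < rad ->
  convex_map rad Q -> convex_map rad q -> averages alpha rad Q q ->
  holo rad P -> averages alpha rad P p -> subordinate rad p q -> subordinate rad P Q.
Proof.
intros Ha Hrad HQ Hq AQ HP AP Hpq.
assert (Na : RtoC alpha <> 0%C) by (apply RtoC_neq_0; lra).
assert (R0 : Cmod 0 < rad) by (rewrite Cmod_0; exact Hrad).
assert (H0 : P 0%C = Q 0%C).
{ pose proof (AP 0%C R0) as A1. pose proof (AQ 0%C R0) as A2.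
  destruct Hpq as [w1 [_ [W1 [_ Ew1]]]]. rewrite (Ew1 0%C R0), W1 in A1.
  replace (P 0%C) with (/ RtoC alpha * (RtoC alpha * P 0%C + 0 * C_derive P 0%C))%C by (field;
    exact Na).
  rewrite A1, <- A2. field. exact Na. }
(* The value is arbitrary at points that are not [covered]. *)
pose (w := fun z => epsilon (inhabits (RtoC 0)) (fun x => Cmod x < rad /\ Q x = P z)).
pose (covered := fun z => exists x, Cmod x < rad /\ Q x = P z).
assert (Hw : forall z, covered z -> Cmod (w z) < rad /\ Q (w z) = P z).
{ intros z Hz. exact (epsilon_spec (inhabits (RtoC 0)) (fun x => Cmod x < rad /\ Q x = P z) Hz). }
assert (Step : forall sigma, sigma <= rad -> (forall z, Cmod z < sigma -> covered z) ->
  holo sigma w /\ forall z, Cmod z < sigma -> Cmod (w z) <= Cmod z).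
{ intros sigma Hs Hcov.
  assert (Dw : holo sigma w).
  { intros z Hz. eexists. apply (cder_of_lift rad Q P w z (sigma - Cmod z)); [exact HQ | lra | | |].
    - intros y Hy. pose proof (Cmod_triangle_rev y z). apply Hw, Hcov. lra.
    - apply (lift_cont rad Q P w z (sigma - Cmod z)); [exact HQ | lra | |].
      + intros y Hy. pose proof (Cmod_triangle_rev y z). apply Hw, Hcov. lra.
      + apply (holo_cont rad); [exact HP | lra].
    - apply (holo_C_derive rad); [exact HP | lra]. }
  split; [exact Dw|]. intros z Hz.
  apply (lift_bound alpha rad sigma Q q P p w z); auto. }
assert (All : forall z, Cmod z < rad -> covered z).
{ intros z1 Hz1. apply NNPP. intros Hbad.
  destruct (compact_min (fun z => Cmod z <= Cmod z1 /\ ~ covered z) Cmod (Cmod z1) 0)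
    as [z0 [[Lz0 Nz0] Hmin]].
  - intros z [H _]. exact H.
  - intros z Hz. destruct (Rle_dec (Cmod z) (Cmod z1)) as [L|L].
    + assert (Cz : covered z) by (apply NNPP; intros N; apply Hz; auto).
      destruct Cz as [x [Rx Ex]].
      destruct (convex_open_image rad ((Cmod x + rad) / 2) Q x HQ ltac:(lra) ltac:(lra)) as [d1
        [Hd1 H1]].
      destruct (holo_cont rad P HP z ltac:(lra) d1 Hd1) as [d2 [Hd2 H2]].
      exists d2. split; [exact Hd2|]. intros y Hy [_ Ny]. apply Ny.
      specialize (H2 y Hy). rewrite <- Ex in H2. destruct (H1 (P y) H2) as [x' [Rx' Ex']].
      exists x'. split; [lra | exact Ex'].
    + apply Rnot_le_lt in L. exists (Cmod z - Cmod z1). split; [lra|].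
      intros y Hy [Ly _]. pose proof (Cmod_triangle_rev z y) as T. rewrite Cmod_minus_sym in T. lra.
  - intros z _. apply cont_Cmod, cont_embed.
  - intros z _. apply Cmod_nonneg.
  - exists z1. split; [lra | exact Hbad].
  - set (sigma := Cmod z0) in *.
    assert (Cov : forall z, Cmod z < sigma -> covered z).
    { intros z Hz. apply NNPP. intros N. specialize (Hmin z ltac:(split; [lra | exact N])).
      fold sigma in Hmin. lra. }
    destruct (Step sigma ltac:(lra) Cov) as [_ Bw].
    assert (Ps : 0 < sigma).
    { apply Cmod_pos. intros E. apply Nz0. exists 0%C. split; [exact R0|]. rewrite E. symmetry.
        exact H0. }
    apply Nz0.
    (* If [P z0] had a positive distance [c] from the values of [Q] on this disk, then
       [|P z - P z0| >= c] for all [|z| < sigma], against continuity at [z0]. *)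
    destruct (compact_min (fun x => Cmod x <= sigma) (fun x => Cmod (Q x - P z0)) sigma 0)
      as [x0 [Lx0 Hx0]].
    + auto.
    + intros x Hx. apply Rnot_le_lt in Hx. exists (Cmod x - sigma). split; [lra|].
      intros y Hy L. pose proof (Cmod_triangle_rev x y) as T. rewrite Cmod_minus_sym in T. lra.
    + intros x Hx. apply cont_Cmod, cont_minus; [|apply cont_const].
      apply (holo_cont rad); [apply HQ | lra].
    + intros x _. apply Cmod_nonneg.
    + exists z0. apply Rle_refl.
    + exists x0. split; [lra|].
      destruct (Req_dec (Cmod (Q x0 - P z0)) 0) as [E|NE].
      { apply Cmod_eq_0 in E. replace (Q x0) with ((Q x0 - P z0) + P z0)%C by ring. rewrite E.
          ring. }
      exfalso. pose proof (Cmod_nonneg (Q x0 - P z0)%C).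
      set (c := Cmod (Q x0 - P z0)) in *.
      assert (NB : 0 <= Cmod (P z0 - P z0) - c / 2).
      { apply (nonneg_boundary rad sigma (fun z => Cmod (P z - P z0) - c / 2) z0);
          [| |fold sigma; lra|fold sigma; lra].
        - intros z Hz. apply cont_local with
            (f := fun z => (RtoC (Cmod (P z - P z0)) - RtoC (c / 2))%C) (eta := 1); [lra| |].
          + intros y _. symmetry. apply RtoC_minus.
          + apply cont_minus; [|apply cont_const]. apply cont_Cmod, cont_minus; [|apply cont_const].
            apply (holo_cont rad); assumption.
        - intros z Hz. destruct (Hw z (Cov z Hz)) as [_ <-].
          specialize (Hx0 (w z)). specialize (Bw z Hz). specialize (Hx0 ltac:(lra)). lra. }
      replace (P z0 - P z0)%C with (RtoC 0) in NB by ring. rewrite Cmod_0 in NB. lra. }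
destruct (Step rad (Rle_refl _) All) as [Dw Bw].
exists w. split; [exact Dw|]. split; [|split].
- apply Cmod_eq_0. specialize (Bw 0%C R0). rewrite Cmod_0 in Bw.
    pose proof (Cmod_nonneg (w 0%C)). lra.
- exact Bw.
- intros z Hz. symmetry. apply Hw, All, Hz.
Qed.

(** * The functions L_m *)

(* The branch at [t <= 0] is needed because [Rpower 0 c = 1]. *)
Definition power0 (c t : R) : R := if Rle_dec t 0 then 0 else Rpower t c.

Lemma power0_pos (c t : R) : 0 < t -> power0 c t = Rpower t c.
Proof. intros H. unfold power0. destruct (Rle_dec t 0); [lra | reflexivity]. Qed.

Lemma power0_nonpos (c t : R) : t <= 0 -> power0 c t = 0.
Proof. intros H. unfold power0. destruct (Rle_dec t 0); [reflexivity | lra]. Qed.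

Lemma power0_1 (c : R) : power0 c 1 = 1.
Proof. rewrite power0_pos by lra. unfold Rpower. rewrite ln_1, Rmult_0_r. apply exp_0. Qed.

Lemma power0_bounds (c t : R) : 0 < c -> t <= 1 -> 0 <= power0 c t <= 1.
Proof.
intros Hc Ht. unfold power0. destruct (Rle_dec t 0) as [L|L]; [lra|]. apply Rnot_le_lt in L.
unfold Rpower. split; [apply Rlt_le, exp_pos|]. rewrite <- exp_0.
destruct (Req_dec t 1) as [->|N]; [rewrite ln_1, Rmult_0_r; lra|].
assert (ln t < 0) by (rewrite <- ln_1; apply ln_increasing; lra).
apply Rlt_le, exp_increasing. nra.
Qed.

Lemma is_derive_Rpower (c t : R) : 0 < t -> is_derive (fun u => Rpower u c) t (c * Rpower t c / t).
Proof. intros H. unfold Rpower. auto_derive; [exact H | field; lra]. Qed.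

Lemma rder_power0 (c t : R) : 0 < t ->
  rder (fun u => RtoC (power0 c u)) t (RtoC (c * power0 c t / t)).
Proof.
intros H. apply rder_components. simpl. rewrite power0_pos by exact H. split.
- apply (is_derive_ext_loc (fun u => Rpower u c)); [|apply is_derive_Rpower, H].
  exists (mkposreal t H). intros u Hu. symmetry. apply power0_pos.
  assert (Hu' : Rabs (u - t) < t) by exact Hu. apply Rabs_def2 in Hu'. lra.
- apply (is_derive_const (K := R_AbsRing) (V := R_NormedModule)).
Qed.

Lemma rcont_power0 (c t : R) : 0 < c -> rcont (fun u => RtoC (power0 c u)) t.
Proof.
intros Hc. destruct (Rlt_dec 0 t) as [H|H]; [eapply der_cont, rder_power0, H|].
intros eps He. rewrite (power0_nonpos c t) by lra.
exists (Rpower eps (/ c)). split; [apply exp_pos|]. intros y Hy.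
rewrite <- RtoC_minus, Cmod_R in *. rewrite Rminus_0_r. apply Rabs_def2 in Hy.
destruct (Rle_dec y 0) as [L|L].
- rewrite power0_nonpos, Rabs_R0 by exact L. exact He.
- apply Rnot_le_lt in L. rewrite power0_pos by exact L. rewrite Rabs_pos_eq by (apply Rlt_le,
    exp_pos).
  replace eps with (Rpower (Rpower eps (/ c)) c).
  + apply Rlt_Rpower_l; [exact Hc | lra].
  + rewrite Rpower_mult. replace (/ c * c) with 1 by (field; lra). apply Rpower_1, He.
Qed.

(* [s = t^(1/alpha)] in [alpha int_0^1 s^(alpha-1) q(s z) ds], which makes the integral proper. *)
Definition average (alpha : R) (q : C -> C) (z : C) : C :=
  CInt (fun t => q (RtoC (power0 (/ alpha) t) * z)%C) 0 1.

Section Average.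

Context (alpha rad : R) (q : C -> C) (Ha : 0 < alpha) (Hq : holo rad q).

Let phi (t : R) : R := power0 (/ alpha) t.

Local Lemma phi_in (t : R) (z : C) : t <= 1 -> Cmod (RtoC (phi t) * z) <= Cmod z.
Proof. intros Ht. apply Cmod_scal_le, power0_bounds; [apply Rinv_0_lt_compat, Ha | exact Ht]. Qed.

Local Lemma phi_cont (t : R) : rcont (fun u => RtoC (phi u)) t.
Proof. apply rcont_power0, Rinv_0_lt_compat, Ha. Qed.

Lemma average_integrand_cont (z : C) (t : R) : Cmod z < rad -> t <= 1 ->
  rcont (fun t => q (RtoC (phi t) * z)%C) t.
Proof.
intros Hz Ht. apply (cont_comp RtoC q (fun t => RtoC (phi t) * z)%C).
- apply (holo_cont rad); [exact Hq|]. pose proof (phi_in t z Ht). lra.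
- apply cont_mult; [apply phi_cont | apply cont_const].
Qed.

Lemma average_contseg (z : C) : Cmod z < rad -> contseg (fun t => q (RtoC (phi t) * z)%C) 0 1.
Proof. intros Hz t Ht. rewrite Rmin01, Rmax01 in Ht. apply average_integrand_cont; [exact Hz
  | lra]. Qed.

Lemma average_der_contseg (z : C) : Cmod z < rad ->
  contseg (fun t => RtoC (phi t) * C_derive q (RtoC (phi t) * z))%C 0 1.
Proof.
intros Hz t Ht. rewrite Rmin01, Rmax01 in Ht. apply cont_mult; [apply phi_cont|].
apply (cont_comp RtoC (C_derive q) (fun t => RtoC (phi t) * z)%C).
- apply (holo_cont rad); [apply holo_derive, Hq|]. pose proof (phi_in t z ltac:(lra)). lra.
- apply cont_mult; [apply phi_cont | apply cont_const].
Qed.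

Lemma average_der (z : C) : Cmod z < rad -> cder (average alpha q) z
  (CInt (fun t => RtoC (phi t) * C_derive q (RtoC (phi t) * z))%C 0 1).
Proof.
intros Hz. pose proof (Cmod_nonneg z). set (rho := (Cmod z + rad) / 2).
destruct (Taylor_quadratic rad rho q Hq ltac:(unfold rho; lra)) as [M HM].
assert (Near : forall y, Cmod (y - z) < rho - Cmod z -> Cmod y <= rho).
{ intros y Hy. pose proof (Cmod_triangle_rev y z). lra. }
apply CInt_param_der with (M := Rmax 0 M) (eta := rho - Cmod z); [lra | unfold rho; lra | | |].
- intros y Hy. apply average_contseg. specialize (Near y Hy). unfold rho in *. lra.
- apply average_der_contseg, Hz.
- intros y t Hy Ht. fold (phi t).
  pose proof (power0_bounds (/ alpha) t (Rinv_0_lt_compat _ Ha) ltac:(lra)) as Hp.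
    fold (phi t) in Hp.
  specialize (HM (RtoC (phi t) * y)%C (RtoC (phi t) * z)%C).
  replace (RtoC (phi t) * y - RtoC (phi t) * z)%C with (RtoC (phi t) * (y - z))%C in HM by ring.
  pose proof (phi_in t y ltac:(lra)). pose proof (phi_in t z ltac:(lra)). specialize (Near y Hy).
  specialize (HM ltac:(lra) ltac:(unfold rho in *; lra)).
  replace (q (RtoC (phi t) * y) - q (RtoC (phi t) * z)
     - RtoC (phi t) * C_derive q (RtoC (phi t) * z) * (y - z))%C
   with (q (RtoC (phi t) * y) - q (RtoC (phi t) * z)
     - C_derive q (RtoC (phi t) * z) * (RtoC (phi t) * (y - z)))%C by ring.
  eapply Rle_trans; [exact HM|]. pose proof (Cmod_scal_le (phi t) (y - z)%C Hp).
  pose proof (Cmod_nonneg (RtoC (phi t) * (y - z))%C). pose proof (Cmod_nonneg (y - z)%C).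
  pose proof (Rmax_l 0 M). pose proof (Rmax_r 0 M).
  set (h := Cmod (RtoC (phi t) * (y - z))) in *.
  assert (h * h <= Cmod (y - z) * Cmod (y - z)) by nra.
  assert (0 <= h * h) by nra. nra.
Qed.

Lemma average_holo : holo rad (average alpha q).
Proof. intros z Hz. eexists. apply average_der, Hz. Qed.

(** With [phi(t) = t^(1/alpha)] the derivative of [t q(phi z)] is
    [q(phi z) + phi z q'(phi z) / alpha]; integration over [[0, 1]] gives the relation. *)
Lemma average_averages : averages alpha rad (average alpha q) q.
Proof.
intros z Hz. rewrite (cder_C_derive _ _ _ (average_der z Hz)).
assert (Na : RtoC alpha <> 0%C) by (apply RtoC_neq_0; lra).
assert (E : CInt (fun t => q (RtoC (phi t) * z) + / RtoC alpha * z *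
    (RtoC (phi t) * C_derive q (RtoC (phi t) * z)))%C 0 1 = q z).
{ rewrite (CInt_FTC (fun t => RtoC t * q (RtoC (phi t) * z))%C).
  - unfold phi at 1. rewrite power0_1. rewrite !Cmult_1_l. ring.
  - rewrite Rmin01, Rmax01. intros t Ht.
    destruct (Req_dec t 0) as [->|Nt].
    + eapply der_eq.
      2: { apply (der_mult_vanishing RtoC RtoC (fun t => q (RtoC (phi t) * z)%C) 0 1).
           - reflexivity.
           - apply der_embed.
           - apply average_integrand_cont; [exact Hz | lra]. }
      cbv beta. unfold phi. rewrite power0_nonpos by lra. ring.
    + eapply der_eq.
      2: { apply (der_mult RtoC RtoC (fun t => q (RtoC (phi t) * z)%C) t 1); [apply der_embed|].
           apply (der_comp RtoC q (fun t => RtoC (phi t) * z)%C).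
           - apply (holo_C_derive rad); [exact Hq|]. pose proof (phi_in t z ltac:(lra)). lra.
           - apply (der_mult RtoC (fun t => RtoC (phi t)) (fun _ => z) t); [|apply der_const].
             apply rder_power0. lra. }
      cbv beta. fold (phi t).
      assert (RtoC t <> 0%C) by (apply RtoC_neq_0, Nt).
      rewrite RtoC_div, RtoC_mult, RtoC_inv by lra. field. auto.
  - apply contseg_plus; [apply average_contseg, Hz|].
    apply contseg_scal, average_der_contseg, Hz. }
rewrite CInt_plus, CInt_scal in E.
- rewrite <- E. unfold average.
  change (CInt (fun t => q (RtoC (power0 (/ alpha) t) * z)%C) 0 1)
    with (CInt (fun t => q (RtoC (phi t) * z)%C) 0 1). field. exact Na.
- apply average_der_contseg, Hz.
- apply average_contseg, Hz.
- apply contseg_scal, average_der_contseg, Hz.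
Qed.

End Average.

(** By the averaging relation [s^alpha Q(s z) / alpha] is a primitive of the integrand. It is
    continuous at [0] with value [0], so the improper integral converges although the integrand need
    not be bounded. *)
Lemma averages_is_RInt_gen (alpha rad : R) (Q q : C -> C) (z : C) : 0 < alpha ->
  holo rad Q -> cont_disk rad q -> averages alpha rad Q q -> Cmod z < rad ->
  is_RInt_gen (V := C_R_NormedModule)
    (fun s : R => (RtoC (Rpower s (alpha - 1)) * q (s * z))%C)
    (at_right 0) (at_point 1) (Q z / RtoC alpha)%C.
Proof.
intros Ha HQ Cq HA Hz.
assert (Na : RtoC alpha <> 0%C) by (apply RtoC_neq_0; lra).
assert (In : forall s, 0 <= s <= 1 -> Cmod (RtoC s * z) < rad).
{ intros s Hs. pose proof (Cmod_scal_le s z Hs). lra. }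
pose (K := fun s => (RtoC (power0 alpha s) * Q (RtoC s * z) * / RtoC alpha)%C).
pose (k := fun s => (RtoC (Rpower s (alpha - 1)) * q (RtoC s * z))%C).
assert (Cray : forall s, rcont (fun s => RtoC s * z)%C s).
{ intros s. apply cont_mult; [apply cont_embed | apply cont_const]. }
assert (DK : forall s, 0 < s <= 1 -> rder K s (k s)).
{ intros s Hs. assert (Ns : RtoC s <> 0%C) by (apply RtoC_neq_0; lra).
  eapply der_eq.
  2: { apply (der_mult RtoC (fun s => RtoC (power0 alpha s) * Q (RtoC s
    * z))%C (fun _ => / RtoC alpha)%C);
       [|apply der_const].
       apply (der_mult RtoC (fun s => RtoC (power0 alpha s)) (fun s => Q (RtoC s * z)%C));
       [apply rder_power0; lra|]. apply (rder_ray Q), (holo_C_derive rad); [exact HQ | apply In;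
         lra]. }
  cbv beta. unfold k.
  replace (Rpower s (alpha - 1)) with (power0 alpha s / s).
  2: { rewrite power0_pos by lra. unfold Rminus. rewrite Rpower_plus, Rpower_Ropp,
    Rpower_1 by lra. reflexivity. }
  replace (q (RtoC s * z)%C) with ((RtoC alpha * Q (RtoC s * z) + RtoC s * z
    * C_derive Q (RtoC s * z)) / RtoC alpha)%C.
  2: { rewrite HA by (apply In; lra). field. exact Na. }
  rewrite !RtoC_div, RtoC_mult by lra. field. auto. }
assert (Ck : forall s, 0 < s <= 1 -> rcont k s).
{ intros s Hs. apply cont_mult.
  - apply cont_local with (f := fun s => RtoC (power0 (alpha - 1) s)) (eta := s); [lra| |].
    + intros y Hy. rewrite <- RtoC_minus, Cmod_R in Hy. apply Rabs_def2 in Hy.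
      rewrite power0_pos by lra. reflexivity.
    + eapply der_cont, rder_power0. lra.
  - apply (cont_comp RtoC q); [apply Cq, In; lra | apply Cray]. }
assert (CK : rcont K 0).
{ apply cont_mult; [|apply cont_const]. apply cont_mult; [apply rcont_power0, Ha|].
  apply (cont_comp RtoC Q (fun s => RtoC s * z)%C); [apply (holo_cont rad); [exact HQ | apply In;
    lra] | apply Cray]. }
assert (K0 : K 0 = 0%C) by (unfold K; rewrite power0_nonpos by lra; ring).
assert (K1 : K 1 = (Q z / RtoC alpha)%C) by (unfold K; rewrite power0_1, !Cmult_1_l; reflexivity).
assert (Int : forall e, 0 < e < 1 -> is_RInt (V := C_R_NormedModule) k e 1 (K 1 - K e)%C).
{ intros e He.
  assert (Seg : forall s, Rmin e 1 <= s <= Rmax e 1 -> 0 < s <= 1).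
  { intros s. rewrite Rmin_left, Rmax_right by lra. lra. }
  apply (is_RInt_fct_extend_pair (U := R_NormedModule) (V := R_NormedModule) k e 1).
  - apply (is_RInt_derive (V := R_CompleteNormedModule) (fun s => fst (K s)) (fun s => fst (k s))).
    + intros s Hs. apply is_derive_fst, DK, Seg, Hs.
    + intros s Hs. apply rcont_fst, Ck, Seg, Hs.
  - apply (is_RInt_derive (V := R_CompleteNormedModule) (fun s => snd (K s)) (fun s => snd (k s))).
    + intros s Hs. apply (proj1 (rder_components K s (k s))), DK, Seg, Hs.
    + intros s Hs. apply rcont_snd, Ck, Seg, Hs. }
intros U [eps HU].
destruct (CK (eps)) as [d [Hd Hc]]; [apply cond_pos|]. rewrite K0 in Hc.
apply (Filter_prod _ _ _ (fun e => 0 < e < Rmin d 1) (fun y => y = 1)).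
- assert (Hd1 : 0 < Rmin d 1) by (apply Rmin_glb_lt; lra).
  exists (mkposreal _ Hd1). intros y Hy Hy0. split; [exact Hy0|].
  assert (Hy' : Rabs (y - 0) < Rmin d 1) by exact Hy. apply Rabs_def2 in Hy'. lra.
- reflexivity.
- intros e y He ->. exists (K 1 - K e)%C. cbn [fst snd].
  assert (E1 : e < d) by (eapply Rlt_le_trans; [apply He | apply Rmin_l]).
  assert (E2 : e < 1) by (eapply Rlt_le_trans; [apply He | apply Rmin_r]).
  split; [apply Int; lra|]. apply HU. rewrite K1.
  specialize (Hc e). rewrite <- RtoC_minus, Cmod_R, Rminus_0_r, Rabs_pos_eq in Hc by lra.
  specialize (Hc E1). replace (K e - 0)%C with (K e) in Hc by ring.
  pose proof (Re_le_Cmod (K e)). pose proof (Im_le_Cmod (K e)).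
  split.
  + change (Rabs (fst (Q z / RtoC alpha - K e)%C - fst (Q z / RtoC alpha)%C) < eps).
    change (Rabs (fst (Q z / RtoC alpha)%C + - fst (K e) - fst (Q z / RtoC alpha)%C) < eps).
    replace (fst (Q z / RtoC alpha)%C + - fst (K e) - fst (Q z / RtoC alpha)%C)
      with (- fst (K e)) by ring.
    rewrite Rabs_Ropp. lra.
  + change (Rabs (snd (Q z / RtoC alpha)%C + - snd (K e) - snd (Q z / RtoC alpha)%C) < eps).
    replace (snd (Q z / RtoC alpha)%C + - snd (K e) - snd (Q z / RtoC alpha)%C)
      with (- snd (K e)) by ring.
    rewrite Rabs_Ropp. lra.
Qed.

Lemma holo_ext (rad : R) (f g : C -> C) : (forall z, Cmod z < rad -> f z = g z) -> holo rad f ->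
  holo rad g.
Proof.
intros E H z Hz. destruct (H z Hz) as [d Hd]. exists d.
apply der_local with (f := f) (eta := rad - Cmod z); [lra| |exact Hd].
intros y Hy. pose proof (Cmod_triangle_rev y z). apply E. lra.
Qed.

Lemma C_derive_ext_disk (rad : R) (f g : C -> C) (z : C) : (forall z, Cmod z < rad -> f z = g z) ->
  holo rad f -> Cmod z < rad -> C_derive g z = C_derive f z.
Proof.
intros E H Hz. apply cder_C_derive.
apply der_local with (f := f) (eta := rad - Cmod z); [lra| |apply (holo_C_derive rad); assumption].
intros y Hy. pose proof (Cmod_triangle_rev y z). apply E. lra.
Qed.

Lemma Lfun_S (alpha a b : R) (m : nat) (z : C) : 0 < alpha -> holo 1 (Lfun alpha a b m) ->
  Cmod z < 1 -> Lfun alpha a b (S m) z = average alpha (Lfun alpha a b m) z.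
Proof.
intros Ha Hm Hz. cbn [Lfun].
rewrite (is_RInt_gen_unique (V := C_R_CompleteNormedModule) _
  (average alpha (Lfun alpha a b m) z / RtoC alpha)%C).
- field. apply RtoC_neq_0. lra.
- apply (averages_is_RInt_gen alpha 1); auto.
  + apply average_holo; assumption.
  + apply holo_cont, Hm.
  + apply average_averages; assumption.
Qed.

(** * Janowski maps *)

Lemma one_plus_neq_0 (b : R) (z : C) : -1 <= b <= 1 -> Cmod z < 1 -> (1 + RtoC b * z)%C <> 0%C.
Proof.
intros Hb Hz. replace (1 + RtoC b * z)%C with (1 - (- RtoC b * z))%C by ring.
apply sub_neq_0. rewrite Cmod_mult, Cmod_opp, Cmod_R, Cmod_1.
assert (Rabs b <= 1) by (apply Rabs_le; lra). pose proof (Cmod_nonneg z).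
  pose proof (Rabs_pos b). nra.
Qed.

Lemma cder_affine (c d z : C) : cder (fun z => c + d * z)%C z d.
Proof.
eapply der_eq; [|apply der_plus; [apply der_const | apply der_scal, der_embed]]. ring.
Qed.

Section Janowski.

Context (a b : R) (hab : -1 <= b /\ b < a /\ a <= 1).

Lemma janowski_cder (z : C) : Cmod z < 1 ->
  cder (janowski_map a b) z (RtoC (a - b) / ((1 + RtoC b * z) * (1 + RtoC b * z)))%C.
Proof.
intros Hz. assert (N : (1 + RtoC b * z)%C <> 0%C) by (apply one_plus_neq_0; lra).
eapply der_eq; [|apply (der_div _ (fun z => 1 + RtoC a * z)%C (fun z => 1 + RtoC b
  * z)%C z (RtoC a) (RtoC b));
  [exact N | apply cder_affine | apply cder_affine]].
cbv beta. rewrite RtoC_minus. field. exact N.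
Qed.

Lemma janowski_holo : holo 1 (janowski_map a b).
Proof. intros z Hz. eexists. apply janowski_cder, Hz. Qed.

Lemma janowski_cder2 (z : C) : Cmod z < 1 -> cder (C_derive (janowski_map a b)) z
  (- 2 * RtoC b * RtoC (a - b) / ((1 + RtoC b * z) * (1 + RtoC b * z) * (1 + RtoC b * z)))%C.
Proof.
intros Hz. assert (N : (1 + RtoC b * z)%C <> 0%C) by (apply one_plus_neq_0; lra).
apply der_local with (f := fun z => (RtoC (a - b) / ((1 + RtoC b * z) * (1 + RtoC b * z)))%C)
  (eta := 1 - Cmod z); [lra| |].
- intros y Hy. pose proof (Cmod_triangle_rev y z). symmetry.
  apply cder_C_derive, janowski_cder. lra.
- eapply der_eq; [|apply (der_div _ (fun _ => RtoC (a - b)) (fun z => (1 + RtoC b * z) * (1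
    + RtoC b * z))%C z 0
     (RtoC b * (1 + RtoC b * z) + (1 + RtoC b * z) * RtoC b)%C)].
  + cbv beta. replace (RtoC 2) with (1 + 1)%C by (rewrite <- RtoC_plus; f_equal; ring).
    field. exact N.
  + apply Cmult_neq_0; exact N.
  + apply der_const.
  + apply (der_mult _ (fun z => 1 + RtoC b * z)%C (fun z => 1 + RtoC b * z)%C); apply cder_affine.
Qed.

(** Here [1 + z Q'' / Q' = (1 - b z) / (1 + b z)], whose real part has the sign of
    [1 - b^2 |z|^2]. *)
Lemma janowski_convex : convex_map 1 (janowski_map a b).
Proof.
split; [exact janowski_holo|]. intros z Hz.
assert (N : (1 + RtoC b * z)%C <> 0%C) by (apply one_plus_neq_0; lra).
assert (Nab : RtoC (a - b) <> 0%C) by (apply RtoC_neq_0; lra).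
unfold curvature.
rewrite (cder_C_derive _ _ _ (janowski_cder2 z Hz)), (cder_C_derive _ _ _ (janowski_cder z Hz)).
apply Re_div_pos.
{ intros E. apply Nab.
  replace (RtoC (a - b)) with (RtoC (a - b) / ((1 + RtoC b * z) * (1 + RtoC b * z))
    * ((1 + RtoC b * z) * (1 + RtoC b * z)))%C by (field; exact N).
  rewrite E. ring. }
match goal with |- 0 < fst ?e => replace e with ((1 - RtoC b * z) / (1 + RtoC b * z))%C end.
2: { replace (RtoC 2) with (1 + 1)%C by (rewrite <- RtoC_plus; f_equal; ring).
     field. auto. }
apply Re_div_pos; [exact N|].
pose proof (Cmod_sqr z) as S. pose proof (Cmod_nonneg z). destruct z as [x y].
unfold Cconj. simpl in *.
assert (b * b <= 1) by nra.
assert (x * x + y * y < 1) by nra. nra.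
Qed.

Lemma janowski_Re_pos (z : C) : Cmod z < 1 -> 0 < fst (janowski_map a b z).
Proof.
intros Hz. apply Re_div_pos; [apply one_plus_neq_0; lra|].
pose proof (Cmod_sqr z) as S. pose proof (Cmod_nonneg z). pose proof (Re_le_Cmod z) as Rz.
apply Rabs_le_between in Rz. set (rho := Cmod z) in *. clearbody rho. destruct z as [x y].
unfold Cconj. simpl in *.
replace ((1 + (a * x - 0 * y)) * (1 + (b * x - 0 * y)) - (0 + (a * y + 0 * x)) * - (0 + (b * y
  + 0 * x)))
  with (1 + a * b * (rho * rho) + (a + b) * x) by (rewrite S; ring).
assert (Pm : forall c, -1 <= c <= 1 -> 0 < 1 - c * rho /\ 0 < 1 + c * rho) by (intros c Hc; nra).
destruct (Pm a ltac:(lra)) as [A1 A2]. destruct (Pm b ltac:(lra)) as [B1 B2].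
(* The expression is affine in [x]. Its least value on [[-rho, rho]] is at an end point, where it
   factors as [(1 - a rho) (1 - b rho)] or [(1 + a rho) (1 + b rho)]. *)
destruct (Rle_dec 0 (a + b)).
- assert (0 < (1 - a * rho) * (1 - b * rho)) by (apply Rmult_lt_0_compat; assumption). nra.
- assert (0 < (1 + a * rho) * (1 + b * rho)) by (apply Rmult_lt_0_compat; assumption). nra.
Qed.

End Janowski.

(** * Symmetry and monotonicity in the angle *)

Lemma Cconj_mult (z w : C) : Cconj (z * w) = (Cconj z * Cconj w)%C.
Proof. unfold Cconj. apply injective_projections; simpl; ring. Qed.

Definition real_symmetric (q : C -> C) : Prop :=
  forall z, Cmod z < 1 -> q (Cconj z) = Cconj (q z).

(** For [s = t] this is the monotonicity of [|q|^2]. The radii are independent because an average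
    evaluates each factor at its own smaller radius. *)
Definition angular_nonincreasing (q : C -> C) : Prop :=
  forall s t th1 th2, 0 <= s < 1 -> 0 <= t < 1 -> 0 <= th1 <= th2 -> th2 <= PI ->
    fst (q (polar s th2) * Cconj (q (polar t th2)))%C
    <= fst (q (polar s th1) * Cconj (q (polar t th1)))%C.

Lemma janowski_symmetric (a b : R) : real_symmetric (janowski_map a b).
Proof.
intros z _. unfold janowski_map, Cdiv. 
assert (I : forall x, Cconj (/ x) = (/ Cconj x)%C).
{ intros [x y]. unfold Cconj, Cinv. apply injective_projections; simpl;
    replace (x * (x * 1) + - y * (- y * 1)) with (x * (x * 1) + y * (y * 1)) by ring;
      unfold Rdiv; ring. }
replace (Cconj ((1 + RtoC a * z) * / (1 + RtoC b * z)))%C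
  with (Cconj (1 + RtoC a * z) * Cconj (/ (1 + RtoC b * z)))%C
  by (symmetry; apply Cconj_mult).
rewrite I. f_equal; [|f_equal]; unfold Cconj; apply injective_projections; simpl; ring.
Qed.

Definition mobius_Re (b s c : R) : R := (s * c + b * s * s) / (1 + 2 * b * s * c + b * b * s * s).

Lemma mobius_den_pos (b s c : R) : -1 <= b <= 1 -> 0 <= s < 1 -> -1 <= c <= 1 ->
  0 < 1 + 2 * b * s * c + b * b * s * s.
Proof.
intros Hb Hs Hc.
assert (-1 < b * s < 1) by nra. set (x := b * s) in *.
replace (1 + 2 * b * s * c + b * b * s * s) with (1 + 2 * x * c + x * x) by (unfold x; ring).
clearbody x. destruct (Rle_dec 0 x).
- assert (0 < (1 - x) * (1 - x)) by nra. nra.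
- assert (0 < (1 + x) * (1 + x)) by nra. nra.
Qed.

Lemma mobius_Re_mono (b s c c' : R) : -1 <= b <= 1 -> 0 <= s < 1 -> -1 <= c -> c <= c' -> c' <= 1 ->
  mobius_Re b s c <= mobius_Re b s c'.
Proof.
intros Hb Hs H1 H2 H3. unfold mobius_Re.
pose proof (mobius_den_pos b s c Hb Hs ltac:(lra)) as D1.
pose proof (mobius_den_pos b s c' Hb Hs ltac:(lra)) as D2.
apply Rmult_le_reg_r with ((1 + 2 * b * s * c + b * b * s * s) * (1 + 2 * b * s * c' + b * b
  * s * s));
  [apply Rmult_lt_0_compat; assumption|].
field_simplify; [|lra|lra].
(* With the denominators cleared, the difference of the two sides is exactly this product. *)
assert (0 <= s * (c' - c) * (1 - b * b * (s * s))).
{ repeat apply Rmult_le_pos; try lra. assert (b * b <= 1) by nra. assert (0 <= s * s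
    <= 1) by nra. nra. }
nra.
Qed.

(* [mobius_Re b s c] is [Re (s e / (1 + b s e))] for [e = (c, d)].  Only these two terms depend on
   [c], with a nonnegative coefficient, and they increase with [c]. *)
Lemma janowski_product (a b s t c d : R) : -1 <= b <= 1 -> 0 <= s < 1 -> 0 <= t < 1 -> c * c
  + d * d = 1 ->
  fst (janowski_map a b ((s * c)%R, (s * d)%R) * Cconj (janowski_map a b ((t * c)%R, (t * d)%R)))%C
  = 1 + (a - b) * (a - b) * s * t / (1 - b * b * s * t)
    + (a - b) * (1 - a * b * s * t) / (1 - b * b * s * t) * (mobius_Re b s c + mobius_Re b t c).
Proof.
intros Hb Hs Ht Hcd.
assert (Hc : -1 <= c <= 1) by nra.
pose proof (mobius_den_pos b s c Hb Hs Hc) as Ds.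
pose proof (mobius_den_pos b t c Hb Ht Hc) as Dt.
assert (Dd : 0 < 1 - b * b * s * t).
{ assert (b * b <= 1) by nra. assert (0 <= s * t < 1) by nra. nra. }
assert (Es : forall u, (1 + b * (u * c)) * (1 + b * (u * c)) + b * (u * d) * (b * (u * d))
   = 1 + 2 * b * u * c + b * b * u * u).
{ intros u. replace (b * (u * d) * (b * (u * d))) with (b * b * u * u * (d * d)) by ring.
  replace (d * d) with (1 - c * c) by lra. ring. }
assert (J : forall u, 0 < 1 + 2 * b * u * c + b * b * u * u ->
  janowski_map a b ((u * c)%R, (u * d)%R) =
   (((1 + a * (u * c)) * (1 + b * (u * c)) + a * (u * d) * (b * (u * d))) / (1 + 2 * b * u * c
     + b * b * u * u),
    ((a - b) * (u * d)) / (1 + 2 * b * u * c + b * b * u * u))).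
{ intros u Du. unfold janowski_map, Cdiv, Cinv. apply injective_projections; simpl.
  - replace ((1 + (b * (u * c) - 0 * (u * d))) * ((1 + (b * (u * c) - 0 * (u * d))) * 1) +
       (0 + (b * (u * d) + 0 * (u * c))) * ((0 + (b * (u * d) + 0 * (u * c))) * 1))
      with (1 + 2 * b * u * c + b * b * u * u) by (rewrite <- Es; ring). field. lra.
  - replace ((1 + (b * (u * c) - 0 * (u * d))) * ((1 + (b * (u * c) - 0 * (u * d))) * 1) +
       (0 + (b * (u * d) + 0 * (u * c))) * ((0 + (b * (u * d) + 0 * (u * c))) * 1))
      with (1 + 2 * b * u * c + b * b * u * u) by (rewrite <- Es; ring). field. lra. }
rewrite (J s Ds), (J t Dt). unfold mobius_Re, Cconj. simpl.
replace (a * (s * d) * (b * (s * d))) with (a * b * (s * s) * (d * d)) by ring.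
replace (a * (t * d) * (b * (t * d))) with (a * b * (t * t) * (d * d)) by ring.
replace ((a - b) * (s * d) / (1 + 2 * b * s * c + b * b * s * s) *
 - ((a - b) * (t * d) / (1 + 2 * b * t * c + b * b * t * t))) with
  (- ((a - b) * (a - b) * s * t * (d * d) / (1 + 2 * b * s * c + b * b * s * s) / (1 + 2 * b
    * t * c + b * b * t * t)))
  by (field; lra).
replace (d * d) with (1 - c * c) by lra.
field. lra.
Qed.

Lemma janowski_angular (a b : R) : -1 <= b /\ b < a /\ a <= 1 ->
  angular_nonincreasing (janowski_map a b).
Proof.
intros hab s t th1 th2 Hs Ht Hth Hpi. unfold polar.
assert (SC : forall x, cos x * cos x + sin x * sin x = 1).
{ intros x. pose proof (sin2_cos2 x) as H. unfold Rsqr in H. lra. }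
rewrite !janowski_product by (try lra; apply SC).
assert (Cd : cos th2 <= cos th1) by (apply cos_decr_1; lra).
pose proof (COS_bound th1). pose proof (COS_bound th2).
pose proof (mobius_Re_mono b s (cos th2) (cos th1) ltac:(lra) Hs ltac:(lra) Cd ltac:(lra)).
pose proof (mobius_Re_mono b t (cos th2) (cos th1) ltac:(lra) Ht ltac:(lra) Cd ltac:(lra)).
apply Rplus_le_compat_l. apply Rmult_le_compat_l; [|lra].
assert (0 <= s * t < 1) by nra. assert (b * b <= 1) by nra. assert (a * b <= 1) by nra.
apply Rdiv_le_0_compat; [|nra]. apply Rmult_le_pos; [lra | nra].
Qed.

Lemma CInt_fst (g : R -> C) (u v : R) : fst (CInt g u v) = RInt (fun t => fst (g t)) u v.
Proof. reflexivity. Qed.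

Lemma RInt_le_cont (f g : R -> C) (u v : R) : u <= v -> contseg f u v -> contseg g u v ->
  (forall t, u <= t <= v -> fst (f t) <= fst (g t)) -> fst (CInt f u v) <= fst (CInt g u v).
Proof.
intros Huv Hf Hg H. rewrite !CInt_fst. apply RInt_le; [exact Huv | apply contseg_ex_Re, Hf
  | apply contseg_ex_Re, Hg|].
intros t Ht. apply H. lra.
Qed.

Lemma fst_mult_conj_sym (z w : C) : fst (z * Cconj w)%C = fst (w * Cconj z)%C.
Proof. unfold Cconj. simpl. ring. Qed.

Lemma polar_scal (u s th : R) : (RtoC u * polar s th)%C = polar (u * s) th.
Proof. unfold polar. apply injective_projections; simpl; ring. Qed.

Section AverageProperties.

Context (alpha : R) (q : C -> C) (Ha : 0 < alpha) (Hq : holo 1 q).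

Let phi (t : R) : R := power0 (/ alpha) t.

Local Lemma phi_bounds (t : R) : t <= 1 -> 0 <= phi t <= 1.
Proof. apply power0_bounds, Rinv_0_lt_compat, Ha. Qed.

Local Lemma average_polar_contseg (s th : R) : 0 <= s < 1 ->
  contseg (fun t => q (RtoC (phi t) * polar s th)%C) 0 1.
Proof. intros Hs. apply (average_contseg alpha 1 q Ha Hq). rewrite Cmod_polar; lra. Qed.

Local Lemma average_mult (s th : R) (c : C) : 0 <= s < 1 ->
  (average alpha q (polar s th) * c)%C = CInt (fun t => c * q (polar (phi t * s) th))%C 0 1.
Proof.
intros Hs. rewrite (CInt_ext _ (fun t => c * q (RtoC (phi t) * polar s th))%C)
  by (intros t _; rewrite polar_scal; reflexivity).
rewrite CInt_scal by (apply average_polar_contseg, Hs). unfold average. fold phi. unfold phi. ring.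
Qed.

Local Lemma average_mult_contseg (s th : R) (c : C) : 0 <= s < 1 ->
  contseg (fun t => c * q (polar (phi t * s) th))%C 0 1.
Proof.
intros Hs t Ht. apply cont_local with (f := fun t => (c * q (RtoC (phi t)
  * polar s th))%C) (eta := 1); [lra| |].
- intros y _. rewrite polar_scal. reflexivity.
- revert t Ht. apply contseg_scal, average_polar_contseg, Hs.
Qed.

(** The form is averaged one factor at a time. [average_angular] treats the second factor by
    exchanging the two, which leaves the real part unchanged. *)
Lemma average_half_angular (s t th1 th2 : R) : angular_nonincreasing q ->
  0 <= s < 1 -> 0 <= t < 1 -> 0 <= th1 <= th2 -> th2 <= PI ->
  fst (average alpha q (polar s th2) * Cconj (q (polar t th2)))%C
  <= fst (average alpha q (polar s th1) * Cconj (q (polar t th1)))%C.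
Proof.
intros H Hs Ht Hth Hpi. rewrite !average_mult by exact Hs.
apply RInt_le_cont; [lra | apply average_mult_contseg, Hs | apply average_mult_contseg, Hs|].
intros u Hu. pose proof (phi_bounds u ltac:(lra)).
rewrite (Cmult_comm (Cconj _)), (Cmult_comm (Cconj (q (polar t th1)))). apply H; auto. nra.
Qed.

Lemma average_angular : angular_nonincreasing q -> angular_nonincreasing (average alpha q).
Proof.
intros H s t th1 th2 Hs Ht Hth Hpi.
rewrite !(fun x => fst_mult_conj_sym (average alpha q (polar s x))).
rewrite !average_mult by exact Ht.
apply RInt_le_cont; [lra | apply average_mult_contseg, Ht | apply average_mult_contseg, Ht|].
intros u Hu. pose proof (phi_bounds u ltac:(lra)).
rewrite (Cmult_comm (Cconj _)), (Cmult_comm (Cconj (average alpha q (polar s th1)))).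
rewrite !(fun x => fst_mult_conj_sym (q (polar (phi u * t) x))).
apply average_half_angular; auto. nra.
Qed.

Lemma average_Re_pos (z : C) : (forall z, Cmod z < 1 -> 0 < fst (q z)) -> Cmod z < 1 ->
  0 < fst (average alpha q z).
Proof.
intros H Hz. unfold average. rewrite CInt_fst. apply RInt_gt_0; [lra| |].
- intros t Ht. apply H. fold (phi t).
  pose proof (Cmod_scal_le (phi t) z (phi_bounds t ltac:(lra))). lra.
- intros t Ht. apply rcont_fst. apply (average_contseg alpha 1 q Ha Hq z Hz).
  rewrite Rmin01, Rmax01. lra.
Qed.

Lemma average_symmetric : real_symmetric q -> real_symmetric (average alpha q).
Proof.
intros H z Hz. unfold average.
rewrite (CInt_ext _ (fun t => Cconj (q (RtoC (power0 (/ alpha) t) * z)%C))).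
2: { rewrite Rmin01, Rmax01. intros t Ht. fold (phi t). rewrite <- H.
     - rewrite Cconj_mult. f_equal. f_equal. unfold Cconj. apply injective_projections; simpl; ring.
     - pose proof (Cmod_scal_le (phi t) z (phi_bounds t ltac:(lra))). lra. }
unfold CInt, Cconj. apply injective_projections; cbn [fst snd]; [reflexivity|].
apply (RInt_opp (V := R_CompleteNormedModule)), contseg_ex_Im,
  (average_contseg alpha 1 q Ha Hq z Hz).
Qed.

End AverageProperties.

(** The properties that pass from [L_m] to [L_(m+1)]. Convexity serves the subordination, the
    positive real part serves the Koebe lift and, with the value at [0], the logarithm; the last two
    serve the ordering of the integrands in the angle. *)
Record extremal_profile (q : C -> C) : Prop := {
  profile_convex : convex_map 1 q;
  profile_0 : q 0%C = 1%C;
  profile_Re_pos : forall z, Cmod z < 1 -> 0 < fst (q z);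
  profile_symmetric : real_symmetric q;
  profile_angular : angular_nonincreasing q
}.

Lemma curvature_ext (rad : R) (f g : C -> C) (z : C) : (forall z, Cmod z < rad -> f z = g z) ->
  holo rad f -> Cmod z < rad -> curvature g z = curvature f z.
Proof.
intros E H Hz. unfold curvature.
rewrite (C_derive_ext_disk rad f g z E H Hz).
rewrite (C_derive_ext_disk rad (C_derive f) (C_derive g) z); [reflexivity| |apply holo_derive,
  H|exact Hz].
intros y Hy. symmetry. apply (C_derive_ext_disk rad f g y E H Hy).
Qed.

Theorem Lfun_profile (alpha a b : R) (m : nat) : 0 < alpha -> -1 <= b /\ b < a /\ a <= 1 ->
  extremal_profile (Lfun alpha a b m).
Proof.
intros Ha hab. induction m as [|m IH].
- split.
  + apply janowski_convex, hab.
  + unfold Lfun, janowski_map, Cdiv. rewrite !Cmult_0_r, !Cplus_0_r. apply Cinv_r, RtoC_neq_0. lra.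
  + apply janowski_Re_pos, hab.
  + apply janowski_symmetric.
  + apply janowski_angular, hab.
- destruct IH as [Cq q0 Rq Sq Aq]. set (q := Lfun alpha a b m) in *.
  assert (E : forall z, Cmod z < 1 -> average alpha q z = Lfun alpha a b (S m) z).
  { intros z Hz. symmetry. apply Lfun_S; [exact Ha | apply Cq | exact Hz]. }
  pose proof (average_holo alpha 1 q Ha (proj1 Cq)) as Hh.
  pose proof (average_averages alpha 1 q Ha (proj1 Cq)) as HA.
  assert (Cc : forall z, Cmod z < 1 -> Cmod (Cconj z) < 1) by (intros z Hz; rewrite Cmod_Cconj;
    exact Hz).
  assert (Z0 : Cmod 0 < 1) by (rewrite Cmod_0; lra).
  split.
  + pose proof (averages_convex alpha 1 _ q Ha Rlt_0_1 Hh Cq HA) as [_ Hc].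
    split; [apply (holo_ext 1 (average alpha q)); assumption|].
    intros z Hz. rewrite (curvature_ext 1 _ _ z E Hh Hz). apply Hc, Hz.
  + rewrite <- E by exact Z0. unfold average. rewrite (CInt_ext _ (fun _ => 1%C)).
    * rewrite CInt_const, Cmult_1_r. f_equal. ring.
    * intros t _. rewrite Cmult_0_r. exact q0.
  + intros z Hz. rewrite <- E by exact Hz. apply average_Re_pos; auto. apply Cq.
  + intros z Hz. rewrite <- !E by auto. apply average_symmetric; auto. apply Cq.
  + intros s t th1 th2 Hs Ht Hth Hpi.
    rewrite <- !E by (rewrite Cmod_polar; lra).
    apply average_angular; auto. apply Cq.
Qed.

Lemma Lfun_averages (alpha a b : R) (m : nat) : 0 < alpha -> -1 <= b /\ b < a /\ a <= 1 ->
  averages alpha 1 (Lfun alpha a b (S m)) (Lfun alpha a b m).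
Proof.
intros Ha hab. pose proof (profile_convex _ (Lfun_profile alpha a b m Ha hab)) as [Hq _].
assert (E : forall z, Cmod z < 1 -> average alpha (Lfun alpha a b m) z = Lfun alpha a b (S m) z).
{ intros z Hz. symmetry. apply Lfun_S; assumption. }
intros z Hz. rewrite (C_derive_ext_disk 1 _ _ z E (average_holo alpha 1 _ Ha Hq) Hz),
  <- E by exact Hz.
apply (average_averages alpha 1); assumption.
Qed.

(** * The class T_n and the Koebe function *)

Lemma analytic_disk_holo (f : C -> C) : analytic_disk f -> holo 1 f.
Proof. intros H z Hz. destruct (H z Hz) as [d Hd]. exists d. apply cder_is_derive, Hd. Qed.

(** The bound is given on the open disk only, so Schwarz's lemma is applied for [r < 1]. A violation
    at [z] would already show for some such [r]. *)
Lemma Schwarz_unit_disk (w : C -> C) : holo 1 w -> w 0%C = 0%C ->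
  (forall z, Cmod z < 1 -> Cmod (w z) < 1) -> forall z, Cmod z < 1 -> Cmod (w z) <= Cmod z.
Proof.
intros Hw W0 H z Hz. apply Rnot_lt_le. intros L. pose proof (Cmod_nonneg z).
assert (B : forall r, Cmod z < r < 1 -> Cmod (w z) * r <= Cmod z).
{ intros r Hr.
  pose proof (Schwarz_lemma 1 r 1 w Hw W0 ltac:(lra)
    (fun y Hy => Rlt_le _ _ (H y (Rle_lt_trans _ _ _ Hy (proj2 Hr)))) z ltac:(lra)) as S.
  apply (Rmult_le_compat_r r) in S; [|lra].
  replace (1 * (Cmod z / r) * r) with (Cmod z) in S by (field; lra). exact S. }
set (r1 := Rmax (Cmod z) (Cmod z / Cmod (w z))).
assert (H1 : r1 < 1).
{ apply Rmax_lub_lt; [exact Hz|]. apply Rmult_lt_reg_r with (Cmod (w z)); [lra|].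
  replace (Cmod z / Cmod (w z) * Cmod (w z)) with (Cmod z) by (field; lra). lra. }
assert (H2 : Cmod z <= r1) by apply Rmax_l. assert (H3 : Cmod z / Cmod (w z) <= r1) by apply Rmax_r.
specialize (B ((1 + r1) / 2) ltac:(lra)).
apply (Rmult_le_compat_l (Cmod (w z))) in H3; [|lra].
replace (Cmod (w z) * (Cmod z / Cmod (w z))) with (Cmod z) in H3 by (field; lra). nra.
Qed.

Lemma RtoC_pow_neq_0 (x : R) (n : nat) : 0 < x -> RtoC (x ^ n) <> 0%C.
Proof. intros H. apply RtoC_neq_0. pose proof (pow_lt x n H). lra. Qed.

Section BranchClass.

Context (alpha : R) (F : C -> C) (Ha : 0 < alpha) (HF : holo 1 F).

Let p (m : nat) (z : C) : C := (twisted_salagean alpha m F z / RtoC (alpha ^ m))%C.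

Lemma twisted_salagean_holo (m : nat) : holo 1 (twisted_salagean alpha m F).
Proof.
induction m as [|m IH]; [exact HF|]. intros z Hz.
change (twisted_salagean alpha (S m) F) with
  (fun z => RtoC alpha * twisted_salagean alpha m F z + z
    * C_derive (twisted_salagean alpha m F) z)%C.
eexists. apply der_plus.
- apply der_scal, (holo_C_derive 1 _ z IH Hz).
- apply der_mult; [apply der_embed | apply (holo_C_derive 1 _ z (holo_derive 1 _ IH) Hz)].
Qed.

Lemma normalized_salagean_cder (m : nat) (z : C) : Cmod z < 1 ->
  cder (p m) z (C_derive (twisted_salagean alpha m F) z / RtoC (alpha ^ m))%C.
Proof.
intros Hz. unfold p, Cdiv.
eapply der_eq; [|apply (der_mult _ (twisted_salagean alpha m F) (fun _ => / RtoC (alpha ^ m))%C z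
   (C_derive (twisted_salagean alpha m F) z) 0)].
- cbv beta. ring.
- apply (holo_C_derive 1 _ z (twisted_salagean_holo m) Hz).
- apply der_const.
Qed.

Lemma normalized_salagean_averages (m : nat) : averages alpha 1 (p m) (p (S m)).
Proof.
intros z Hz. rewrite (cder_C_derive _ _ _ (normalized_salagean_cder m z Hz)). unfold p.
change (twisted_salagean alpha (S m) F z) with
  (RtoC alpha * twisted_salagean alpha m F z + z * C_derive (twisted_salagean alpha m F) z)%C.
pose proof (RtoC_pow_neq_0 alpha m Ha).
change (alpha ^ S m) with (alpha * alpha ^ m). rewrite RtoC_mult.
assert (RtoC alpha <> 0%C) by (apply RtoC_neq_0; lra). field. auto.
Qed.

(** [p m] averages [p (S m)] just as [L_(k+1)] averages [L_k], so each step of the induction lowers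
    the index on the left and raises the one on the right. *)
Lemma janowski_subordinate (n : nat) (a b : R) (k : nat) : -1 <= b /\ b < a /\ a <= 1 ->
  janowski a b (p n) -> (k <= n)%nat -> subordinate 1 (p (n - k)) (Lfun alpha a b k).
Proof.
intros hab [_ [_ [w [Hw [W0 [Wb Ew]]]]]]. induction k as [|k IH]; intros Hk.
- rewrite Nat.sub_0_r. apply analytic_disk_holo in Hw.
  exists w. split; [exact Hw|]. split; [exact W0|]. split; [|exact Ew].
  apply Schwarz_unit_disk; assumption.
- specialize (IH ltac:(lia)). replace (n - k)%nat with (S (n - S k)) in IH by lia.
  apply (averages_subordinate alpha 1 _ (Lfun alpha a b k) _ (p (S (n - S k)))); auto; try lra.
  + apply Lfun_profile; assumption.
  + apply Lfun_profile; assumption.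
  + apply Lfun_averages; assumption.
  + intros z Hz. eexists. apply normalized_salagean_cder, Hz.
  + apply normalized_salagean_averages.
Qed.

End BranchClass.

(** * Comparison with the Koebe function *)

Lemma trig_contact (alpha psi m : R) : 0 < alpha <= 1 -> - PI / 2 < psi < PI / 2 -> 1 <= m ->
  (1 - m) * cos (2 * alpha * psi) * cos psi - m * sin psi * sin (2 * alpha * psi) <= 0.
Proof.
intros Ha Hp Hm.
(* The expression equals [(1 - m) cos ((2 alpha - 1) psi) - sin (2 alpha psi) sin psi]. As
   [0 < alpha <= 1], the angle of the cosine stays within a right angle and [2 alpha psi] within a
   straight one, so neither term is positive. *)
assert (E : cos ((2 * alpha - 1) * psi) = cos (2 * alpha * psi) * cos psi + sin (2 * alpha
  * psi) * sin psi).
{ replace ((2 * alpha - 1) * psi) with (2 * alpha * psi - psi) by ring. apply cos_minus. }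
assert (C0 : 0 <= cos ((2 * alpha - 1) * psi)).
{ apply cos_ge_0; destruct (Rle_dec 0 psi); nra. }
assert (S0 : 0 <= sin (2 * alpha * psi) * sin psi).
{ pose proof PI_RGT_0. destruct (Rle_dec 0 psi).
  - apply Rmult_le_pos; apply sin_ge_0; nra.
  - replace (sin (2 * alpha * psi) * sin psi) with (sin (2 * alpha * - psi) * sin (- psi)).
    + apply Rmult_le_pos; apply sin_ge_0; nra.
    + replace (2 * alpha * - psi) with (- (2 * alpha * psi)) by ring. rewrite !sin_neg. ring. }
nra.
Qed.

(** Positivity of the cosine confines [h] only modulo [2 PI]. Continuity from [h 0 = 0] keeps it in
    the central interval. *)
Lemma cos_pos_interval (h : R -> R) : (forall t, 0 <= t <= 1 -> continuous h t) -> h 0 = 0 ->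
  (forall t, 0 <= t <= 1 -> 0 < cos (h t)) -> - PI / 2 < h 1 < PI / 2.
Proof.
assert (Up : forall h, (forall t, 0 <= t <= 1 -> continuous h t) -> h 0 = 0 ->
  (forall t, 0 <= t <= 1 -> 0 < cos (h t)) -> h 1 < PI / 2).
{ clear h. intros h Hc H0 Hp. apply Rnot_le_lt. intros L. pose proof PI_RGT_0.
  destruct (Req_dec (h 1) (PI / 2)) as [E|N].
  - specialize (Hp 1 ltac:(lra)). rewrite E, cos_PI2 in Hp. lra.
  - destruct (Ranalysis5.IVT_interv (fun t => h t - PI / 2) 0 1) as [t [Ht Et]]; try lra.
    + intros t Ht. apply continuity_pt_filterlim.
      apply (continuous_minus (V := R_NormedModule) h (fun _ => PI / 2) t); [apply Hc, Ht
        | apply continuous_const].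
    + specialize (Hp t Ht). replace (h t) with (PI / 2) in Hp by lra. rewrite cos_PI2 in Hp. lra. }
intros Hc H0 Hp. split; [|apply Up; assumption].
assert (- h 1 < PI / 2); [|lra].
apply (Up (fun t => - h t)).
- intros t Ht. apply (continuous_opp (V := R_NormedModule) h t), Hc, Ht.
- cbv beta. lra.
- intros t Ht. rewrite cos_neg. apply Hp, Ht.
Qed.

(** If [f = z exp l] and [w] is this function, then [f(z) / z = 1 / (1 - w)^2], which is the Koebe
    quotient [k(x) / x] at [x = w]. Halving the logarithm [l] picks the branch of the square
    root. *)
Definition koebe_lift (l : C -> C) (z : C) : C := (1 - Cexp (- (l z / RtoC 2)))%C.

Lemma koebe_lift_cder (l : C -> C) (z : C) : holo 1 l -> Cmod z < 1 ->
  cder (koebe_lift l) z (C_derive l z / RtoC 2 * Cexp (- (l z / RtoC 2)))%C.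
Proof.
intros Hl Hz. eapply der_eq.
2: { apply der_minus; [apply der_const|].
     apply (der_comp _ Cexp (fun z => - (l z / RtoC 2))%C); [apply cder_Cexp|].
     apply der_opp, (der_mult _ l (fun _ => / RtoC 2)%C z (C_derive l z) 0);
       [apply (holo_C_derive 1); assumption | apply der_const]. }
cbv beta. unfold Cdiv. ring.
Qed.

Lemma Re_lt_1_of_Cmod_le (w : C) : Cmod w <= 1 -> w <> 1%C -> fst w < 1.
Proof.
intros H N. pose proof (Cmod_sqr w) as S. pose proof (Cmod_nonneg w).
pose proof (Re_le_Cmod w) as Rw. apply Rabs_le_between in Rw.
destruct (Req_dec (fst w) 1) as [E|NE]; [|lra]. exfalso. apply N.
apply injective_projections; [exact E|]. simpl. rewrite E in S. nra.
Qed.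

(* At a first point with [|w| = 1], [w = 1 - exp (-l/2)], Jack's lemma gives
   [1 + z l' = (1 - m) + i m tan psi] with [psi = Im l / 2] in [(-PI/2, PI/2)] and [m >= 1],
   and then [Re (exp (alpha l) (1 + z l')) <= 0]. *)
Theorem koebe_lift_bound (alpha : R) (l : C -> C) : 0 < alpha <= 1 -> holo 1 l -> l 0%C = 0%C ->
  (forall z, Cmod z < 1 -> 0 < fst (Cexp (RtoC alpha * l z) * (1 + z * C_derive l z))%C) ->
  holo 1 (koebe_lift l) /\ koebe_lift l 0%C = 0%C /\
  forall z, Cmod z < 1 -> Cmod (koebe_lift l z) <= Cmod z.
Proof.
intros Ha Hl l0 Hp. pose proof RtoC_2_neq_0 as N2.
assert (Hw : holo 1 (koebe_lift l)) by (intros z Hz; eexists; apply koebe_lift_cder; assumption).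
assert (W0 : koebe_lift l 0%C = 0%C).
{ unfold koebe_lift. rewrite l0. replace (- (0 / RtoC 2))%C with (RtoC 0) by (unfold Cdiv; ring).
  rewrite Cexp_0. ring. }
split; [exact Hw|]. split; [exact W0|].
apply Schwarz_unit_disk; [exact Hw | exact W0|].
intros z1 Hz1. apply Rnot_le_lt. intros Hbad.
set (w := koebe_lift l) in *.
assert (CE : forall z, Cmod z < 1 -> ccont (fun z => RtoC (1 - Cmod (w z))) z).
{ intros z Hz. apply cont_local with (f := fun z => (1 - RtoC (Cmod (w z)))%C) (eta := 1); [lra| |].
  - intros y _. symmetry. apply RtoC_minus.
  - apply cont_minus; [apply cont_const | apply cont_Cmod, (holo_cont 1 _ Hw z Hz)]. }
destruct (first_contact 1 (fun z => 1 - Cmod (w z)) z1) as [z0 [Hz0 [E0 Hin]]]; auto.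
{ rewrite W0, Cmod_0. lra. }
{ lra. }
assert (Bd : forall z, Cmod z <= Cmod z0 -> Cmod (w z) <= 1).
{ intros z Hz. destruct (Req_dec (Cmod z) 0) as [Z|NZ].
  - apply Cmod_eq_0 in Z. subst z. rewrite W0, Cmod_0. lra.
  - pose proof (Cmod_nonneg z).
    pose proof (nonneg_boundary 1 (Cmod z0) (fun z => 1 - Cmod (w z)) z CE Hin ltac:(lra)
      ltac:(lra)). lra. }
assert (Rz0 : Cmod z0 < 1) by lra.
assert (Ew : Cmod (w z0) = 1) by lra.
assert (Nw : w z0 <> 0%C) by (apply Cmod_pos_neq; lra).
destruct (Jack_lemma 1 w z0 _ Hw W0 ltac:(lra) Nw (koebe_lift_cder l z0 Hl Rz0))
  as [m [Hm Em]].
{ intros z Hz. rewrite Ew. apply Bd, Hz. }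
assert (N1 : forall z, w z <> 1%C).
{ intros z E. apply (Cexp_neq_0 (- (l z / RtoC 2))).
  replace (Cexp (- (l z / RtoC 2))) with (1 - w z)%C by (unfold w, koebe_lift; ring). rewrite E.
    ring. }
assert (Half : forall z, (l z / RtoC 2)%C = (fst (l z) / 2, snd (l z) / 2)).
{ intros z. unfold Cdiv. rewrite <- RtoC_half. destruct (l z) as [x y].
  apply injective_projections; simpl; field. }
(* Along the radius [1 - Re w = exp (- Re l / 2) cos (Im l / 2)] is positive, since [|w| <= 1] and
   [w <> 1]. This fixes the branch of [Im l / 2]. *)
assert (Hpsi : - PI / 2 < snd (l (RtoC 1 * z0)%C) / 2 < PI / 2).
{ apply (cos_pos_interval (fun t => snd (l (RtoC t * z0)%C) / 2)).
  - intros t Ht. apply (continuous_mult (K := R_AbsRing) (fun t => snd (l (RtoC t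
      * z0)%C)) (fun _ => / 2));
      [|apply continuous_const].
    apply rcont_snd, (cont_comp RtoC l (fun t => RtoC t * z0)%C).
    + apply (holo_cont 1 l Hl). pose proof (Cmod_scal_le t z0 Ht). lra.
    + apply cont_mult; [apply cont_embed | apply cont_const].
  - replace (RtoC 0 * z0)%C with (RtoC 0) by ring. rewrite l0. simpl. field.
  - intros t Ht. pose proof (Cmod_scal_le t z0 Ht) as Lt.
    pose proof (Re_lt_1_of_Cmod_le (w (RtoC t * z0)%C) (Bd _ Lt) (N1 _)) as Rl.
    unfold w, koebe_lift in Rl. rewrite Half in Rl. unfold Cexp, Re, Im in Rl. simpl in Rl.
    rewrite cos_neg in Rl.
    set (c := cos (snd (l (RtoC t * z0)%C) / 2)).
    assert (0 < exp (- (fst (l (RtoC t * z0)%C) / 2)) * c).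
    { unfold c. simpl. lra. }
    pose proof (exp_pos (- (fst (l (RtoC t * z0)%C) / 2))). nra. }
replace (RtoC 1 * z0)%C with z0 in Hpsi by ring.
set (psi := snd (l z0) / 2) in *. set (e := exp (fst (l z0) / 2)).
assert (Pe : 0 < e) by apply exp_pos.
assert (Ei : exp (- (fst (l z0) / 2)) = / e) by (unfold e; apply exp_Ropp).
assert (Cpsi : 0 < cos psi) by (apply cos_gt_0; lra).
assert (SC : sin psi * sin psi + cos psi * cos psi = 1) by (pose proof (sin2_cos2 psi) as S;
  exact S).
(* For [A = exp (- l / 2)], [|1 - A| = 1] means [2 Re A = |A|^2]. *)
assert (Ecos : 2 * (e * cos psi) = 1).
{ pose proof (Cmod_sqr (w z0)) as S. rewrite Ew in S. unfold w, koebe_lift in S. rewrite Half in S.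
  unfold Cexp, Re, Im in S. simpl in S. fold psi in S. rewrite Ei, cos_neg, sin_neg in S.
  assert (S' : 2 * (/ e * cos psi) = / e * / e * (sin psi * sin psi + cos psi * cos psi)) by lra.
  rewrite SC in S'. apply (f_equal (fun x => e * e * x)) in S'. field_simplify in S'; lra. }
(* This is [z0 w' = m w] solved for [l'], with [w' = l' A / 2] and [w = 1 - A]. By [Ecos] the real
   part of [1 + z0 l'] is then [1 - m]. *)
assert (Zl : (z0 * C_derive l z0)%C = (2 * RtoC m * (Cexp (l z0 / RtoC 2) - 1))%C).
{ set (A := Cexp (- (l z0 / RtoC 2))) in *.
  assert (NA : A <> 0%C) by apply Cexp_neq_0.
  assert (IA : Cexp (l z0 / RtoC 2) = (/ A)%C).
  { pose proof (Cexp_opp (l z0 / RtoC 2)) as E. fold A in E.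
    replace (Cexp (l z0 / RtoC 2)) with (Cexp (l z0 / RtoC 2) * A * / A)%C by (field; exact NA).
    rewrite E. ring. }
  rewrite IA. assert (Wz : w z0 = (1 - A)%C) by reflexivity. rewrite Wz in Em.
  transitivity (2 * / A * (z0 * (C_derive l z0 / RtoC 2 * A)))%C; [field; auto|].
  rewrite Em. field. exact NA. }
assert (Ex : Cexp (l z0 / RtoC 2) = ((e * cos psi)%R, (e * sin psi)%R)).
{ rewrite Half. reflexivity. }
specialize (Hp z0 Rz0). rewrite Zl, Ex in Hp.
pose proof (trig_contact alpha psi m Ha Hpsi Hm) as T.
assert (EA : Cexp (RtoC alpha * l z0) = ((exp (alpha * fst (l z0)) * cos (2 * alpha * psi))%R,
   (exp (alpha * fst (l z0)) * sin (2 * alpha * psi))%R)).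
{ unfold Cexp, Re, Im, psi. destruct (l z0) as [x y]. simpl.
  replace (alpha * x - 0 * y) with (alpha * x) by ring.
  replace (alpha * y + 0 * x) with (2 * alpha * (y / 2)) by field. reflexivity. }
rewrite EA in Hp. simpl in Hp.
pose proof (exp_pos (alpha * fst (l z0))) as PE.
set (k := exp (alpha * fst (l z0))) in *.
set (c := cos (2 * alpha * psi)) in *. set (s := sin (2 * alpha * psi)) in *.
assert (Hp' : 0 < k * ((1 - m) * c - 2 * m * (e * sin psi) * s)).
{ replace (k * ((1 - m) * c - 2 * m * (e * sin psi) * s)) with
    (k * (1 + m * (2 * (e * cos psi) - 2)) * c - 2 * m * (e * sin psi) * k * s)
    by (rewrite Ecos; ring). lra. }
assert (Hq : 0 < (1 - m) * c - 2 * m * (e * sin psi) * s) by nra.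
assert (0 < cos psi * ((1 - m) * c - 2 * m * (e * sin psi) * s)) by (apply Rmult_lt_0_compat;
  assumption).
replace (cos psi * ((1 - m) * c - 2 * m * (e * sin psi) * s)) with
  ((1 - m) * c * cos psi - m * sin psi * s * (2 * (e * cos psi))) in H by ring.
rewrite Ecos in H. lra.
Qed.

(** * Integral means *)

Lemma RInt_scal_R (f : R -> R) (a b c : R) : ex_RInt f a b ->
  RInt (fun t => c * f t) a b = c * RInt f a b.
Proof. exact (RInt_scal (V := R_CompleteNormedModule) f a b c). Qed.

Lemma RInt_plus_R (f g : R -> R) (a b : R) : ex_RInt f a b -> ex_RInt g a b ->
  RInt (fun t => f t + g t) a b = RInt f a b + RInt g a b.
Proof. exact (RInt_plus (V := R_CompleteNormedModule) f g a b). Qed.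

(** Subharmonicity of the positive part of a harmonic function: the kernel is positive, and [Rmax]
    dominates both of its arguments. *)
Lemma poisson_dominates (R0 : R) (h : C -> C) (zeta : C) : holo 1 h -> 0 < R0 < 1 ->
  Cmod zeta < R0 ->
  2 * PI * Rmax 0 (fst (h zeta)) <=
  RInt (fun t => poisson R0 zeta t * Rmax 0 (fst (h (polar R0 t)))) (- PI) PI.
Proof.
intros Hh HR Hz. pose proof PI_RGT_0.
assert (Ex : ex_RInt (fun t => poisson R0 zeta t * Rmax 0 (fst (h (polar R0 t)))) (- PI) PI).
{ apply ex_RInt_rcont. intros t. apply cont_RtoC_mult; [apply poisson_continuous; lra|].
  apply cont_max; [apply cont_const | apply cont_Re, (holo_circle_cont 1); assumption]. }
assert (Pp : forall t, 0 <= poisson R0 zeta t) by (intros t; apply Rlt_le, poisson_pos, Hz).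
apply Rmax_case.
- rewrite Rmult_0_r. apply RInt_ge_0; [lra | exact Ex|]. intros t _.
  apply Rmult_le_pos; [apply Pp | apply Rmax_l].
- rewrite <- (Poisson_Re 1 R0 h zeta Hh HR Hz). apply RInt_le; [lra | | exact Ex|].
  + apply (ex_RInt_poisson 1); assumption.
  + intros t _. apply Rmult_le_compat_l; [apply Pp | apply Rmax_r].
Qed.

(** For a fixed boundary point [s] the integrand is the real part of the holomorphic function
    [(s + w) / (s - w)], so its mean is the value [1] at the centre, where [w = 0]. *)
Lemma poisson_mean (R0 r t : R) (w : C -> C) : holo 1 w -> w 0%C = 0%C ->
  (forall z, Cmod z < 1 -> Cmod (w z) <= Cmod z) -> 0 < r < R0 -> R0 < 1 ->
  RInt (fun x => poisson R0 (w (polar r x)) t) (- PI) PI = 2 * PI.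
Proof.
intros Hw W0 Bw Hr HR.
assert (N : forall z, Cmod z < R0 -> (polar R0 t - w z)%C <> 0%C).
{ intros z Hz. apply sub_neq_0. rewrite Cmod_polar by lra. specialize (Bw z ltac:(lra)). lra. }
assert (Hk : holo R0 (fun z => (polar R0 t + w z) / (polar R0 t - w z))%C).
{ intros z Hz. destruct (Hw z ltac:(lra)) as [d Hd]. eexists. apply der_div; [apply N, Hz | |].
  - apply der_plus; [apply der_const | exact Hd].
  - apply der_minus; [apply der_const | exact Hd]. }
pose proof (mean_value_Re R0 r _ Hk Hr) as E. cbv beta in E. rewrite W0 in E.
assert (N0 : polar R0 t <> 0%C) by (apply Cmod_pos_neq; rewrite Cmod_polar; lra).
replace ((polar R0 t + 0) / (polar R0 t - 0))%C with (RtoC 1) in E.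
2: { field. replace (polar R0 t - 0)%C with (polar R0 t) by ring. exact N0. }
rewrite Rmult_1_r in E. rewrite <- E.
apply RInt_ext. intros x _. apply poisson_Re; [lra|].
pose proof (Bw (polar r x)) as B. rewrite Cmod_polar in B by lra. lra.
Qed.

(** Littlewood's argument: the Poisson bound at [w (polar r x)] is integrated over [x], the
    integrations are exchanged, and the kernel has mean [1] in [x]. The larger radius [R0] keeps
    [w (polar r x)], whose modulus may reach [r], inside the circle. *)
Lemma subordinate_hinge_lt (R0 r : R) (h w : C -> C) : holo 1 h -> holo 1 w -> w 0%C = 0%C ->
  (forall z, Cmod z < 1 -> Cmod (w z) <= Cmod z) -> 0 < r < R0 -> R0 < 1 ->
  RInt (fun x => Rmax 0 (fst (h (w (polar r x))))) (- PI) PI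
  <= RInt (fun t => Rmax 0 (fst (h (polar R0 t)))) (- PI) PI.
Proof.
intros Hh Hw W0 Bw Hr HR. pose proof PI_RGT_0 as HP.
pose (u := fun z => Rmax 0 (fst (h z))).
assert (Cu : forall z, Cmod z < 1 -> ccont (fun z => RtoC (u z)) z).
{ intros z Hz. apply cont_max; [apply cont_const | apply cont_Re, (holo_cont 1 h Hh z Hz)]. }
assert (Wr : forall x, Cmod (w (polar r x)) < R0).
{ intros x. pose proof (Bw (polar r x)) as B. rewrite Cmod_polar in B by lra. lra. }
pose (K := fun x t => poisson R0 (w (polar r x)) t * u (polar R0 t)).
assert (CK : forall x t, continuity_2d_pt K x t).
{ intros x t. apply (ccont_continuity_2d (fun p => K (fst p) (snd p)) x t).
  unfold K. apply cont_RtoC_mult.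
  - apply cont_local with (f := fun p => RtoC (fst ((polar R0 (snd p) + w (polar r (fst p)))
        / (polar R0 (snd p) - w (polar r (fst p))))%C)) (eta := 1); [lra| |].
    + intros y _. rewrite poisson_Re; [reflexivity | lra | apply Wr].
    + assert (Cw : ccont (fun p : C => w (polar r (fst p))) (x, t)).
      { apply (cont_rcomp (fun p : C => p) (fun x => w (polar r x)) (fun p : C => fst p)).
        - apply (holo_circle_cont 1); [exact Hw | lra].
        - apply ccont_fst. }
      apply cont_Re, cont_div.
      * cbn [fst snd]. apply sub_neq_0. rewrite Cmod_polar by lra. apply Wr.
      * apply cont_plus; [apply ccont_polar_snd | exact Cw].
      * apply cont_minus; [apply ccont_polar_snd | exact Cw].
  - apply (cont_comp (fun p : C => p) (fun z => RtoC (u z)) (fun p => polar R0 (snd p))).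
    + apply Cu. rewrite Cmod_polar; lra.
    + apply ccont_polar_snd. }
assert (Exw : ex_RInt (fun x => u (w (polar r x))) (- PI) PI).
{ apply ex_RInt_rcont. intros x. apply (cont_comp RtoC (fun z => RtoC (u z)) (fun x => w (polar r
    x))).
  - apply Cu. specialize (Wr x). lra.
  - apply (holo_circle_cont 1); [exact Hw | lra]. }
apply Rmult_le_reg_l with (2 * PI); [lra|].
change (2 * PI * RInt (fun x => u (w (polar r x))) (- PI) PI <= 2 * PI
  * RInt (fun t => u (polar R0 t)) (- PI) PI).
rewrite <- (RInt_scal (V := R_CompleteNormedModule) (fun x => u (w (polar r x))) _ _ (2
  * PI)) by exact Exw.
apply Rle_trans with (RInt (fun x => RInt (K x) (- PI) PI) (- PI) PI).
- apply RInt_le; [lra | | |].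
  + apply (ex_RInt_scal (V := R_NormedModule)), Exw.
  + apply (ex_RInt_continuous (V := R_CompleteNormedModule)). intros x _.
    apply RInt_param_continuous; [lra | auto].
  + intros x _. apply poisson_dominates; [exact Hh | lra | apply Wr].
- rewrite (RInt_swap K) by (auto; lra).
  rewrite (RInt_ext _ (fun t => scal (2 * PI) (u (polar R0 t)))).
  + rewrite (RInt_scal (V := R_CompleteNormedModule)); [apply Rle_refl|].
    apply ex_RInt_rcont. intros t. apply (cont_comp RtoC (fun z => RtoC (u z)) (polar R0)).
    * apply Cu. rewrite Cmod_polar; lra.
    * apply rcont_polar.
  + intros t _. unfold K.
    rewrite (RInt_ext _ (fun x => scal (u (polar R0 t)) (poisson R0 (w (polar r x)) t)))
      by (intros x _; apply Rmult_comm).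
    rewrite (RInt_scal (V := R_CompleteNormedModule)).
    * rewrite (poisson_mean R0 r t w) by assumption. apply Rmult_comm.
    * apply ex_RInt_rcont. intros x.
      apply cont_local with (f := fun x => RtoC (fst ((polar R0 t + w (polar r x))
        / (polar R0 t - w (polar r x)))%C)) (eta := 1); [lra| |].
      -- intros y _. rewrite poisson_Re; [reflexivity | lra | apply Wr].
      -- assert (Cw : rcont (fun x => w (polar r x)) x) by (apply (holo_circle_cont 1);
        [exact Hw | lra]).
         apply cont_Re, cont_div.
         ++ apply sub_neq_0. rewrite Cmod_polar by lra. apply Wr.
         ++ apply cont_plus; [apply cont_const | exact Cw].
         ++ apply cont_minus; [apply cont_const | exact Cw].
Qed.

Theorem subordinate_hinge (r : R) (h w : C -> C) : holo 1 h -> holo 1 w -> w 0%C = 0%C ->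
  (forall z, Cmod z < 1 -> Cmod (w z) <= Cmod z) -> 0 < r < 1 ->
  RInt (fun x => Rmax 0 (fst (h (w (polar r x))))) (- PI) PI
  <= RInt (fun t => Rmax 0 (fst (h (polar r t)))) (- PI) PI.
Proof.
intros Hh Hw W0 Bw Hr. pose proof PI_RGT_0 as HP.
set (r1 := (1 + r) / 2).
(* Continuity of the parametric integral is available for integrands continuous at every parameter.
   Clamping the radius to [[0, r1]] with [r1 < 1] keeps all points in the disk, so that [R0] can
   tend to [r]. *)
pose (u := fun rho t => Rmax 0 (fst (h (polar (clamp 0 r1 rho) t)))).
assert (Hr1 : 0 <= r1) by (unfold r1; lra).
assert (Cu : forall rho t, continuity_2d_pt u rho t).
{ intros rho t. apply (ccont_continuity_2d (fun p => u (fst p) (snd p))).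
  unfold u. apply cont_max; [apply cont_const|]. apply cont_Re.
  apply (cont_comp (fun p : C => p) h (fun p => polar (clamp 0 r1 (fst p)) (snd p))).
  - apply (holo_cont 1 h Hh). cbn [fst snd]. pose proof (clamp_in 0 r1 rho Hr1).
    rewrite Cmod_polar; unfold r1 in *; lra.
  - apply cont_local with (f := fun p : C => (RtoC (clamp 0 r1 (fst p))
      * polar 1 (snd p))%C) (eta := 1); [lra| |].
    + intros y _. rewrite polar_scal, Rmult_1_r. reflexivity.
    + apply cont_mult; [|apply ccont_polar_snd].
      apply (cont_of_Lipschitz _ (fun z => RtoC (clamp 0 r1 (fst z))) 1 Rlt_0_1);
        [|apply cont_embed].
      intros x y. rewrite <- RtoC_minus, Cmod_R, Rmult_1_l.
      eapply Rle_trans; [apply clamp_Lipschitz, Hr1|]. apply (Re_le_Cmod (y - x)). }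
pose proof (RInt_param_continuous u (- PI) PI r ltac:(lra) (fun x y _ => Cu x y)) as CI.
apply le_epsilon. intros eps He.
apply filterlim_locally with (eps := mkposreal eps He) in CI. destruct CI as [d Hd].
pose proof (cond_pos d) as Pd.
set (R0 := Rmin (r + d / 2) r1).
assert (HR : r < R0) by (unfold R0; apply Rmin_glb_lt; unfold r1; lra).
assert (HR1 : R0 <= r1) by apply Rmin_r. assert (HR2 : R0 <= r + d / 2) by apply Rmin_l.
specialize (Hd R0). assert (B : Rabs (R0 - r) < d) by (apply Rabs_def1; lra). specialize (Hd B).
assert (Hd' : Rabs (RInt (u R0) (- PI) PI - RInt (u r) (- PI) PI) < eps) by exact Hd.
apply Rabs_def2 in Hd'.
pose proof (subordinate_hinge_lt R0 r h w Hh Hw W0 Bw ltac:(lra) ltac:(unfold r1 in *; lra)) as L.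
unfold u in Hd'. rewrite !clamp_id in Hd' by (unfold r1 in *; lra). lra.
Qed.

(** * From hinge functions to convex functions *)

Section ConvexOrder.

Context (Phi : R -> R) (Hc : convex Phi) (Hm : forall x y, x <= y -> Phi x <= Phi y).

Lemma convex_three_slopes (x y z : R) : x < y < z ->
  (Phi y - Phi x) * (z - y) <= (Phi z - Phi y) * (y - x).
Proof.
intros H. set (t := (z - y) / (z - x)).
assert (Ht : 0 <= t <= 1).
{ unfold t. split; [apply Rdiv_le_0_compat; lra|]. apply Rmult_le_reg_r with (z - x); [lra|].
  replace ((z - y) / (z - x) * (z - x)) with (z - y) by (field; lra). lra. }
pose proof (Hc x z t Ht) as K.
replace (t * x + (1 - t) * z) with y in K by (unfold t; field; lra).
apply (Rmult_le_compat_r (z - x)) in K; [|lra].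
replace ((t * Phi x + (1 - t) * Phi z) * (z - x)) with ((z - y) * Phi x + (y - x) * Phi z) in K
  by (unfold t; field; lra).
lra.
Qed.

Lemma convex_chord (x y z : R) : x <= y <= z -> (Phi y - Phi x) * (z - x) <= (Phi z - Phi x)
  * (y - x).
Proof.
intros H. destruct (Req_dec x y) as [->|N1]; [nra|]. destruct (Req_dec y z) as [->|N2]; [nra|].
pose proof (convex_three_slopes x y z ltac:(lra)). nra.
Qed.

(** Slopes of a convex function increase, so the one over [[M, M + 1]] bounds all those to the left
    of [M]. This Lipschitz constant serves both continuity and the error of the chords. *)
Lemma convex_slope_bound (M x y : R) : x <= y -> y <= M ->
  0 <= Phi y - Phi x <= (Phi (M + 1) - Phi M) * (y - x).
Proof.
intros Hxy HyM. pose proof (Hm x y Hxy). split; [lra|].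
destruct (Req_dec x y) as [->|N1]; [nra|].
destruct (Req_dec y M) as [->|N2].
- pose proof (convex_three_slopes x M (M + 1) ltac:(lra)). nra.
- pose proof (convex_three_slopes x y M ltac:(lra)).
  pose proof (convex_three_slopes y M (M + 1) ltac:(lra)).
  apply Rmult_le_reg_r with (M - y); [lra|]. nra.
Qed.

Lemma convex_cont (f : R -> R) (t : R) : rcont (fun t => RtoC (f t)) t ->
  rcont (fun t => RtoC (Phi (f t))) t.
Proof.
intros Hf. apply (cont_comp RtoC (fun z => RtoC (Phi (fst z))) (fun t => RtoC (f t))); [|exact Hf].
cbn [fst RtoC]. set (x := f t). intros eps He.
set (K := Phi (x + 1 + 1) - Phi (x + 1)).
assert (HK : 0 <= K) by (pose proof (Hm (x + 1) (x + 1 + 1) ltac:(lra)); unfold K; lra).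
exists (Rmin 1 (eps / (K + 1))).
split; [apply Rmin_glb_lt; [lra | apply Rdiv_lt_0_compat; lra]|]. intros y Hy.
assert (L : Rabs (fst y - x) <= Cmod (y - RtoC x)) by (apply (Re_le_Cmod (y - RtoC x))).
assert (L1 : Rabs (fst y - x) < 1) by (eapply Rle_lt_trans; [exact L|]; eapply Rlt_le_trans;
  [exact Hy | apply Rmin_l]).
assert (L2 : Rabs (fst y - x) < eps / (K + 1))
  by (eapply Rle_lt_trans; [exact L|]; eapply Rlt_le_trans; [exact Hy | apply Rmin_r]).
change (fst (RtoC x)) with x. rewrite <- RtoC_minus, Cmod_R.
apply (Rmult_lt_compat_r (K + 1)) in L2; [|lra].
replace (eps / (K + 1) * (K + 1)) with eps in L2 by (field; lra).
pose proof (Rabs_pos (fst y - x)).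
apply Rle_lt_trans with (K * Rabs (fst y - x)); [|nra].
apply Rabs_def2 in L1.
destruct (Rle_dec x (fst y)) as [C1|C1].
- pose proof (convex_slope_bound (x + 1) x (fst y) C1 ltac:(lra)) as S. fold K in S.
  rewrite !Rabs_pos_eq by lra. lra.
- pose proof (convex_slope_bound (x + 1) (fst y) x ltac:(lra) ltac:(lra)) as S. fold K in S.
  rewrite !Rabs_left1 by lra. lra.
Qed.

Context (a b : R) (Hab : a <= b) (H1 H2 : R -> R)
  (C1 : forall t, rcont (fun t => RtoC (H1 t)) t) (C2 : forall t, rcont (fun t => RtoC (H2 t)) t)
  (Hinge : forall s, RInt (fun t => Rmax 0 (H1 t - s)) a b
    <= RInt (fun t => Rmax 0 (H2 t - s)) a b).

(* The chord interpolation of [Phi] at the nodes [m + i d], as a sum of hinge functions. *)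
Fixpoint chords (m d : R) (k : nat) (x : R) : R :=
  match k with
  | O => Phi m + (Phi (m + d) - Phi m) / d * Rmax 0 (x - m)
  | S k' => chords m d k' x +
      ((Phi (m + (INR k + 1) * d) - Phi (m + INR k * d)) / d
       - (Phi (m + INR k * d) - Phi (m + INR k' * d)) / d) * Rmax 0 (x - (m + INR k * d))
  end.

Lemma hinge_cont (H : R -> R) (c s t : R) : (forall t, rcont (fun t => RtoC (H t)) t) ->
  rcont (fun t => RtoC (c * Rmax 0 (H t - s))) t.
Proof.
intros C. apply cont_RtoC_mult; [apply cont_const|]. apply cont_max; [apply cont_const|].
apply cont_local with (f := fun t => (RtoC (H t) - RtoC s)%C) (eta := 1); [lra| |].
- intros y _. symmetry. apply RtoC_minus.
- apply cont_minus; [apply C | apply cont_const].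
Qed.

Lemma chords_cont (H : R -> R) (m d : R) (k : nat) (t : R) : (forall t,
  rcont (fun t => RtoC (H t)) t) ->
  rcont (fun t => RtoC (chords m d k (H t))) t.
Proof.
intros C. induction k as [|k IH].
- cbn [chords]. eapply cont_local with (eta := 1); [lra | intros y _; symmetry; apply RtoC_plus|].
  apply cont_plus; [apply cont_const | apply hinge_cont, C].
- cbn [chords]. eapply cont_local with (eta := 1); [lra | intros y _; symmetry; apply RtoC_plus|].
  apply cont_plus; [apply IH | apply hinge_cont, C].
Qed.

Lemma RInt_hinge_le (c s : R) : 0 <= c ->
  RInt (fun t => c * Rmax 0 (H1 t - s)) a b <= RInt (fun t => c * Rmax 0 (H2 t - s)) a b.
Proof.
intros Hcc.
assert (Ex : forall H, (forall t, rcont (fun t => RtoC (H t)) t) ->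
  ex_RInt (fun t => Rmax 0 (H t - s)) a b).
{ intros H C. apply ex_RInt_rcont. intros t. apply cont_local with (f := fun t => RtoC (1
    * Rmax 0 (H t - s))) (eta := 1); [lra| |].
  - intros y _. f_equal. ring.
  - apply hinge_cont, C. }
rewrite (RInt_scal_R (fun t => Rmax 0 (H1 t - s)) a b c) by (apply Ex, C1).
rewrite (RInt_scal_R (fun t => Rmax 0 (H2 t - s)) a b c) by (apply Ex, C2).
apply Rmult_le_compat_l; [exact Hcc | apply Hinge].
Qed.

Lemma RInt_chords_le (m d : R) (k : nat) : 0 < d ->
  RInt (fun t => chords m d k (H1 t)) a b <= RInt (fun t => chords m d k (H2 t)) a b.
Proof.
intros Hd.
assert (ExH : forall H c s, (forall t, rcont (fun t => RtoC (H t)) t) -> ex_RInt (fun t => c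
  * Rmax 0 (H t - s)) a b).
{ intros H c s C. apply ex_RInt_rcont. intros t. apply hinge_cont, C. }
induction k as [|k IH].
- cbn [chords].
  rewrite (RInt_plus_R (fun _ => Phi m)
     (fun t => (Phi (m + d) - Phi m) / d * Rmax 0 (H1 t - m)))
       by (solve [auto] || apply ex_RInt_const).
  rewrite (RInt_plus_R (fun _ => Phi m)
     (fun t => (Phi (m + d) - Phi m) / d * Rmax 0 (H2 t - m)))
       by (solve [auto] || apply ex_RInt_const).
  apply Rplus_le_compat_l, RInt_hinge_le. apply Rdiv_le_0_compat; [|exact Hd].
  pose proof (Hm m (m + d) ltac:(lra)). lra.
- cbn [chords]. set (c := _ - _). set (s := m + INR (S k) * d).
  assert (Exk : forall H, (forall t, rcont (fun t => RtoC (H t)) t) ->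
    ex_RInt (fun t => chords m d k (H t)) a b).
  { intros H C. apply ex_RInt_rcont. intros t. apply chords_cont, C. }
  rewrite (RInt_plus_R (fun t => chords m d k (H1 t))
     (fun t => c * Rmax 0 (H1 t - s))) by auto.
  rewrite (RInt_plus_R (fun t => chords m d k (H2 t))
     (fun t => c * Rmax 0 (H2 t - s))) by auto.
  apply Rplus_le_compat; [exact IH|]. apply RInt_hinge_le. unfold c. rewrite S_INR.
  pose proof (convex_three_slopes (m + INR k * d) (m + (INR k + 1) * d) (m + (INR k + 1 + 1)
    * d) ltac:(nra)) as T.
  replace (m + (INR k + 1 + 1) * d - (m + (INR k + 1) * d)) with d in T by ring.
  replace (m + (INR k + 1) * d - (m + INR k * d)) with d in T by ring.
  apply Rmult_le_reg_r in T; [|exact Hd].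
  replace ((Phi (m + (INR k + 1 + 1) * d) - Phi (m + (INR k + 1) * d)) / d
     - (Phi (m + (INR k + 1) * d) - Phi (m + INR k * d)) / d)
   with ((Phi (m + (INR k + 1 + 1) * d) - Phi (m + (INR k + 1) * d)
     - (Phi (m + (INR k + 1) * d) - Phi (m + INR k * d))) / d) by (field; lra).
  apply Rdiv_le_0_compat; lra.
Qed.

(** To the right of the last node all hinges are active, and the increments of slope telescope to
    the last chord. *)
Lemma chords_last (m d : R) (k : nat) (x : R) : 0 < d -> m + INR k * d <= x ->
  chords m d k x = Phi (m + INR k * d) +
    (Phi (m + (INR k + 1) * d) - Phi (m + INR k * d)) / d * (x - (m + INR k * d)).
Proof.
intros Hd. induction k as [|k IH]; intros Hx.
- cbn [chords]. simpl INR in *. rewrite Rmult_0_l, Rplus_0_r in *. rewrite Rmax_right by lra.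
  rewrite Rplus_0_l, Rmult_1_l. reflexivity.
- cbn [chords]. rewrite S_INR in *. rewrite IH by nra. rewrite Rmax_right by lra. field. lra.
Qed.

Lemma chords_between (M m d : R) (k : nat) (x : R) : 0 < d -> m + (INR k + 1) * d <= M ->
  m <= x <= m + (INR k + 1) * d ->
  Phi x <= chords m d k x <= Phi x + (Phi (M + 1) - Phi M) * d.
Proof.
intros Hd. assert (Main : forall k, m + (INR k + 1) * d <= M -> m + INR k * d <= x <= m
  + (INR k + 1) * d ->
  Phi x <= chords m d k x <= Phi x + (Phi (M + 1) - Phi M) * d).
{ clear k. intros k HM Hx. rewrite chords_last by lra.
  pose proof (convex_chord (m + INR k * d) x (m + (INR k + 1) * d) Hx) as Ch.
  replace (m + (INR k + 1) * d - (m + INR k * d)) with d in Ch by ring.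
  pose proof (convex_slope_bound M (m + INR k * d) (m + (INR k + 1) * d) ltac:(nra) HM) as S.
  replace (m + (INR k + 1) * d - (m + INR k * d)) with d in S by ring.
  pose proof (Hm (m + INR k * d) x ltac:(lra)).
  set (P0 := Phi (m + INR k * d)) in *. set (P1 := Phi (m + (INR k + 1) * d)) in *.
  set (y := x - (m + INR k * d)) in *. assert (Hy : 0 <= y <= d) by (unfold y; lra).
  assert (E : (P1 - P0) / d * y = (P1 - P0) * y / d) by (field; lra).
  split.
  - assert (Phi x - P0 <= (P1 - P0) * y / d); [|lra].
    apply Rmult_le_reg_r with d; [exact Hd|].
    replace ((P1 - P0) * y / d * d) with ((P1 - P0) * y) by (field; lra). exact Ch.
  - assert ((P1 - P0) * y / d <= P1 - P0); [|lra].
    apply Rmult_le_reg_r with d; [exact Hd|].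
    replace ((P1 - P0) * y / d * d) with ((P1 - P0) * y) by (field; lra). nra. }
induction k as [|k IH]; intros HM Hx.
- apply Main; [exact HM|]. simpl INR in *. lra.
(* To the left of the last node the last hinge vanishes, so the index can be lowered. *)
- destruct (Rle_dec (m + INR (S k) * d) x) as [L|L]; [apply Main; lra|]. apply Rnot_le_lt in L.
  cbn [chords]. rewrite (Rmax_left 0) by lra. rewrite Rmult_0_r, Rplus_0_r.
  rewrite S_INR in *. apply IH; [nra | lra].
Qed.

Theorem convex_order : RInt (fun t => Phi (H1 t)) a b <= RInt (fun t => Phi (H2 t)) a b.
Proof.
assert (Bd : forall H, (forall t, rcont (fun t => RtoC (H t)) t) ->
  exists K, 0 < K /\ forall t, a <= t <= b -> - K <= H t <= K).
{ intros H C. destruct (contseg_bounded (fun t => RtoC (H t)) a b Hab (fun t _ => C t)) as [K [HK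
    B]].
  exists K. split; [exact HK|]. intros t Ht. specialize (B t Ht). rewrite Cmod_R in B.
  apply Rabs_le_between, B. }
destruct (Bd H1 C1) as [K1 [P1 B1]]. destruct (Bd H2 C2) as [K2 [P2 B2]].
set (K := K1 + K2). assert (PK : 0 < K) by (unfold K; lra).
assert (Ex1 : ex_RInt (fun t => Phi (H1 t)) a b) by (apply ex_RInt_rcont; intros t;
  apply convex_cont, C1).
assert (Ex2 : ex_RInt (fun t => Phi (H2 t)) a b) by (apply ex_RInt_rcont; intros t;
  apply convex_cont, C2).
set (Lip := Phi (K + 1) - Phi K).
assert (PL : 0 <= Lip) by (pose proof (Hm K (K + 1) ltac:(lra)); unfold Lip; lra).
apply le_epsilon. intros eps He.
(* The values of [H1] and [H2] lie in [[-K, K]]. With mesh [2 K / N] the total error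
   [Lip * d * (b - a)] is at most [eps]; the terms [+ 1] only keep the divisor positive. *)
destruct (archimed_cor1 (eps / (2 * K * (Lip + 1) * (b - a + 1)))) as [N [HN PN]].
{ apply Rdiv_lt_0_compat; [exact He|]. repeat apply Rmult_lt_0_compat; lra. }
assert (IN : 0 < INR N) by (apply lt_0_INR; lia).
set (d := 2 * K / INR N). assert (Pd : 0 < d) by (apply Rdiv_lt_0_compat; lra).
(* [chords] with index [k] has [k + 1] intervals, so the index is [N - 1]. *)
destruct N as [|k]; [lia|].
assert (End : - K + (INR k + 1) * d = K) by (rewrite <- S_INR; unfold d; field; lra).
assert (G : forall x, - K <= x <= K -> Phi x <= chords (- K) d k x <= Phi x + Lip * d).
{ intros x Hx. apply (chords_between K); [exact Pd | lra | lra]. }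
assert (Exc : forall H, (forall t, rcont (fun t => RtoC (H t)) t) ->
  ex_RInt (fun t => chords (- K) d k (H t)) a b).
{ intros H C. apply ex_RInt_rcont. intros t. apply chords_cont, C. }
apply Rle_trans with (RInt (fun t => chords (- K) d k (H1 t)) a b).
{ apply RInt_le; [exact Hab | exact Ex1 | apply Exc, C1|]. intros t Ht. apply G.
  specialize (B1 t ltac:(lra)). unfold K in *. lra. }
eapply Rle_trans; [apply RInt_chords_le, Pd|].
apply Rle_trans with (RInt (fun t => Phi (H2 t) + Lip * d) a b).
{ apply RInt_le; [exact Hab | apply Exc, C2 | apply (ex_RInt_plus (V := R_NormedModule));
    [exact Ex2 | apply ex_RInt_const]|].
  intros t Ht. apply G. specialize (B2 t ltac:(lra)). unfold K in *. lra. }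
rewrite (RInt_plus_R (fun t => Phi (H2 t)) (fun _ => Lip * d))
  by (exact Ex2 || apply ex_RInt_const).
rewrite RInt_const. unfold plus, scal. simpl. unfold mult. simpl. apply Rplus_le_compat_l.
assert (Dd : d < eps / ((Lip + 1) * (b - a + 1))).
{ unfold d. apply (Rmult_lt_compat_l (2 * K)) in HN; [|lra].
  replace (2 * K * (eps / (2 * K * (Lip + 1) * (b - a + 1)))) with (eps / ((Lip + 1) * (b - a
    + 1))) in HN
    by (field; lra). exact HN. }
apply (Rmult_lt_compat_l ((Lip + 1) * (b - a + 1))) in Dd; [|apply Rmult_lt_0_compat; lra].
replace ((Lip + 1) * (b - a + 1) * (eps / ((Lip + 1) * (b - a + 1)))) with eps in Dd by (field;
  lra).
assert (0 <= Lip * (b - a)) by (apply Rmult_le_pos; lra). nra.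
Qed.

End ConvexOrder.

(* [U] and [V] are similarly ordered, so every threshold [s] splits as [s = s1 + s2] such that
   [U - s1] and [V - s2] never have opposite signs. *)
Lemma hinge_split (U V : R -> R) (s : R) :
  (forall t, rcont (fun t => RtoC (U t)) t) -> (forall t, rcont (fun t => RtoC (V t)) t) ->
  (forall t, U (- t) = U t) -> (forall t, V (- t) = V t) ->
  (forall t t', 0 <= t <= t' -> t' <= PI -> U t <= U t') ->
  (forall t t', 0 <= t <= t' -> t' <= PI -> V t <= V t') ->
  exists s1 s2, s1 + s2 = s /\ forall t, - PI <= t <= PI ->
    Rmax 0 (U t - s1) + Rmax 0 (V t - s2) = Rmax 0 (U t + V t - s).
Proof.
intros CU CV EU EV MU MV. pose proof PI_RGT_0 as HP.
assert (Sgn : forall s1 s2, s1 + s2 = s ->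
  (forall t, 0 <= t <= PI -> (s1 <= U t /\ s2 <= V t) \/ (U t <= s1 /\ V t <= s2)) ->
  exists s1 s2, s1 + s2 = s /\ forall t, - PI <= t <= PI ->
    Rmax 0 (U t - s1) + Rmax 0 (V t - s2) = Rmax 0 (U t + V t - s)).
{ intros s1 s2 Es H. exists s1, s2. split; [exact Es|].
  assert (Pos : forall t, 0 <= t <= PI ->
    Rmax 0 (U t - s1) + Rmax 0 (V t - s2) = Rmax 0 (U t + V t - s)).
  { intros t Ht. destruct (H t Ht) as [[A B]|[A B]].
    - rewrite !Rmax_right by lra. lra.
    - rewrite !Rmax_left by lra. lra. }
  intros t Ht. destruct (Rle_dec 0 t) as [L|L]; [apply Pos; lra|].
  rewrite <- (EU t), <- (EV t). apply Pos. lra. }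
(* A threshold below or above the range of [U + V] on [[0, PI]] is split at an end point, where all
   differences have one sign. Any other is split at a point where [U + V = s]. *)
destruct (Rle_dec s (U 0 + V 0)) as [L0|L0].
{ apply (Sgn (U 0) (s - U 0)); [ring|]. intros t Ht. left.
  pose proof (MU 0 t ltac:(lra) ltac:(lra)). pose proof (MV 0 t ltac:(lra) ltac:(lra)). lra. }
destruct (Rle_dec (U PI + V PI) s) as [L1|L1].
{ apply (Sgn (U PI) (s - U PI)); [ring|]. intros t Ht. right.
  pose proof (MU t PI ltac:(lra) ltac:(lra)). pose proof (MV t PI ltac:(lra) ltac:(lra)). lra. }
destruct (Ranalysis5.IVT_interv (fun t => U t + V t - s) 0 PI) as [t0 [Ht0 E0]]; try lra.
{ intros t _. apply continuity_pt_filterlim.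
  apply (continuous_minus (V := R_NormedModule) (fun t => U t + V t) (fun _ => s));
    [|apply continuous_const].
  apply (continuous_plus (V := R_NormedModule)); apply rcont_continuous; auto. }
apply (Sgn (U t0) (V t0)); [lra|]. intros t Ht. destruct (Rle_dec t0 t) as [L|L].
- left. split; [apply MU | apply MV]; lra.
- right. split; [apply MU | apply MV]; lra.
Qed.

Lemma rcont_R_plus (f g : R -> R) (t : R) : rcont (fun t => RtoC (f t)) t ->
  rcont (fun t => RtoC (g t)) t ->
  rcont (fun t => RtoC (f t + g t)) t.
Proof.
intros Hf Hg. apply cont_local with (f := fun t => (RtoC (f t) + RtoC (g t))%C) (eta := 1);
  [lra| |].
- intros y _. symmetry. apply RtoC_plus.
- apply cont_plus; assumption.
Qed.

Lemma rcont_hinge (f : R -> R) (s t : R) : rcont (fun t => RtoC (f t)) t ->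
  rcont (fun t => RtoC (Rmax 0 (f t - s))) t.
Proof.
intros Hf. apply cont_max; [apply cont_const|]. apply (rcont_R_plus f (fun _ => - s));
  [exact Hf | apply cont_const].
Qed.

(** [max (0, x + y - s) <= max (0, x - s1) + max (0, y - s2)] for every split of [s], which suffices
    for [U1 + V1]. For [U + V] the split of [hinge_split] gives equality. *)
Theorem similarly_ordered_hinge (U V U1 V1 : R -> R) (s : R) :
  (forall t, rcont (fun t => RtoC (U t)) t) -> (forall t, rcont (fun t => RtoC (V t)) t) ->
  (forall t, rcont (fun t => RtoC (U1 t)) t) -> (forall t, rcont (fun t => RtoC (V1 t)) t) ->
  (forall t, U (- t) = U t) -> (forall t, V (- t) = V t) ->
  (forall t t', 0 <= t <= t' -> t' <= PI -> U t <= U t') ->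
  (forall t t', 0 <= t <= t' -> t' <= PI -> V t <= V t') ->
  (forall s, RInt (fun t => Rmax 0 (U1 t - s)) (- PI) PI
    <= RInt (fun t => Rmax 0 (U t - s)) (- PI) PI) ->
  (forall s, RInt (fun t => Rmax 0 (V1 t - s)) (- PI) PI
    <= RInt (fun t => Rmax 0 (V t - s)) (- PI) PI) ->
  RInt (fun t => Rmax 0 (U1 t + V1 t - s)) (- PI) PI
  <= RInt (fun t => Rmax 0 (U t + V t - s)) (- PI) PI.
Proof.
intros CU CV CU1 CV1 EU EV MU MV HU HV. pose proof PI_RGT_0 as HP.
destruct (hinge_split U V s CU CV EU EV MU MV) as [s1 [s2 [Es Hs]]].
assert (Ex : forall f s, (forall t, rcont (fun t => RtoC (f t)) t) ->
  ex_RInt (fun t => Rmax 0 (f t - s)) (- PI) PI).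
{ intros f s0 C. apply ex_RInt_rcont. intros t. apply rcont_hinge, C. }
apply Rle_trans with (RInt (fun t => Rmax 0 (U1 t - s1) + Rmax 0 (V1 t - s2)) (- PI) PI).
- apply RInt_le; [lra | apply (Ex (fun t => U1 t + V1 t))
    | apply (ex_RInt_plus (V := R_NormedModule)); apply Ex; assumption|].
  + intros t. apply rcont_R_plus; auto.
  + intros t _. unfold Rmax. repeat destruct (Rle_dec _ _); lra.
- rewrite RInt_plus_R by (apply Ex; assumption).
  rewrite <- (RInt_ext (fun t => Rmax 0 (U t - s1) + Rmax 0 (V t - s2)) (fun t => Rmax 0 (U t
    + V t - s))).
  + rewrite RInt_plus_R by (apply Ex; assumption). apply Rplus_le_compat; [apply HU | apply HV].
  + rewrite Rmin_left, Rmax_right by lra. intros t Ht. apply Hs. lra.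
Qed.

(** * Logarithms and the final comparison *)

Lemma holo_log (q : C -> C) : holo 1 q -> q 0%C = 1%C -> (forall z, Cmod z < 1 -> q z <> 0%C) ->
  exists L, holo 1 L /\ forall z, Cmod z < 1 -> q z = Cexp (L z).
Proof.
intros Hq q0 Nq. pose proof (holo_derive 1 q Hq) as Hq1.
assert (H : holo 1 (fun z => C_derive q z / q z)%C).
{ intros z Hz. eexists. apply der_div; [apply Nq, Hz | apply (holo_C_derive 1); assumption
    | apply (holo_C_derive 1); assumption]. }
destruct (disk_primitive 1 _ Rlt_0_1 H) as [L [L0 HL]].
exists L. split; [intros z Hz; eexists; apply HL, Hz|]. intros z Hz.
pose (K := fun z => (q z * Cexp (- L z))%C).
assert (DK : forall y, Cmod y < 1 -> cder K y 0%C).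
{ intros y Hy. eapply der_eq.
  2: { apply der_mult; [apply (holo_C_derive 1); assumption|].
       apply (der_comp _ Cexp (fun z => - L z)%C); [apply cder_Cexp | apply der_opp, HL, Hy]. }
  cbv beta. field. apply Nq, Hy. }
assert (E : seg (fun _ => 0%C) 0 z = (K z - K 0)%C).
{ apply seg_FTC.
  - intros t Ht. apply DK. apply Cmod_segment_lt; [exact Ht | rewrite Cmod_0; lra | exact Hz].
  - apply contseg_const. }
assert (K0 : K 0%C = 1%C).
{ unfold K. rewrite q0, L0. replace (- 0)%C with (RtoC 0) by ring. rewrite Cexp_0. ring. }
unfold seg in E. rewrite CInt_const, K0 in E.
assert (Kz : K z = 1%C).
{ replace (K z) with ((K z - 1) + 1)%C by ring. rewrite <- E. ring. }
replace (q z) with (q z * (Cexp (L z) * Cexp (- L z)))%C by (rewrite Cexp_opp; ring).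
replace (q z * (Cexp (L z) * Cexp (- L z)))%C with (K z * Cexp (L z))%C by (unfold K; ring).
rewrite Kz. ring.
Qed.

Lemma ln_Cmod_Cexp (z : C) : ln (Cmod (Cexp z)) = fst z.
Proof. rewrite Cmod_Cexp. apply ln_exp. Qed.

Lemma ln_nondecreasing (x y : R) : 0 < x -> x <= y -> ln x <= ln y.
Proof. intros Hx [H | ->]; [apply Rlt_le, ln_increasing; assumption | apply Rle_refl]. Qed.

Lemma polar_opp (r t : R) : polar r (- t) = Cconj (polar r t).
Proof. unfold polar, Cconj. rewrite cos_neg, sin_neg. apply injective_projections; simpl; ring. Qed.

Lemma koebe_derive (z : C) : (1 - z)%C <> 0%C ->
  C_derive koebe z = ((1 + z) / ((1 - z) * (1 - z) * (1 - z)))%C.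
Proof.
intros N. apply cder_C_derive. eapply der_eq.
2: { apply (der_div _ (fun z => z) (fun z => (1 - z) * (1 - z))%C z 1 (- (1) * (1 - z)
  + (1 - z) * - (1))%C).
     - apply Cmult_neq_0; exact N.
     - apply der_embed.
     - assert (D : cder (fun z => 1 - z)%C z (- (1))%C).
       { eapply der_eq; [|apply der_minus; [apply der_const | apply der_embed]]. ring. }
       apply (der_mult _ (fun z => 1 - z)%C (fun z => 1 - z)%C); exact D. }
cbv beta. field. exact N.
Qed.

(** The factor [1 + z] cancels in [k' / L_0], which leaves [(1 - z)^(-2)]. *)
Lemma ln_extremal_modulus (n : nat) (alpha a b : R) (z : C) : Cmod z < 1 ->
  Lfun alpha a b (n - 1) z <> 0%C ->
  - ln (extremal_modulus n alpha a b z)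
  = - ln (Cmod (Lfun alpha a b (n - 1) z)) + 2 * (1 - alpha) * ln (Cmod (1 - z)).
Proof.
intros Hz Nq. unfold extremal_modulus.
assert (N1 : (1 - z)%C <> 0%C) by (apply sub_neq_0; rewrite Cmod_1; exact Hz).
assert (N2 : (1 + z)%C <> 0%C).
{ replace (1 + z)%C with (1 - - z)%C by ring. apply sub_neq_0. rewrite Cmod_1, Cmod_opp. exact Hz. }
pose proof (Cmod_pos _ Nq). pose proof (Cmod_pos _ N1). pose proof (Cmod_pos _ N2).
rewrite koebe_derive by exact N1. unfold L0.
rewrite !Cmod_div by (repeat apply Cmult_neq_0; exact N1). rewrite !Cmod_mult.
set (x := Cmod (1 - z)) in *. set (y := Cmod (1 + z)) in *.
assert (0 < x * x * x) by (repeat apply Rmult_lt_0_compat; assumption).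
unfold Rdiv at 1. rewrite ln_mult, ln_mult, ln_Rinv; try apply exp_pos; try assumption;
  [|apply Rmult_lt_0_compat; [assumption | apply exp_pos] | apply Rinv_0_lt_compat, exp_pos].
unfold Rpower. rewrite !ln_exp. unfold Rdiv.
rewrite !ln_mult, !ln_Rinv, !ln_mult; try assumption; try (apply Rinv_0_lt_compat; assumption);
  try (repeat apply Rmult_lt_0_compat; assumption).
ring.
Qed.

Theorem theorem2 (a b alpha : R) (n : nat) (Phi : R -> R) (f : C -> C) (r : R)
  (hab : -1 <= b /\ b < a /\ a <= 1)
  (halpha : 0 < alpha <= 1)
  (hn : (1 <= n)%nat)
  (hPhi_convex : convex Phi)
  (hPhi_mono : forall x y : R, x <= y -> Phi x <= Phi y)
  (hf : class_T n alpha a b f)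
  (hr : 0 < r < 1) :
  RInt (fun theta : R => Phi (- ln (Cmod (C_derive f (polar r theta))))) (- PI) PI
  <= RInt (fun theta : R => Phi (- ln (extremal_modulus n alpha a b (polar r theta))))
       (- PI) PI.
Proof.
pose proof PI_RGT_0 as HP. assert (Ha : 0 < alpha) by lra.
destruct hf as [_ [F [[l [Hl [l0 [Ef EF]]]] HJ]]]. apply analytic_disk_holo in Hl.
assert (Dl : forall z, Cmod z < 1 -> cder l z (C_derive l z)) by (intros;
  apply (holo_C_derive 1); assumption).
assert (Na : RtoC alpha <> 0%C) by (apply RtoC_neq_0; lra).
set (q := Lfun alpha a b (n - 1)).
destruct (Lfun_profile alpha a b (n - 1) Ha hab) as [Cq q0 Rq Sq Aq]. fold q in Cq, q0, Rq, Sq, Aq.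
assert (Nq : forall z, Cmod z < 1 -> q z <> 0%C).
{ intros z Hz E. specialize (Rq z Hz). rewrite E in Rq. simpl in Rq. lra. }
assert (DF : forall z, Cmod z < 1 -> cder F z (Cexp (RtoC alpha * l z) * (RtoC alpha
  * C_derive l z))%C).
{ intros z Hz. apply der_local with (f := fun z => Cexp (RtoC alpha * l z)) (eta := 1 - Cmod z);
    [lra| |].
  - intros y Hy. pose proof (Cmod_triangle_rev y z). symmetry. apply EF. unfold unit_disk. lra.
  - apply (der_comp _ Cexp (fun z => RtoC alpha * l z)%C); [apply cder_Cexp | apply der_scal, Dl,
      Hz]. }
assert (HF : holo 1 F) by (intros z Hz; eexists; apply DF, Hz).
(* [n - 1] averagings lead from [p_n] down to [p_1], the one that occurs in [f']. *)
pose proof (janowski_subordinate alpha F Ha HF n a b (n - 1) hab HJ ltac:(lia)) as Sub.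
replace (n - (n - 1))%nat with 1%nat in Sub by lia. fold q in Sub.
destruct Sub as [w [Hw [W0 [Bw Ew]]]].
assert (P1 : forall z, Cmod z < 1 -> (Cexp (RtoC alpha * l z) * (1 + z * C_derive l z))%C
  = q (w z)).
{ intros z Hz. rewrite <- Ew by exact Hz.
  change (twisted_salagean alpha 1 F z) with (RtoC alpha * F z + z * C_derive F z)%C.
  rewrite (cder_C_derive _ _ _ (DF z Hz)), EF by exact Hz. rewrite pow_1. field. exact Na. }
assert (Bw1 : forall z, Cmod z < 1 -> Cmod (w z) < 1) by (intros z Hz; specialize (Bw z Hz); lra).
destruct (koebe_lift_bound alpha l halpha Hl l0) as [Hv [v0 Bv]].
{ intros z Hz. rewrite P1 by exact Hz. apply Rq, Bw1, Hz. }
set (v := koebe_lift l) in *.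
(* The logarithms of [q] and of [1 - z] turn both terms into real parts of holomorphic functions, to
   which Littlewood's principle applies. *)
destruct (holo_log q (proj1 Cq) q0 Nq) as [L [HL EL]].
assert (N1 : forall z, Cmod z < 1 -> (1 - z)%C <> 0%C).
{ intros z Hz. apply sub_neq_0. rewrite Cmod_1. exact Hz. }
destruct (holo_log (fun z => 1 - z)%C) as [M [HM EM]].
{ intros z Hz. eexists. apply der_minus; [apply der_const | apply der_embed]. }
{ ring. }
{ exact N1. }
assert (Df : forall z, Cmod z < 1 -> - ln (Cmod (C_derive f z))
   = - ln (Cmod (q (w z))) + 2 * (1 - alpha) * ln (Cmod (1 - v z))).
{ intros z Hz.
  assert (E : C_derive f z = (q (w z) * Cexp (RtoC (1 - alpha) * l z))%C).
  { rewrite <- P1 by exact Hz.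
    transitivity (Cexp (l z) * (1 + z * C_derive l z))%C.
    - apply cder_C_derive.
      apply der_local with (f := fun z => (z * Cexp (l z))%C) (eta := 1 - Cmod z); [lra| |].
      + intros y Hy. pose proof (Cmod_triangle_rev y z). symmetry. apply Ef. unfold unit_disk. lra.
      + eapply der_eq.
        2: { apply (der_mult _ (fun z => z) (fun z => Cexp (l z)) z 1 (Cexp (l z)
          * C_derive l z)%C);
             [apply der_embed | apply (der_comp _ Cexp l); [apply cder_Cexp | apply Dl, Hz]]. }
        cbv beta. ring.
    - replace (Cexp (l z)) with (Cexp (RtoC alpha * l z) * Cexp (RtoC (1 - alpha) * l z))%C;
        [ring|].
      rewrite <- Cexp_plus. f_equal. rewrite RtoC_minus. ring. }
  pose proof (Cmod_pos _ (Nq (w z) (Bw1 z Hz))).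
  rewrite E, Cmod_mult, ln_mult, ln_Cmod_Cexp; [|assumption | apply Cmod_pos, Cexp_neq_0].
  unfold v, koebe_lift. replace (1 - (1 - Cexp (- (l z / RtoC 2))))%C
    with (Cexp (- (l z / RtoC 2))) by ring.
  rewrite ln_Cmod_Cexp. unfold Cdiv. rewrite <- RtoC_half. destruct (l z) as [x y]. simpl. field. }
assert (Pz : forall t, Cmod (polar r t) < 1) by (intros t; rewrite Cmod_polar; lra).
pose (U := fun t => - ln (Cmod (q (polar r t)))).
pose (V := fun t => 2 * (1 - alpha) * ln (Cmod (1 - polar r t))).
pose (U1 := fun t => - ln (Cmod (q (w (polar r t))))).
pose (V1 := fun t => 2 * (1 - alpha) * ln (Cmod (1 - v (polar r t)))).
(* The threshold is absorbed into the holomorphic function, so the hinge at [0] covers every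
   threshold. *)
pose (hU := fun s z => (- L z - RtoC s)%C).
pose (hV := fun s z => (RtoC (2 * (1 - alpha)) * M z - RtoC s)%C).
assert (HhU : forall s, holo 1 (hU s)).
{ intros s z Hz. destruct (HL z Hz) as [d Hd]. eexists. apply der_minus; [apply der_opp, Hd
    | apply der_const]. }
assert (HhV : forall s, holo 1 (hV s)).
{ intros s z Hz. destruct (HM z Hz) as [d Hd]. eexists. apply der_minus; [apply der_scal, Hd
    | apply der_const]. }
assert (FU : forall s z, Cmod z < 1 -> fst (hU s z) = - ln (Cmod (q z)) - s).
{ intros s z Hz. rewrite EL, ln_Cmod_Cexp by exact Hz. reflexivity. }
assert (FV : forall s z, Cmod z < 1 -> fst (hV s z) = 2 * (1 - alpha) * ln (Cmod (1 - z)) - s).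
{ intros s z Hz. rewrite EM, ln_Cmod_Cexp by exact Hz. unfold hV. simpl. ring. }
assert (Bv1 : forall z, Cmod z < 1 -> Cmod (v z) < 1) by (intros z Hz; specialize (Bv z Hz); lra).
assert (CReal : forall (g : R -> R) (h x : C -> C), holo 1 h -> holo 1 x ->
  (forall z, Cmod z < 1 -> Cmod (x z) < 1) ->
  (forall t, g t = fst (h (x (polar r t)))) -> forall t, rcont (fun t => RtoC (g t)) t).
{ intros g h x Hh Hx Bx E t.
  apply cont_local with (f := fun t => RtoC (fst (h (x (polar r t))))) (eta := 1); [lra| |].
  - intros y _. rewrite E. reflexivity.
  - apply cont_Re. apply (cont_comp RtoC h (fun t => x (polar r t))).
    + apply (holo_cont 1 h Hh), Bx, Pz.
    + apply (holo_circle_cont 1); assumption. }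
assert (Hid : holo 1 (fun z => z)) by (intros z _; eexists; apply der_embed).
assert (CU : forall t, rcont (fun t => RtoC (U t)) t).
{ apply (CReal U (hU 0) (fun z => z)); auto. intros t. rewrite FU by apply Pz. unfold U. ring. }
assert (CV : forall t, rcont (fun t => RtoC (V t)) t).
{ apply (CReal V (hV 0) (fun z => z)); auto. intros t. rewrite FV by apply Pz. unfold V. ring. }
assert (CU1 : forall t, rcont (fun t => RtoC (U1 t)) t).
{ apply (CReal U1 (hU 0) w); auto. intros t. rewrite FU by apply Bw1, Pz. unfold U1. ring. }
assert (CV1 : forall t, rcont (fun t => RtoC (V1 t)) t).
{ apply (CReal V1 (hV 0) v); auto. intros t. rewrite FV by apply Bv1, Pz. unfold V1. ring. }
rewrite (RInt_ext _ (fun t => Phi (U1 t + V1 t))) by (intros t _; rewrite Df by apply Pz;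
  reflexivity).
rewrite (RInt_ext (fun t => Phi (- ln (extremal_modulus n alpha a b (polar r t)))) (fun t => Phi (U
  t + V t))).
2: { intros t _. rewrite ln_extremal_modulus by (apply Pz || apply Nq, Pz). reflexivity. }
apply convex_order; auto; [lra | intros t; apply rcont_R_plus; auto | intros t;
  apply rcont_R_plus; auto|].
intros s. apply similarly_ordered_hinge; auto.
- intros t. unfold U. rewrite polar_opp, Sq, Cmod_Cconj by apply Pz. reflexivity.
- intros t. unfold V. rewrite polar_opp. rewrite <- (Cmod_Cconj (1 - polar r t)%C).
  do 3 f_equal. unfold Cconj. apply injective_projections; simpl; ring.
- intros t t' Ht Ht'. unfold U. apply Ropp_le_contravar, ln_nondecreasing.
  + apply Cmod_pos, Nq, Pz.
  (* Equal radii turn the angular form into [|q|^2]. *)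
  + pose proof (Aq r r t t' ltac:(lra) ltac:(lra) Ht Ht') as A. rewrite !Cconj_mult_Cmod in A.
    change (Cmod (q (polar r t')) * Cmod (q (polar r t')) <= Cmod (q (polar r t))
      * Cmod (q (polar r t))) in A.
    pose proof (Cmod_nonneg (q (polar r t))). pose proof (Cmod_nonneg (q (polar r t'))). nra.
- intros t t' Ht Ht'. unfold V. apply Rmult_le_compat_l; [lra|]. apply ln_nondecreasing.
  + apply Cmod_pos, N1, Pz.
  + assert (S : forall x, Cmod (1 - polar r x) * Cmod (1 - polar r x) = 1 - 2 * r * cos x + r * r).
    { intros x. rewrite Cmod_sqr. simpl. pose proof (sin2_cos2 x) as SC. unfold Rsqr in SC.
      replace ((1 + - (r * cos x)) * (1 + - (r * cos x)) + (0 + - (r * sin x)) * (0 + - (r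
        * sin x)))
        with (1 - 2 * r * cos x + r * r * (sin x * sin x + cos x * cos x)) by ring. rewrite SC.
          ring. }
    pose proof (S t). pose proof (S t'). assert (cos t' <= cos t) by (apply cos_decr_1; lra).
    pose proof (Cmod_nonneg (1 - polar r t)%C). pose proof (Cmod_nonneg (1 - polar r t')%C). nra.
- intros s'.
  rewrite (RInt_ext _ (fun t => Rmax 0 (fst (hU s' (w (polar r t)))))) by (intros t _;
    rewrite FU by apply Bw1, Pz; reflexivity).
  rewrite (RInt_ext (fun t => Rmax 0 (U t - s')) (fun t => Rmax 0 (fst (hU s' (polar r t)))))
    by (intros t _; rewrite FU by apply Pz; reflexivity).
  apply subordinate_hinge; auto.
- intros s'.
  rewrite (RInt_ext _ (fun t => Rmax 0 (fst (hV s' (v (polar r t)))))) by (intros t _;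
    rewrite FV by apply Bv1, Pz; reflexivity).
  rewrite (RInt_ext (fun t => Rmax 0 (V t - s')) (fun t => Rmax 0 (fst (hV s' (polar r t)))))
    by (intros t _; rewrite FV by apply Pz; reflexivity).
  apply subordinate_hinge; auto.
Qed.
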